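(* Consider the model in which one observes $Y=(Y_1,Y_2,\dots)$ with $Y_i=\kappa_i\mu_{0,i}+n^{-1/2}Z_i$, $i\ge1$, where $Z_1,Z_2,\dots$ are i.i.d. standard normal, $\mu_0\in\ell_2$, and $(\kappa_i)$ is a known sequence with $C^{-1}i^{-p}\le\kappa_i\le Ci^{-p}$ for some $p\ge0$, $C\ge1$. Define \[ \ell_n(\alpha)=-\frac12\sum_{i=1}^\infty\Big(\log\Big(1+\frac{n}{i^{1+2\alpha}\kappa_i^{-2}}\Big)-\frac{n^2}{i^{1+2\alpha}\kappa_i^{-2}+n}Y_i^2\Big), \] and, with $h_n$ defined by \[ h_n(\alpha)=\frac{1+2\alpha+2p}{n^{1/(1+2\alpha+2p)}\log n}\sum_{i=1}^{\infty}\frac{n^2 i^{1+2\alpha}\mu_{0,i}^2\log i}{(i^{1+2\alpha}\kappa_i^{-2}+n)^2}, \] set $\underline{\alpha}_n=\inf\{\alpha>0:h_n(\alpha)>l\}\wedge\sqrt{\log n}$ and $\overline{\alpha}_n=\inf\{\alpha>0:h_n(\alpha)>L(\log n)^2\}$ for constants $0<l<L$. Let $\beta>0$, $\gamma>0$. Then for every $R>0$ the constants $l$ and $L$ can be chosen such that \[ \inf_{\mu_0\in\mathcal{B}(R)}\mathrm{P}_0\Big(\operatorname*{argmax}_{\alpha\in[0,\log n]}\ell_n(\alpha)\in[\underline{\alpha}_n,\overline{\alpha}_n]\Big)\to 1\quad(n\to\infty), \] where either $\mathcal{B}(R)=\{\mu_0\in\ell_2:\|\mu_0\|_\beta\le R\}$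 or $\mathcal{B}(R)=\{\mu_0\in\ell_2:\|\mu_0\|_{A^\gamma}\le R\}$.
   Context: $\mathrm{P}_0$ denotes the law of $Y$ under the true parameter $\mu_0$. $\ell_n$ is the marginal log-likelihood of $\alpha$ (relative to an infinite product of $N(0,1/n)$ laws) when $\mu\sim\bigotimes_i N(0,i^{-1-2\alpha})$; it is a.s. continuous on $[0,\log n]$ and the argmax is any maximizer (if not unique, any value may be chosen). Sobolev norm $\|\mu\|_\beta^2=\sum_i i^{2\beta}\mu_i^2$, analytic norm $\|\mu\|_{A^\gamma}^2=\sum_i e^{2\gamma i}\mu_i^2$. Infimum of the empty set is $+\infty$. *)

(* Defs.v *)
From HB Require Import structures.
From mathcomp Require Import all_boot all_order all_algebra.
From mathcomp Require Import all_classical all_reals all_analysis.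
Set Implicit Arguments. Unset Strict Implicit. Unset Printing Implicit Defensive.
Import Order.TTheory GRing.Theory Num.Theory.
Import numFieldNormedType.Exports.
Local Open Scope classical_set_scope.
Local Open Scope ring_scope.

Section defs.
Variable R : realType.

(* Sequences are indexed by nat; only indices i >= 1 are used
   (index 0 is ignored everywhere). *)

Definition kappa_cond (p C : R) (kappa : nat -> R) : Prop :=
  forall i : nat, (1 <= i)%N ->
    C^-1 * (i%:R `^ (- p)) <= kappa i /\ kappa i <= C * (i%:R `^ (- p)).

Definition in_l2 (mu : nat -> R) : Prop :=
  (\sum_(1 <= i <oo) ((mu i) ^+ 2)%:E < +oo)%E.

Definition sobolev_ball (beta Rad : R) (mu : nat -> R) : Prop :=
  in_l2 mu /\
  (\sum_(1 <= i <oo) ((i%:R `^ (2 * beta)) * (mu i) ^+ 2)%:E <= (Rad ^+ 2)%:E)%E.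

Definition analytic_ball (gamma Rad : R) (mu : nat -> R) : Prop :=
  in_l2 mu /\
  (\sum_(1 <= i <oo) (expR (2 * gamma * i%:R) * (mu i) ^+ 2)%:E <= (Rad ^+ 2)%:E)%E.

Definition obsY (kappa mu0 : nat -> R) (n : nat) (Zw : nat -> R) : nat -> R :=
  fun i => kappa i * mu0 i + (Num.sqrt n%:R)^-1 * Zw i.

Definition sigk (kappa : nat -> R) (alpha : R) (i : nat) : R :=
  (i%:R `^ (1 + 2 * alpha)) * (kappa i ^+ 2)^-1.

Definition ell_n (kappa : nat -> R) (n : nat) (y : nat -> R) (alpha : R) : R :=
  - 2^-1 * limn (fun N => \sum_(1 <= i < N)
     (ln (1 + n%:R / sigk kappa alpha i)
      - (n%:R ^+ 2 / (sigk kappa alpha i + n%:R)) * (y i) ^+ 2)).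

Definition h_n (p : R) (kappa mu0 : nat -> R) (n : nat) (alpha : R) : R :=
  (1 + 2 * alpha + 2 * p) / (n%:R `^ ((1 + 2 * alpha + 2 * p)^-1) * ln n%:R)
  * limn (fun N => \sum_(1 <= i < N)
      (n%:R ^+ 2 * (i%:R `^ (1 + 2 * alpha)) * (mu0 i) ^+ 2 * ln i%:R
       / (sigk kappa alpha i + n%:R) ^+ 2)).

(* underline alpha_n = inf {alpha > 0 : h_n(alpha) > l} /\ sqrt(log n),
   infimum in the extended reals (inf of the empty set = +oo) *)
Definition alpha_low (p : R) (kappa mu0 : nat -> R) (n : nat) (l : R) : \bar R :=
  Order.min
    (ereal_inf [set a%:E | a in [set a : R | 0 < a /\ l < h_n p kappa mu0 n a]])
    (Num.sqrt (ln n%:R))%:E.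

Definition alpha_up (p : R) (kappa mu0 : nat -> R) (n : nat) (L : R) : \bar R :=
  ereal_inf [set a%:E | a in
     [set a : R | 0 < a /\ L * (ln n%:R) ^+ 2 < h_n p kappa mu0 n a]].

Definition is_argmax (f : R -> R) (lo hi a : R) : Prop :=
  lo <= a <= hi /\ forall b, lo <= b <= hi -> f b <= f a.

Definition iid_std_normal d (T : measurableType d) (P : probability T R)
    (Z : nat -> T -> R) : Prop :=
  (forall i, measurable_fun setT (Z i)) /\
  (forall i (B : set R), measurable B ->
     P (Z i @^-1` B) = normal_prob (0 : R) 1 B) /\
  (forall (s : seq nat) (B : nat -> set R), uniq s ->
     (forall i, measurable (B i)) ->
     P (\bigcap_(i in [set i | i \in s]) (Z i @^-1` B i))
     = (\prod_(i <- s) P (Z i @^-1` B i))%E).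

Definition good_event d (T : measurableType d) (Z : nat -> T -> R)
    (p : R) (kappa mu0 : nat -> R) (n : nat) (l L : R) : set T :=
  [set w | forall a, is_argmax (ell_n kappa n (obsY kappa mu0 n (fun i => Z i w)))
                       0 (ln n%:R) a ->
     (alpha_low p kappa mu0 n l <= a%:E)%E /\ (a%:E <= alpha_up p kappa mu0 n L)%E].

End defs.

(* Main.v *)
Require Import Defs.
From HB Require Import structures.
From mathcomp Require Import all_boot all_order all_algebra.
From mathcomp Require Import all_classical all_reals all_analysis.
From mathcomp Require Import measurable_realfun zify ring lra.
Set Implicit Arguments.
Unset Strict Implicit.
Unset Printing Implicit Defensive.
Import Order.TTheory GRing.Theory Num.Theory.
Import numFieldNormedType.Exports.
Local Open Scope classical_set_scope.
Local Open Scope ring_scope.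

(** Write [s = 1 + 2 alpha + 2 p] and [J = n^(1/s)], so that [h_n] is [sum d_i m_i^2] divided
    by [J ln J], where [m_i = sqrt n kappa_i mu_i] and [d_i] is, up to the factor [-2], the
    derivative in [alpha] of the shrinkage factor [g_i = n / (sigma_i + n)].  No derivative of
    the likelihood is taken: [ell] is compared at two points at distance of order [1 / ln n].

    Moving right by [2 / ln n] gains an entropy term of order [J ln J / ln n].  As long as
    [h_n <= l] the signal costs at most [l] times as much, and the noise is a sum of
    independent centered variables of standard deviation [O(J^(7/8)) / ln n]; a union bound
    over a grid of [(ln n)^2] cells, where [J >= exp (c sqrt (ln n))] because
    [alpha <= sqrt (ln n)], excludes a maximizer to the left of [alpha_low].

    Let [b] be the point [1 / ln n] to the left of [alpha_up].  Any [alpha > alpha_up] loses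
    against [b]: the signal lost between them is of order [L J (ln n)^2 / s], while the entropy
    and the noise at [b] are only [O(s J)] and [O(J)].

    Both comparisons hold for infinitely many partial sums of the series defining [ell], which
    suffices since these series converge almost surely at every [alpha >= 0]. *)

(** * Moments of the normal law *)

(** The step [1 / ln n] is the scale on which the prior precision changes by a bounded factor for
    all indices up to a fixed power of [n]. Increments of the shrinkage factor are then comparable
    with [slope] at one end of the interval, which is how [h_n] takes the place of a derivative.

    The two sides differ. On the left, gain and signal have the same order, so the noise must be
    centered and controlled uniformly over a cell; a cell fails with probability [O(J^(-1/8))], and
    the cap [sqrt (ln n)] lets this beat the number of cells. On the right, signal over entropy is
    of order [L (ln n)^2 / s^2] with [s = O(ln n)], so a large [L] wins even with crude bounds: the
    noise is dominated by a multiple of [sum g_i z_i^2] taken at [b], whatever the competing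
    [alpha], and no grid is used.

    The ball enters only through a bound [Q] on [sum i^(2 beta) mu_i^2], valid on analytic balls
    too. It forces [alpha_up >= beta] for large [n], so that [s] at [b] exceeds 1 by at least
    [beta]; this keeps [sum g_i] at [b] of order [J] uniformly. *)

Section affine.
Context d (T : measurableType d) {R : realType} (P : probability T R).

Lemma integrable_affine (f : T -> R) (a u : R) :
  P.-integrable setT (fun x => (f x)%:E) ->
  P.-integrable setT (fun x => (a + u * f x)%:E).
Proof.
move=> intf; have -> : (fun x => (a + u * f x)%:E) =
    (cst a%:E \+ (fun x => u%:E * (f x)%:E))%E.
  by apply/funext => x; rewrite EFinD EFinM.
apply: integrableD => //; first exact: finite_measure_integrable_cst.
exact: integrableZl.
Qed.

Lemma integral_affine (f : T -> R) (a u e : R) :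
  P.-integrable setT (fun x => (f x)%:E) -> (\int[P]_x (f x)%:E = e%:E)%E ->
  (\int[P]_x (a + u * f x)%:E = (a + u * e)%:E)%E.
Proof.
move=> intf inte; under eq_integral do rewrite EFinD EFinM.
rewrite integralD//; [|exact: finite_measure_integrable_cst|exact: integrableZl].
by rewrite integralZl// (integral_cst P measurableT) [X in (_ * X)%E]probability_setT mule1 inte.
Qed.

Lemma ge0_integral_affine (f : T -> R) (a u : R) : 0 <= a -> 0 <= u ->
  measurable_fun setT f -> (forall o, 0 <= f o) ->
  (\int[P]_x (a + u * f x)%:E = a%:E + u%:E * \int[P]_x (f x)%:E)%E.
Proof.
move=> a0 u0 mf f0; under eq_integral do rewrite EFinD EFinM.
have mf' : measurable_fun setT (fun x => (f x)%:E) by exact/measurable_EFinP.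
rewrite ge0_integralD//.
- rewrite (integral_cst P measurableT) [X in (_ * X)%E]probability_setT mule1.
  by rewrite ge0_integralZl// => x _; rewrite lee_fin.
- by move=> x _; rewrite -EFinM lee_fin mulr_ge0.
- exact: measurable_funeM.
Qed.

End affine.

Section normal_moments.
Context {R : realType}.
Local Notation mu := (@lebesgue_measure R).
Local Notation normal01 := (normal_prob (0 : R) 1).

(** The density and the Radon-Nikodym derivative have the same integral over every measurable set,
    hence agree almost everywhere. *)
Lemma ge0_integral_normal_prob (m s : R) (f : R -> \bar R) :
  measurable_fun setT f -> (forall x, 0 <= f x)%E ->
  (\int[normal_prob m s]_x f x =
   \int[mu]_x (f x * (normal_pdf m s x)%:E))%E.
Proof.
move=> mf f0.
rewrite -(Radon_Nikodym_SigmaFinite.change_of_variables (normal_prob_dominates m s))//.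
have mRN := measurable_int _
  (Radon_Nikodym_SigmaFinite.f_integrable (normal_prob_dominates m s)).
apply: ae_eq_integral => //.
- exact: emeasurable_funM.
- apply: emeasurable_funM => //.
  by apply/measurable_EFinP; exact: measurable_normal_pdf.
- apply: ae_eqe_mul2l.
  apply: integral_ae_eq => //.
  + exact: Radon_Nikodym_SigmaFinite.f_integrable (normal_prob_dominates m s).
  + by apply/measurable_EFinP; exact: measurable_normal_pdf.
  + move=> E _ mE.
    by rewrite -Radon_Nikodym_SigmaFinite.f_integral//; exact: normal_prob_dominates.
Qed.

(** Completing the square: the tilted density is [expR (u^2 / 2)] times the normal density of mean
    [u]. *)
Lemma normal_expR (u : R) :
  (\int[normal01]_x (expR (u * x))%:E = (expR (u ^+ 2 / 2))%:E)%E.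
Proof.
rewrite ge0_integral_normal_prob; first last.
- by move=> x; rewrite lee_fin expR_ge0.
- apply/measurable_EFinP; exact: measurableT_comp.
under eq_integral => x _.
  rewrite -EFinM (_ : expR (u * x) * _ = expR (u ^+ 2 / 2) * normal_pdf u 1 x).
    rewrite EFinM; over.
  rewrite !normal_pdfE// mulrCA [RHS]mulrCA; congr (_ * _).
  rewrite /normal_fun -!expRD; congr expR.
  by field.
rewrite ge0_integralZl//=.
- by rewrite integral_normal_pdf mule1.
- by apply/measurable_EFinP; exact: measurable_normal_pdf.
- by move=> x _; rewrite lee_fin normal_pdf_ge0.
Qed.

(** The tilted density is a multiple of the centered normal density with variance
    [1 / (1 - 2 u)]. *)
Lemma normal_expR_sqr (u : R) : u < 2^-1 ->
  (\int[normal01]_x (expR (u * x ^+ 2))%:E = ((Num.sqrt (1 - 2 * u))^-1)%:E)%E.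
Proof.
move=> u2.
have t0 : 0 < 1 - 2 * u by lra.
set t := 1 - 2 * u in t0 *; set s := (Num.sqrt t)^-1.
have st0 : 0 < Num.sqrt t by rewrite sqrtr_gt0.
have s0 : 0 < s by rewrite invr_gt0.
have s2 : s ^+ 2 = t^-1 by rewrite exprVn sqr_sqrtr// ltW.
rewrite ge0_integral_normal_prob; first last.
- by move=> x; rewrite lee_fin expR_ge0.
- apply/measurable_EFinP; apply: measurableT_comp => //.
  by apply: measurable_funM => //; exact: measurable_funX.
under eq_integral => x _.
  rewrite -EFinM (_ : expR (u * x ^+ 2) * _ = s * normal_pdf 0 s x).
    rewrite EFinM; over.
  have pk : normal_peak 1 = s * normal_peak s.
    rewrite /normal_peak expr1n mul1r -mulrnAr sqrtrM ?sqr_ge0//.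
    rewrite sqrtr_sqr ger0_norm ?ltW// invfM mulrA divff ?mul1r//.
    by rewrite gt_eqF.
  rewrite !normal_pdfE ?gt_eqF// pk mulrCA -!mulrA; congr (_ * (_ * _)).
  rewrite /normal_fun -!expRD; congr expR; rewrite s2 /t.
  have t1 : 1 - 2 * u != 0 by rewrite gt_eqF.
  by field; rewrite t1.
rewrite ge0_integralZl//=.
- by rewrite integral_normal_pdf mule1.
- by apply/measurable_EFinP; exact: measurable_normal_pdf.
- by move=> x _; rewrite lee_fin normal_pdf_ge0.
- by rewrite lee_fin ltW.
Qed.


Lemma X4_le_expR (x : R) : x ^+ 4 <= 32 * expR (4^-1 * x ^+ 2).
Proof.
have : 1 + (4^-1 * x ^+ 2) ^+ 2 / 2`!%:R <= expR (4^-1 * x ^+ 2).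
  by apply: expR_ge1Dxn; rewrite mulr_ge0 ?sqr_ge0.
have -> : (4^-1 * (x : R) ^+ 2) ^+ 2 = x ^+ 4 / 16 by field.
have -> : 2`!%:R = 2 :> R by [].
by set E := expR _; set y : R := x ^+ 4; lra.
Qed.

Lemma normal_integrable_X4 : normal01.-integrable setT (fun x : R => (x ^+ 4)%:E).
Proof.
apply: (@le_integrable _ _ _ normal01 _ measurableT _ (fun x : R => 32%:E * (expR (4^-1 * x ^+ 2)%R)%:E)%E).
- by apply/measurable_EFinP; exact: measurable_funX.
- move=> x _; rewrite -EFinM !abse_EFin lee_fin.
  rewrite [in leLHS]ger0_norm ?exprn_even_ge0// ger0_norm ?mulr_ge0 ?expR_ge0//.
  exact: X4_le_expR.
- apply: integrableZl => //; apply/integrableP; split.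
    apply/measurable_EFinP; apply: measurableT_comp => //.
    by apply: measurable_funM => //; exact: measurable_funX.
  under eq_integral do rewrite /= ger0_norm ?expR_ge0//.
  by rewrite normal_expR_sqr ?ltry//; lra.
Qed.

Lemma normal_integrable (f : R -> R) (c : R) : measurable_fun setT f ->
  (forall x, `|f x| <= c * (1 + x ^+ 4)) ->
  normal01.-integrable setT (fun x : R => (f x)%:E).
Proof.
move=> mf fc.
apply: (@le_integrable _ _ _ normal01 _ measurableT _ (fun x : R => c%:E * (1 + (x ^+ 4)%R%:E))%E).
- exact/measurable_EFinP.
- move=> x _; rewrite -EFinD -EFinM !abse_EFin lee_fin.
  exact: le_trans (fc x) (ler_norm _).
- apply: integrableZl => //; apply: integrableD => //.
    exact: finite_measure_integrable_cst.
  exact: normal_integrable_X4.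
Qed.

Lemma normal_integrable_X : normal01.-integrable setT (fun x : R => x%:E).
Proof.
apply: (normal_integrable (c := 1)) => // x; rewrite mul1r.
rewrite (_ : x ^+ 4 = (x ^+ 2) ^+ 2); last by rewrite -exprM.
have h1 := sqr_ge0 (x ^+ 2 - 2^-1); have h2 := sqr_ge0 (x - 2^-1).
have h3 := sqr_ge0 (x + 2^-1).
by rewrite ler_norml; apply/andP; split; nra.
Qed.

Lemma normal_integrable_X2 : normal01.-integrable setT (fun x : R => (x ^+ 2)%:E).
Proof.
apply: (normal_integrable (c := 1)) => [|x]; first exact: measurable_funX.
rewrite mul1r ger0_norm ?sqr_ge0// (_ : x ^+ 4 = (x ^+ 2) ^+ 2); last by rewrite -exprM.
by have h1 := sqr_ge0 (x ^+ 2 - 2^-1); nra.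
Qed.

(* Reads off the linear coefficient of a Laplace transform, whose value is bounded on both
   sides of [0]; this gives the first two moments without integration by parts. *)
Lemma eq0_of_quadratic_bound (a K : R) : 0 <= K ->
  (forall u, - 4^-1 <= u <= 4^-1 -> u * a <= K * u ^+ 2) -> a = 0.
Proof.
move=> K0 H; apply/eqP/negPn/negP => a0.
pose e := Num.min 4^-1 (`|a| / (2 * (K + 1))).
have e0 : 0 < e by rewrite lt_min divr_gt0 ?normr_gt0 ?mulr_gt0 ?ltr_pwDr//; lra.
have e4 : e <= 4^-1 by rewrite ge_min lexx.
have ea : 2 * (K + 1) * e <= `|a|.
  by rewrite mulrC -ler_pdivlMr ?ge_min ?lexx ?orbT// mulr_gt0// ltr_pwDr.
have [a1|a1] := ltP 0 a.
  have := H e; rewrite gtr0_norm// in ea.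
  by move=> /(_ _) h; have := h ltac:(apply/andP; split; lra); nra.
have {}a1 : a < 0 by rewrite lt_neqAle a0.
have := H (- e); rewrite ltr0_norm// in ea.
by move=> /(_ _) h; have := h ltac:(apply/andP; split; lra); nra.
Qed.

Lemma normal_integral_le (f g : R -> R) :
  normal01.-integrable setT (fun x : R => (f x)%:E) -> measurable_fun setT g ->
  (forall x, f x <= g x) -> (forall x, 0 <= g x) ->
  (\int[normal01]_x (f x)%:E <= \int[normal01]_x (g x)%:E)%E.
Proof.
move=> intf mg fg g0.
have [goo|] := ltP (\int[normal01]_x (g x)%:E)%E +oo%E; last first.
  by rewrite leye_eq => /eqP ->; rewrite leey.
have intg : normal01.-integrable setT (fun x : R => (g x)%:E).
  apply/integrableP; split; first exact/measurable_EFinP.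
  by under eq_integral do rewrite /= ger0_norm//.
by apply: le_integral => // x _; rewrite lee_fin.
Qed.

(** Integrating [1 + u x <= expR (u x)] gives [1 + u m <= expR (u^2 / 2) <= 1 + u^2] for the mean
    [m] and small [u] of either sign, which forces [m = 0]. *)
Lemma normal_mean : (\int[normal01]_(x in [set: R]) x%:E = 0)%E.
Proof.
have intX := normal_integrable_X.
have fin := integrable_fin_num measurableT intX.
rewrite -(fineK fin); congr EFin; apply: (@eq0_of_quadratic_bound _ 1) => // u u4.
have : (\int[normal01]_x (1 + u * x)%:E <= (expR (u ^+ 2 / 2))%:E)%E.
  rewrite -normal_expR; apply: normal_integral_le.
  - exact: (integrable_affine 1 u intX).
  - by apply: measurableT_comp => //; exact: measurable_funM.
  - by move=> x; exact: expR_ge1Dx.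
  - by move=> x; exact: expR_ge0.
rewrite (integral_affine 1 u intX (esym (fineK fin))) lee_fin.
have : expR (u ^+ 2 / 2) <= 1 + u ^+ 2; last by lra.
have := expR_ge1Dx (- (u ^+ 2 / 2)); rewrite expRN => h.
have u1 : u ^+ 2 <= 1 by nra.
have e0 : 0 < expR (u ^+ 2 / 2) by exact: expR_gt0.
have : (1 - u ^+ 2 / 2) * expR (u ^+ 2 / 2) <= 1.
  by rewrite -ler_pdivlMr// div1r.
by have := sqr_ge0 u; nra.
Qed.

Lemma normal_sqr : (\int[normal01]_x (x ^+ 2)%:E = 1)%E.
Proof.
have intX := normal_integrable_X2.
have fin := integrable_fin_num measurableT intX.
rewrite -(fineK fin); congr EFin; apply/eqP; rewrite -subr_eq0; apply/eqP.
apply: (@eq0_of_quadratic_bound _ 4) => // u u4.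
have : (\int[normal01]_x (1 + u * x ^+ 2)%:E <= ((Num.sqrt (1 - 2 * u))^-1)%:E)%E.
  rewrite -normal_expR_sqr; last by lra.
  apply: normal_integral_le.
  - exact: (integrable_affine 1 u intX).
  - by apply: measurableT_comp => //; apply: measurable_funM => //; exact: measurable_funX.
  - by move=> x; exact: expR_ge1Dx.
  - by move=> x; exact: expR_ge0.
rewrite (integral_affine 1 u intX (esym (fineK fin))) lee_fin.
have t0 : 0 < 1 - 2 * u by lra.
have q0 : 0 < Num.sqrt (1 - 2 * u) by rewrite sqrtr_gt0.
have : (Num.sqrt (1 - 2 * u))^-1 <= 1 + u + 4 * u ^+ 2; last by lra.
have k0 : 0 < 1 + u + 4 * u ^+ 2 by nra.
rewrite -[leLHS]div1r ler_pdivrMr// mulrC.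
(* The bound [(1 - 2 u)^(-1/2) <= 1 + u + 4 u^2] is squared; the product exceeds 1 by
   [u^2 (5 - 10 u - 32 u^3)], which is nonnegative for [|u| <= 1/4]. *)
rewrite -(@expr_ge1 _ 2)// ?(mulr_ge0 (ltW q0) (ltW k0))// exprMn sqr_sqrtr ?(ltW t0)//.
have u3 : u * u ^+ 2 <= 4^-1 * 16^-1 by case/andP: u4 => ? ?; nra.
have : 0 <= u ^+ 2 * (5 - 10 * u - 32 * (u * u ^+ 2)).
  by apply: mulr_ge0; [exact: sqr_ge0|lra].
rewrite (_ : (1 - 2 * u) * (1 + u + 4 * u ^+ 2) ^+ 2 =
  1 + u ^+ 2 * (5 - 10 * u - 32 * (u * u ^+ 2))); first by lra.
by ring.
Qed.
End normal_moments.

(** * Sums of independent noise *)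

Section probability_facts.
Context d (T : measurableType d) {R : realType} (P : probability T R).

Lemma measurable_le_event (f : T -> R) (t : R) : measurable_fun setT f ->
  measurable [set o | t <= f o].
Proof.
move=> mf; rewrite -[X in measurable X]setTI.
by have := mf measurableT `[t, +oo[%classic (measurable_itv _); rewrite preimage_itvcy.
Qed.

Lemma markov_event (f : T -> R) (M t : R) : measurable_fun setT f ->
  (forall o, 0 <= f o) -> (\int[P]_o (f o)%:E <= M%:E)%E -> 0 < t ->
  (P [set o | (t <= f o)%R] <= (M / t)%:E)%E.
Proof.
move=> mf f0 fM t0.
have mA := measurable_le_event t mf.
have := le_integral_abse P measurableT (g := fun o => (f o)%:E)
  (iffRL (measurable_EFinP _ _) mf) t0.
rewrite setTI (_ : [set x | _] = [set o | t <= f o]); last first.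
  by apply/seteqP; split => o /=; rewrite lee_fin ger0_norm.
under eq_integral do rewrite /= ger0_norm//.
move=> /le_trans -/(_ _ fM) h.
have fin : P [set o | t <= f o] \is a fin_num by exact: fin_num_measure.
have : (t%:E * P [set o | (t <= f o)%R] <= M%:E)%E by exact: h.
by move: fin; case: (P _) => // r _; rewrite -EFinM !lee_fin mulrC -ler_pdivlMr.
Qed.

Lemma orthogonal_sum_sqr (U : nat -> T -> R) (v c : nat -> R) (s : seq nat) :
  uniq s ->
  (forall i j, P.-integrable setT (fun o => (U i o * U j o)%:E)) ->
  (forall i j, i != j -> (\int[P]_o (U i o * U j o)%:E = 0)%E) ->
  (forall i, (\int[P]_o (U i o ^+ 2)%:E <= (v i)%:E)%E) ->
  (\int[P]_o ((\sum_(i <- s) c i * U i o) ^+ 2)%:E <= (\sum_(i <- s) c i ^+ 2 * v i)%:E)%E.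
Proof.
move=> us intU U0 Uv.
have intc i j : P.-integrable setT (fun o => ((c i * c j) * (U i o * U j o))%:E).
  by under eq_fun do rewrite EFinM; exact: integrableZl.
under eq_integral => o _.
  rewrite (_ : (_ ^+ 2)%:E = \sum_(i <- s) \sum_(j <- s) ((c i * c j) * (U i o * U j o))%:E)%E.
    over.
  rewrite expr2 big_distrlr/= -sumEFin; apply: eq_bigr => i _.
  by rewrite -sumEFin; apply: eq_bigr => j _; congr EFin; ring.
rewrite integral_sum//; last by move=> i; exact: integrable_sum.
rewrite -sumEFin [leLHS]big_seq [leRHS]big_seq; apply: lee_sum => i si.
rewrite integral_sum// (bigD1_seq i)//= big1 ?adde0; last first.
  move=> j ji; under eq_integral do rewrite EFinM.
  by rewrite integralZl// U0 ?mule0// eq_sym.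
under eq_integral do rewrite EFinM.
rewrite integralZl// [leRHS]EFinM [(c i * c i)%R]mulrC; apply: lee_pmul => //.
- by rewrite lee_fin -expr2 sqr_ge0.
- by apply: integral_ge0 => o _; rewrite lee_fin -expr2 sqr_ge0.
- exact: Uv.
Qed.

End probability_facts.

Section iid_normal.
Context d (T : measurableType d) {R : realType} (P : probability T R).
Variable Z : nat -> T -> R.
Hypothesis HZ : iid_std_normal P Z.
Local Notation normal01 := (normal_prob (0 : R) 1).

Lemma iid_measurable i : measurable_fun setT (Z i).
Proof. by case: HZ. Qed.

Lemma iid_measurable_comp (f : R -> R) i : measurable_fun setT f ->
  measurable_fun setT (fun w => f (Z i w)).
Proof. by move=> mf; apply: measurableT_comp => //; exact: iid_measurable. Qed.

Lemma iid_ge0_integral (f : R -> R) i : measurable_fun setT f -> (forall x, 0 <= f x) ->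
  (\int[P]_w (f (Z i w))%:E = \int[normal01]_x (f x)%:E)%E.
Proof.
move=> mf f0.
have mZ : measurable_fun setT (Z i : T -> measurableTypeR R) := iid_measurable i.
transitivity (\int[pushforward P (Z i : T -> measurableTypeR R)]_x (f x)%:E)%E.
  rewrite ge0_integral_pushforward//; first exact/measurable_EFinP.
  by move=> x _; rewrite lee_fin.
apply: (eq_measure_integral (normal_prob 0 1)) => A mA _.
by case: HZ => _ [/(_ i A mA)].
Qed.

Lemma iid_pair_law i j : i != j -> forall X : set (measurableTypeR R * measurableTypeR R), measurable X ->
  (normal01 \x normal01)%E X = pushforward P (fun w => (Z i w : measurableTypeR R, Z j w : measurableTypeR R)) X.
Proof.
move=> ij.
have mZ : measurable_fun setT
    (fun w => (Z i w : measurableTypeR R, Z j w : measurableTypeR R)).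
  by apply: measurable_fun_pair; exact: iid_measurable.
apply: product_measure_unique => A B mA mB.
have [_ [law ind]] := HZ.
have := ind [:: i; j] (fun k => if k == i then A else B).
rewrite !big_cons big_nil mule1 eqxx eq_sym (negbTE ij) !law// => <-.
- congr (P _); apply/seteqP; split => [w [/= Aw Bw] k|w /= H].
    rewrite /= !inE => /orP[|] /eqP -> /=; first by rewrite eqxx.
    by rewrite eq_sym (negbTE ij).
  split; first by have := H i; rewrite /= !inE eqxx => /(_ isT).
  by have := H j; rewrite /= !inE eqxx orbT eq_sym (negbTE ij) => /(_ isT).
- by rewrite /= inE ij.
- by move=> k; case: ifP.
Qed.

Lemma iid_orthogonal (f g : R -> R) i j : i != j ->
  measurable_fun setT f -> measurable_fun setT g ->
  normal01.-integrable setT (fun x => (f x)%:E) ->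
  normal01.-integrable setT (fun x => (g x)%:E) ->
  (\int[normal01]_x (g x)%:E = 0)%E ->
  P.-integrable setT (fun w => (f (Z i w) * g (Z j w))%:E) /\
  (\int[P]_w (f (Z i w) * g (Z j w))%:E = 0)%E.
Proof.
move=> ij mf mg intf intg g0.
have mZ : measurable_fun setT
    (fun w => (Z i w : measurableTypeR R, Z j w : measurableTypeR R)).
  by apply: measurable_fun_pair; exact: iid_measurable.
have mfg : measurable_fun setT (fun z : measurableTypeR R * measurableTypeR R => f z.1 * g z.2).
  by apply: measurable_funM; apply: measurableT_comp.
have intp : (normal01 \x normal01)%E.-integrable setT (fun z : measurableTypeR R * measurableTypeR R => (f z.1 * g z.2)%:E).
  apply/integrable12ltyP; first exact/measurable_EFinP.
  have [mg1 goo] := integrableP _ _ _ intg.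
  have [mf1 foo] := integrableP _ _ _ intf.
  have int_abs x : (\int[normal01]_y `|(f x * g y)%:E| =
      `|(f x)%:E| * \int[normal01]_y `|(g y)%:E|)%E.
    under eq_integral => y _ do rewrite EFinM abseM.
    by rewrite ge0_integralZl//; apply: measurableT_comp.
  under eq_integral => x _ do rewrite int_abs.
  rewrite ge0_integralZr//; [|exact: measurableT_comp|exact: integral_ge0].
  by rewrite lte_mul_pinfty ?integral_ge0// ge0_fin_numE ?integral_ge0.
have lawP A : measurable A -> A `<=` setT ->
    pushforward P (fun w => (Z i w : measurableTypeR R, Z j w : measurableTypeR R)) A =
    (normal01 \x normal01)%E A.
  by move=> mA _; rewrite (iid_pair_law ij).
have mfgZ : measurable_fun setT (fun w => (f (Z i w) * g (Z j w))).
  by apply: measurable_funM; exact: iid_measurable_comp.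
have intP : P.-integrable setT (fun w => (f (Z i w) * g (Z j w))%:E).
  apply/integrableP; split; first exact/measurable_EFinP.
  have [_] := integrableP _ _ _ intp; rewrite -(eq_measure_integral _ lawP).
  rewrite ge0_integral_pushforward//.
  by apply: measurableT_comp => //; exact/measurable_EFinP.
split => //.
transitivity (\int[pushforward P (fun w => (Z i w : measurableTypeR R,
   Z j w : measurableTypeR R))]_z (f z.1 * g z.2)%:E)%E.
  rewrite integral_pushforward//; exact/measurable_EFinP.
rewrite (eq_measure_integral _ lawP).
rewrite -(integral12_prod_meas1 intp).
rewrite /fubini_F; under eq_integral => x _.
  under eq_integral => y _ do rewrite /= EFinM.
  rewrite integralZl// g0 mule0; over.
exact: integral0.
exact: mZ.
Qed.

(** The centered part of a noisy square: [(m + x)^2 = m^2 + 1 + noise (2 m) x]. *)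
Definition noise (a x : R) : R := a * x + (x ^+ 2 - 1).

Lemma measurable_noise a : measurable_fun setT (noise a).
Proof.
apply: measurable_funD; first exact: measurable_funM.
by apply: measurable_funB => //; exact: measurable_funX.
Qed.

Lemma noise_sqr_le a x : noise a x ^+ 2 <= 2 * a ^+ 2 * x ^+ 2 + 2 * (x ^+ 4 + 1).
Proof.
rewrite /noise (_ : x ^+ 4 = (x ^+ 2) ^+ 2); last by rewrite -exprM.
have := sqr_ge0 (a * x - (x ^+ 2 - 1)); have := sqr_ge0 x.
have -> : 2 * a ^+ 2 * x ^+ 2 = 2 * (a * x) ^+ 2 by ring.
by move: (a * x) (x ^+ 2) => b y; nra.
Qed.

Lemma normal_noise a : normal01.-integrable setT (fun x => (noise a x)%:E) /\
  (\int[normal01]_x (noise a x)%:E = 0)%E.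
Proof.
have [iX iX2] : normal01.-integrable setT (fun x : R => x%:E) /\
    normal01.-integrable setT (fun x : R => (x ^+ 2)%:E).
  by split; [exact: normal_integrable_X|exact: normal_integrable_X2].
have i1 := integrable_affine 0 a iX.
have i2 := integrable_affine (-1) 1 iX2.
have h1 := integral_affine 0 a iX normal_mean.
have h2 := integral_affine (-1) 1 iX2 normal_sqr.
have E : (fun x => (noise a x)%:E) = ((fun x => (0 + a * x)%:E) \+ (fun x => (-1 + 1 * x ^+ 2)%:E))%E.
  by apply/funext => x /=; rewrite -EFinD; congr EFin; rewrite /noise; ring.
rewrite E; split; first exact: integrableD.
rewrite integralD// h1 h2 -EFinD; congr EFin; ring.
Qed.

(** The constant is [2 + 2 * 64], where 64 bounds the fourth moment: [x^4 <= 32 expR (x^2 / 4)], and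
    this exponential has mean [sqrt 2 <= 2]. *)
Lemma normal_noise_sqr a : (\int[normal01]_x (noise a x ^+ 2)%:E <= (2 * a ^+ 2 + 130)%:E)%E.
Proof.
have iX2 : normal01.-integrable setT (fun x : R => (x ^+ 2)%:E) by exact: normal_integrable_X2.
have iX4 : normal01.-integrable setT (fun x : R => (x ^+ 4)%:E) by exact: normal_integrable_X4.
have X4 : (\int[normal01]_x (x ^+ 4)%:E <= 64%:E)%E.
  apply: (@le_trans _ _ (\int[normal01]_x (32 * expR (4^-1 * x ^+ 2))%:E)%E).
    apply: ge0_le_integral => //=.
    - by move=> x _; rewrite lee_fin exprn_even_ge0.
    - by apply/measurable_EFinP; exact: measurable_funX.
    - apply/measurable_EFinP; apply: measurable_funM => //; apply: measurableT_comp => //.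
      by apply: measurable_funM => //; exact: measurable_funX.
    - by move=> x _; rewrite lee_fin; exact: X4_le_expR.
  under eq_integral do rewrite EFinM.
  rewrite ge0_integralZl//; last first.
    apply/measurable_EFinP; apply: measurableT_comp => //.
    by apply: measurable_funM => //; exact: measurable_funX.
  rewrite normal_expR_sqr; last by lra.
  rewrite -EFinM lee_fin.
  have q0 : 0 < Num.sqrt (1 - 2 * 4^-1) :> R by rewrite sqrtr_gt0; lra.
  rewrite ler_pdivrMr//.
  have : 2^-1 <= Num.sqrt (1 - 2 * 4^-1) :> R; last by lra.
  by rewrite -(@ler_pXn2r _ 2)// ?nnegrE ?(ltW q0)// sqr_sqrtr; lra.
have [v Ev] : exists v, (\int[normal01]_x (x ^+ 4)%:E = v%:E)%E.
  exists (fine (\int[normal01]_x (x ^+ 4)%:E)); rewrite fineK//.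
  exact: integrable_fin_num.
rewrite Ev lee_fin in X4.
have h1 := integral_affine 2 (2 * a ^+ 2) iX2 normal_sqr.
have h2 := integral_affine 0 2 iX4 Ev.
apply: (@le_trans _ _ (\int[normal01]_x ((2 + 2 * a ^+ 2 * x ^+ 2)%:E + (0 + 2 * x ^+ 4)%:E))%E).
  apply: ge0_le_integral => //=.
  - by move=> x _; rewrite lee_fin sqr_ge0.
  - by apply/measurable_EFinP; apply: measurable_funX; exact: measurable_noise.
  - apply/measurable_EFinP; apply: measurable_funD; apply: measurable_funD => //;
      by apply: measurable_funM => //; exact: measurable_funX.
  - move=> x _; rewrite -EFinD lee_fin; have := noise_sqr_le a x.
    by set y : R := x ^+ 4; set z := noise _ _ ^+ 2; set t := _ * x ^+ 2; lra.
rewrite integralD//; [|exact: integrable_affine|exact: integrable_affine].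
by rewrite h1 h2 -EFinD lee_fin; lra.
Qed.

Lemma noise_sum_sqr (a c : nat -> R) (s : seq nat) : uniq s ->
  (\int[P]_o ((\sum_(i <- s) c i * noise (a i) (Z i o)) ^+ 2)%:E <=
   (\sum_(i <- s) c i ^+ 2 * (2 * a i ^+ 2 + 130))%:E)%E.
Proof.
move=> us.
have mV i : measurable_fun setT (fun o => noise (a i) (Z i o)).
  by apply: iid_measurable_comp; exact: measurable_noise.
have V2 i : (\int[P]_o (noise (a i) (Z i o) ^+ 2)%:E <= (2 * a i ^+ 2 + 130)%:E)%E.
  rewrite (@iid_ge0_integral (fun x => noise (a i) x ^+ 2)).
  - exact: normal_noise_sqr.
  - by apply: measurable_funX; exact: measurable_noise.
  - by move=> x; exact: sqr_ge0.
apply: orthogonal_sum_sqr => // i j; last first.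
  move=> ij; have [intf _] := normal_noise (a i); have [intg g0] := normal_noise (a j).
  by have [] := iid_orthogonal ij (measurable_noise (a i)) (measurable_noise (a j)) intf intg g0.
have [<-|ij] := eqVneq i j; last first.
  have [intf _] := normal_noise (a i); have [intg g0] := normal_noise (a j).
  by have [] := iid_orthogonal ij (measurable_noise (a i)) (measurable_noise (a j)) intf intg g0.
apply/integrableP; split; first by apply/measurable_EFinP; exact: measurable_funM.
under eq_integral do rewrite /= -expr2 ger0_norm ?sqr_ge0//.
exact: le_lt_trans (V2 i) (ltry _).
Qed.

(* A finite mesh suffices: the increments of the noise process over the mesh have
   standard deviation at most [len / q * B], whatever the number [q] of cells, and
   inside a cell the process is controlled crudely by the absolute values. *)
Lemma noise_total_variation (f : nat -> R -> R) (e m : nat -> R) (c len B t : R) (N : nat) :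
  0 < len -> 0 < B -> 0 < t -> (forall i, 0 <= e i) ->
  (forall i u v, c <= u -> u <= v -> v <= c + len ->
     0 <= f i u - f i v <= (v - u) * e i) ->
  \sum_(1 <= i < N) e i ^+ 2 * (8 * m i ^+ 2 + 130) <= B ^+ 2 ->
  exists E, [/\ measurable E, (P (~` E) <= (2 * len * B / t)%:E)%E &
    forall o, E o -> forall a, c <= a <= c + len ->
      `|\sum_(1 <= i < N) (f i a - f i (c + len)) * noise (2 * m i) (Z i o)| <= t].
Proof.
move=> len0 B0 t0 e0 fe eB.
pose M := \sum_(1 <= i < N) e i * (m i ^+ 2 + 3).
have M0 : 0 <= M by apply: sumr_ge0 => i _; rewrite mulr_ge0// addr_ge0// sqr_ge0.
(* [M] bounds the mean of the crude majorant [S]; the mesh is fine enough for the contribution of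
   one cell, [len / q * M], to be at most [len * B]. *)
pose q := (Num.truncn (M / B)).+1.
have q0 : 0 < q%:R :> R by rewrite ltr0n.
have qM : M <= q%:R * B.
  by rewrite -ler_pdivrMr// ltW// truncnS_gt.
pose u (j : nat) := c + j%:R * (len / q%:R).
have lq0 : 0 < len / q%:R by rewrite divr_gt0.
pose V i o := noise (2 * m i) (Z i o).
pose D (j : nat) o := \sum_(1 <= i < N) (f i (u j) - f i (u j.+1)) * V i o.
pose b := len / q%:R * B.
have b0 : 0 < b by rewrite mulr_gt0.
have bi0 : 0 <= (2 * b)^-1 by rewrite invr_ge0 mulr_ge0// ltW.
pose S o := \sum_(1 <= i < N) e i * (m i ^+ 2 + 1 + 2 * Z i o ^+ 2).
(* Each [|D j|] is replaced by its majorant [b / 2 + D^2 / (2 b)]. Since [D j] has second moment at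
   most [b^2], the majorant has mean at most [b], and the [q] cells together cost [q * b = len * B].
   Markov's inequality is applied once, to [G]. *)
pose G o := \sum_(0 <= j < q) (b / 2 + (2 * b)^-1 * D j o ^+ 2) + len / q%:R * S o.
have mV i : measurable_fun setT (V i).
  by apply: iid_measurable_comp; exact: measurable_noise.
have mD j : measurable_fun setT (D j).
  by apply: measurable_sum => i; exact: measurable_funM.
have mZ2 i : measurable_fun setT (fun o => Z i o ^+ 2).
  by apply: (@iid_measurable_comp (fun x => x ^+ 2)); exact: measurable_funX.
have mS : measurable_fun setT S.
  apply: measurable_sum => i; apply: measurable_funM => //; apply: measurable_funD => //.
  exact: measurable_funM.
have S0 o : 0 <= S o.
  apply: sumr_ge0 => i _; rewrite mulr_ge0//.
  by have := sqr_ge0 (m i); have := sqr_ge0 (Z i o); lra.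
have mDb j : measurable_fun setT (fun o => b / 2 + (2 * b)^-1 * D j o ^+ 2).
  by apply: measurable_funD => //; apply: measurable_funM => //; exact: measurable_funX.
have Db0 j o : 0 <= b / 2 + (2 * b)^-1 * D j o ^+ 2.
  by rewrite addr_ge0 ?(mulr_ge0 bi0 (sqr_ge0 _))// divr_ge0// ltW.
have mG : measurable_fun setT G.
  apply: measurable_funD; first by apply: measurable_sum => j.
  exact: measurable_funM.
have G0 o : 0 <= G o.
  by rewrite addr_ge0 ?sumr_ge0// mulr_ge0 ?(ltW lq0).
have uS j : u j.+1 = u j + len / q%:R by rewrite /u -natr1; ring.
have uq : u q = c + len by rewrite /u mulrC divfK// gt_eqF.
have u_le j k : (j <= k)%N -> u j <= u k.
  by move=> jk; rewrite lerD2l ler_pM2r// ler_nat.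
have ul j : (j < q)%N -> u j.+1 <= c + len by move=> jq; rewrite -uq; exact: u_le.
have cu j : c <= u j by rewrite lerDl mulr_ge0// ltW.
have ES : (\int[P]_o (S o)%:E <= M%:E)%E.
  under eq_integral do rewrite -sumEFin.
  rewrite ge0_integral_sum//; last 2 first.
  - move=> i; apply/measurable_EFinP; apply: measurable_funM => //.
    by apply: measurable_funD => //; exact: measurable_funM.
  - move=> i o _; rewrite lee_fin mulr_ge0//.
    by have := sqr_ge0 (m i); have := sqr_ge0 (Z i o); lra.
  rewrite -sumEFin; apply: lee_sum => i _.
  have h := integral_affine (e i * (m i ^+ 2 + 1)) (2 * e i) normal_integrable_X2 normal_sqr.
  rewrite (@iid_ge0_integral (fun x => e i * (m i ^+ 2 + 1 + 2 * x ^+ 2))).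
  - under eq_integral => x _.
      rewrite (_ : e i * _ = e i * (m i ^+ 2 + 1) + 2 * e i * x ^+ 2); last by ring.
      over.
    by rewrite h lee_fin; lra.
  - apply: measurable_funM => //; apply: measurable_funD => //.
    by apply: measurable_funM => //; exact: measurable_funX.
  - move=> x; rewrite mulr_ge0//.
    by have := sqr_ge0 (m i); have := sqr_ge0 x; lra.
have ED j : (j < q)%N -> (\int[P]_o (D j o ^+ 2)%:E <= (b ^+ 2)%:E)%E.
  move=> jq; apply: le_trans (noise_sum_sqr _ _ (iota_uniq _ _)) _.
  rewrite lee_fin /b exprMn.
  apply: le_trans (ler_wpM2l (sqr_ge0 _) eB); rewrite mulr_sumr.
  apply: ler_sum => i _.
  have /andP[h0 h1] := fe i _ _ (cu j) (u_le _ _ (leqnSn j))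
    (ul j jq).
  rewrite (_ : 2 * (2 * m i) ^+ 2 = 8 * m i ^+ 2); last by ring.
  rewrite [leRHS]mulrA; apply: ler_wpM2r.
    by have := sqr_ge0 (m i); lra.
  rewrite -exprMn; apply: lerXn2r; rewrite ?nnegrE ?(mulr_ge0 (ltW lq0))//.
  by rewrite -[len / _](addrK (u j)) [_ + u j]addrC -uS.
have EG : (\int[P]_o (G o)%:E <= (2 * len * B)%:E)%E.
  under eq_integral do rewrite EFinD -sumEFin.
  rewrite ge0_integralD//=; first last.
  - by apply/measurable_EFinP; exact: measurable_funM.
  - by move=> o _; rewrite lee_fin mulr_ge0// ltW.
  - by apply: emeasurable_sum => j; exact/measurable_EFinP.
  - by move=> o _; apply: sume_ge0 => k _; rewrite lee_fin.
  have -> : (\int[P]_o (len / q%:R * S o)%:E = (len / q%:R)%:E * \int[P]_o (S o)%:E)%E.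
    under eq_integral => o _ do rewrite -[(len / _ * _)%R]add0r.
    by rewrite ge0_integral_affine// ?add0e// ltW.
  rewrite ge0_integral_sum//; last 2 first.
  - by move=> j; exact/measurable_EFinP.
  - by move=> j o _; rewrite lee_fin.
  have h1 : (\sum_(0 <= j < q) \int[P]_o (b / 2 + (2 * b)^-1 * D j o ^+ 2)%:E
      <= (len * B)%:E)%E.
    have -> : len * B = \sum_(0 <= j < q) b.
      by rewrite sumr_const_nat subn0 -mulr_natr /b mulrAC divfK// gt_eqF.
    rewrite -sumEFin big_nat [leRHS]big_nat; apply: lee_sum => j /andP[_ jq].
    rewrite ge0_integral_affine// ?divr_ge0 ?(ltW b0)//; last 2 first.
    - exact: measurable_funX.
    - by move=> o; exact: sqr_ge0.
    apply: (@le_trans _ _ ((b / 2)%:E + ((2 * b)^-1)%:E * (b ^+ 2)%:E)%E).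
      rewrite leeD2l// lee_wpmul2l ?ED// lee_fin.
    have bn : b != 0 by rewrite gt_eqF.
    by rewrite -EFinM -EFinD lee_fin le_eqVlt; apply/orP; left; apply/eqP; field.
  have h2 : ((len / q%:R)%:E * \int[P]_o (S o)%:E <= (len * B)%:E)%E.
    apply: (@le_trans _ _ ((len / q%:R)%:E * M%:E)%E).
      by rewrite lee_wpmul2l// lee_fin ltW.
    rewrite -EFinM lee_fin -mulrA ler_pM2l// mulrC ler_pdivrMr//.
    by rewrite mulrC.
  apply: le_trans (leeD h1 h2) _.
  by rewrite -EFinD lee_fin; lra.
exists (~` [set o | t <= G o]); split.
- by apply: measurableC; exact: measurable_le_event.
- by rewrite setCK; exact: markov_event.
move=> o /negP; rewrite -ltNge => Gt a /andP[ca al].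
have [j [jq ja aj]] : exists j, [/\ (j < q)%N, u j <= a & a <= u j.+1].
  have : forall k, (k < q)%N -> a <= u k.+1 -> exists j, [/\ (j < q)%N, u j <= a & a <= u j.+1].
    elim=> [|k IH] kq ak.
      by exists 0%N; split => //; rewrite /u mul0r addr0.
    have [h|h] := leP a (u k.+1); first by apply: IH => //; exact: ltnW.
    by exists k.+1; split => //; exact: ltW.
  by apply; [exact: ltnSn|rewrite uq].
have Vle i : `|V i o| <= m i ^+ 2 + 1 + 2 * Z i o ^+ 2.
  rewrite /V /noise ler_norml.
  have := sqr_ge0 (m i - Z i o); have := sqr_ge0 (m i + Z i o); rewrite !expr2.
  by move=> *; apply/andP; split; nra.
have Dle k : `|D k o| <= b / 2 + (2 * b)^-1 * D k o ^+ 2.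
  have : 0 <= (2 * b)^-1 * (b - `|D k o|) ^+ 2.
    by rewrite (mulr_ge0 bi0 (sqr_ge0 _)).
  have bn : b != 0 by rewrite gt_eqF.
  rewrite sqrrB real_normK ?num_real// mulrDr mulrBr.
  have -> : (2 * b)^-1 * b ^+ 2 = b / 2 by field.
  have -> : (2 * b)^-1 * (b * `|D k o| *+ 2) = `|D k o| by field.
  lra.
(* From [a] to the next mesh point, controlled by [S], then along whole cells to the right end,
   controlled by the [D k]. *)
have -> : \sum_(1 <= i < N) (f i a - f i (c + len)) * noise (2 * m i) (Z i o) =
    \sum_(1 <= i < N) (f i a - f i (u j.+1)) * V i o + \sum_(j.+1 <= k < q) D k o.
  rewrite /D exchange_big/= -big_split/=; apply: eq_bigr => i _.
  rewrite -mulr_suml -mulrDl -uq; congr (_ * _).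
  have := telescope_sumr (fun k => - f i (u k)) jq.
  under eq_bigr do rewrite opprK addrC.
  by move=> ->; ring.
apply: le_trans (ler_normD _ _) (le_trans _ (ltW Gt)).
rewrite addrC; apply: lerD.
  apply: le_trans (ler_norm_sum _ _ _) _.
  rewrite [leRHS](big_cat_nat (n := j.+1))//=.
  apply: le_trans (_ : \sum_(j.+1 <= k < q) (b / 2 + (2 * b)^-1 * D k o ^+ 2) <= _).
    by apply: ler_sum => k _; exact: Dle.
  by rewrite lerDr sumr_ge0.
apply: le_trans (ler_norm_sum _ _ _) _; rewrite mulr_sumr.
apply: ler_sum => i _; rewrite normrM mulrA.
have /andP[h0 h1] := fe i _ _ ca aj (ul j jq).
apply: ler_pM => //; rewrite ger0_norm//; apply: le_trans h1 _.
by rewrite ler_wpM2r// uS; move: ja; lra.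
Qed.

End iid_normal.

(** * Events of large probability *)

Section likely.
Context d (T : measurableType d) {R : realType} (P : probability T R).

(** Stated through a measurable subset because [Q] may quantify over uncountably many values of
    [alpha], as [good_event] does, so that its measurability is not at hand. *)
Definition likely (x : R) (Q : T -> Prop) :=
  exists E, [/\ measurable E, (P (~` E) <= x%:E)%E & forall o, E o -> Q o].

Lemma likely_weaken (x y : R) (Q Q' : T -> Prop) : x <= y -> (forall o, Q o -> Q' o) ->
  likely x Q -> likely y Q'.
Proof.
move=> xy QQ' [E [mE PE EQ]]; exists E; split => //.
  by rewrite (le_trans PE)// lee_fin.
by move=> o /EQ /QQ'.
Qed.

Lemma likelyT (Q : T -> Prop) : (forall o, Q o) -> likely 0 Q.
Proof. by move=> Qo; exists setT; split => //; rewrite setCT measure0. Qed.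

Lemma likely_and (x y : R) (Q Q' : T -> Prop) : likely x Q -> likely y Q' ->
  likely (x + y) (fun o => Q o /\ Q' o).
Proof.
move=> [E [mE PE EQ]] [F [mF PF FQ]]; exists (E `&` F); split.
- exact: measurableI.
- rewrite setCI EFinD; apply: le_trans (leeD PE PF).
  by apply: measureU2; exact: measurableC.
- by move=> o [/EQ ? /FQ].
Qed.

Lemma likely_forall_lt (x : R) (Q : nat -> T -> Prop) (K : nat) :
  (forall k, (k < K)%N -> likely x (Q k)) ->
  likely (K%:R * x) (fun o => forall k, (k < K)%N -> Q k o).
Proof.
elim: K => [|K IH] H.
  by rewrite mul0r; apply: likelyT.
have := likely_and (IH (fun k kK => H k (ltnW kK))) (H K (ltnSn K)).
apply: likely_weaken; first by rewrite -natr1 mulrDl mul1r.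
move=> o [h1 h2] k; rewrite ltnS leq_eqVlt => /orP[/eqP -> //|]; exact: h1.
Qed.

Lemma measure_bigcup_nondecreasing_le (F : nat -> set T) (x : R) :
  (forall n, measurable (F n)) -> (forall m n, (m <= n)%N -> F m `<=` F n) ->
  (forall n, (P (F n) <= x%:E)%E) -> (P (\bigcup_n F n) <= x%:E)%E.
Proof.
move=> mF ndF PF.
have cv : P (F n) @[n --> \oo] --> P (\bigcup_n F n).
  apply: nondecreasing_cvg_mu => //; first exact: bigcupT_measurable.
  by move=> m n mn; apply/subsetPset; exact: ndF.
rewrite -(cvg_lim _ cv)//; apply: lime_le; first by apply/cvg_ex; exists (P (\bigcup_n F n)).
exact: nearW.
Qed.

(** Reverse Fatou for events: the upper limit of events of probability at least [1 - x] has
    probability at least [1 - x]. It removes the truncation [N] from bounds that are proved for each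
    [N] separately and are not monotone in [N]. *)
Lemma likely_infinitely_often (x : R) (Q : nat -> T -> Prop) :
  (forall N, likely x (Q N)) ->
  likely x (fun o => forall N, exists2 M, (N <= M)%N & Q M o).
Proof.
move=> H; have [E HE] := choice H.
have mE N : measurable (E N) by have [] := HE N.
exists (lim_sup_set E); split.
- by apply: bigcap_measurable => // k _; exact: bigcup_measurable.
- rewrite /lim_sup_set setC_bigcap; apply: measure_bigcup_nondecreasing_le.
  + by move=> n; apply: measurableC; exact: bigcup_measurable.
  + move=> m n mn o /= h [j /= nj Ej]; apply: h; exists j => //=.
    exact: leq_trans nj.
  + move=> n; have [_ + _] := HE n; apply: le_trans.
    apply: le_measure; rewrite ?inE; [|exact: measurableC|].
      by apply: measurableC; exact: bigcup_measurable.
    by apply: subsetC => o Eo; exists n => //=.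
- move=> o Eo N; have [j /= Nj Ej] := Eo N I; exists j => //.
  by have [_ _] := HE j; apply.
Qed.

(** The terms are nonnegative, so the exceptional events increase with [N], and Markov's bound for
    each [N] survives in their union. *)
Lemma likely_series_bounded (f : nat -> T -> R) (M eta : R) : 0 < eta -> 0 < M ->
  (forall i, measurable_fun setT (f i)) -> (forall i o, 0 <= f i o) ->
  (forall N, \sum_(1 <= i < N) \int[P]_o (f i o)%:E <= M%:E)%E ->
  likely eta (fun o => forall N, \sum_(1 <= i < N) f i o <= M / eta).
Proof.
move=> eta0 M0 mf f0 fM.
have t0 : 0 < M / eta by rewrite divr_gt0.
pose F N := [set o | M / eta <= \sum_(1 <= i < N) f i o].
have mS N : measurable_fun setT (fun o => \sum_(1 <= i < N) f i o).
  exact: measurable_sum.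
have mF N : measurable (F N) by exact: measurable_le_event.
exists (~` \bigcup_N F N); split.
- by apply: measurableC; exact: bigcupT_measurable.
- rewrite setCK; apply: measure_bigcup_nondecreasing_le => //.
    move=> m n mn o /= /le_trans; apply.
    have [m1|m1] := leqP 1 m; last first.
      by rewrite big_geq ?sumr_ge0// ltnW.
    by rewrite [leRHS](big_cat_nat (n := m))//= lerDl sumr_ge0.
  move=> N; have h : (\int[P]_o (\sum_(1 <= i < N) f i o)%:E <= M%:E)%E.
    under eq_integral do rewrite -sumEFin.
    rewrite ge0_integral_sum//; first by move=> i; exact/measurable_EFinP.
    by move=> i o _; rewrite lee_fin.
  apply: le_trans (markov_event (mS N) _ h t0) _; first by move=> o; rewrite sumr_ge0.
  by rewrite lee_fin invf_div mulrCA divff ?mulr1// gt_eqF.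
- move=> o nF N; rewrite leNgt; apply/negP => h; apply: nF; exists N => //=.
  exact: ltW.
Qed.

End likely.

(** * Series *)

Section series_facts.
Context {R : realType}.
Implicit Types (x c : nat -> R).

Lemma abs_bounded_series_cvg x (M : R) :
  (forall N, \sum_(1 <= i < N) `|x i| <= M) -> cvgn (fun N => \sum_(1 <= i < N) x i).
Proof.
move=> xM.
have nneg (y : nat -> R) (K : R) : (forall i, 0 <= y i) ->
    (forall N, \sum_(1 <= i < N) y i <= K) -> cvgn (fun N => \sum_(1 <= i < N) y i).
  move=> y0 yK; apply: nondecreasing_is_cvgn.
    move=> m n mn; have [m1|m1] := leqP 1 m; last first.
      by rewrite [leLHS]big_geq ?sumr_ge0// ltnW.
    by rewrite [leRHS](big_cat_nat (n := m))//= lerDl sumr_ge0.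
  by exists K => _ [N _ <-].
have -> : (fun N => \sum_(1 <= i < N) x i) =
    (fun N => \sum_(1 <= i < N) (`|x i| + x i)) - (fun N => \sum_(1 <= i < N) `|x i|).
  apply/funext => N; rewrite /GRing.add/= /GRing.opp/= -sumrB.
  by apply: eq_bigr => i _; rewrite addrC addKr.
apply: is_cvgB; last by apply: nneg xM => i.
apply: (nneg _ (2 * M)) => [i|N].
  by have := ler_norm (- x i); rewrite normrN; lra.
have -> : 2 * M = M + M by ring.
rewrite big_split/=; apply: lerD => //; apply: le_trans (xM N).
by apply: ler_sum => i _; exact: ler_norm.
Qed.

Lemma cube_root_floor (N : nat) : (0 < N)%N ->
  exists k, (0 < k)%N /\ (k ^ 3 <= N < k.+1 ^ 3)%N.
Proof.
elim: N => // N IH _; have [->|N0] := posnP N; first by exists 1%N.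
have [k [k0 /andP[k1 k2]]] := IH N0.
have [h|h] := ltnP N.+1 (k.+1 ^ 3).
  by exists k; rewrite k0 h (leq_trans k1).
exists k.+1; split => //; apply/andP; split => //.
apply: leq_ltn_trans (_ : k.+1 ^ 3 < _)%N => //.
by rewrite ltn_exp2r.
Qed.

(* Between consecutive cubes the partial sums move by at most the sum of the lower
   bounds [c i], in either direction, so that it suffices to control the cubes. *)
Lemma cube_blocks_cvg x c (M G : R) : (forall i, (0 < i)%N -> - c i <= x i) ->
  (forall i, 0 <= c i) ->
  (forall K, \sum_(1 <= k < K) `|\sum_(k ^ 3 <= i < k.+1 ^ 3) x i| <= M) ->
  (forall k, (0 < k)%N -> \sum_(k ^ 3 <= i < k.+1 ^ 3) c i <= G / k%:R) ->
  cvgn (fun N => \sum_(1 <= i < N) x i).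
Proof.
move=> cx c0 xM cG; pose S N := \sum_(1 <= i < N) x i.
have G0 : 0 <= G.
  by have := cG 1%N isT; rewrite divr1; apply: le_trans; exact: sumr_ge0.
have Sk k : S (k.+1 ^ 3)%N = \sum_(1 <= j < k.+1) \sum_(j ^ 3 <= i < j.+1 ^ 3) x i.
  elim: k => [|k IH]; first by rewrite /S exp1n !big_geq.
  rewrite big_nat_recr//= -IH /S (big_cat_nat (n := (k.+1 ^ 3)%N))//=.
  by rewrite leq_exp2r.
have /cvg_ex[l /= Bl] := abs_bounded_series_cvg xM.
apply/cvg_ex; exists l; apply/cvgrPdist_le => e e0.
have /cvgrPdist_le/(_ (e / 2))[|K0 _ HK] := Bl; first by rewrite divr_gt0.
pose K := maxn K0 (Num.truncn (2 * G / e)).+1.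
exists (K.+1 ^ 3)%N => // N /= KN.
have N0 : (0 < N)%N by apply: leq_trans KN; rewrite expn_gt0.
have [k [k0 /andP[kN Nk]]] := cube_root_floor N0.
have Kk : (K <= k)%N.
  rewrite -ltnS -(@ltn_exp2r _ _ 3)//; apply: leq_ltn_trans Nk.
  by apply: leq_trans KN; rewrite leq_exp2r.
have Gk : G / k%:R <= e / 2.
  rewrite ler_pdivrMr ?ltr0n//.
  have h : 2 * G / e <= k%:R.
    apply: le_trans (_ : (Num.truncn (2 * G / e)).+1%:R <= _).
      by rewrite ltW// truncnS_gt.
    by rewrite ler_nat; apply: leq_trans Kk; rewrite leq_maxr.
  by move: h; rewrite ler_pdivrMr//; lra.
have near j : (k <= j)%N -> `|l - S (j ^ 3)%N| <= e / 2.
  move=> kj; have j0 : (0 < j)%N by exact: leq_trans kj.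
  rewrite -(prednK j0) Sk prednK//; apply: HK => /=.
  by apply: leq_trans kj; apply: leq_trans Kk; rewrite leq_maxl.
have gap a b : (k ^ 3 <= a)%N -> (a <= b)%N -> (b <= k.+1 ^ 3)%N -> - (e / 2) <= S b - S a.
  move=> ka ab bk.
  have a1 : (1 <= a)%N by apply: leq_trans ka; rewrite expn_gt0 k0.
  rewrite /S [X in X - _](big_cat_nat (n := a))//= addrAC subrr add0r.
  apply: le_trans (_ : - (\sum_(a <= i < b) c i) <= _); last first.
    rewrite -sumrN; apply: ler_sum_nat => i /andP[ai _]; apply: cx.
    exact: leq_trans ai.
  rewrite lerN2; apply: le_trans Gk; apply: le_trans (cG k k0).
  rewrite [leRHS](big_cat_nat (n := a))//=; last exact: leq_trans bk.
  rewrite [X in _ <= _ + X](big_cat_nat (n := b))//=.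
  by rewrite addrCA lerDl addr_ge0 ?sumr_ge0.
have h1 := near k (leqnn k); have h2 := near k.+1 (leqnSn k).
have h3 := gap _ _ (leqnn _) kN (ltnW Nk); have h4 := gap _ _ kN (ltnW Nk) (leqnn _).
rewrite -/(S N); move: h1 h2 h3 h4; rewrite !ler_norml => /andP[? ?] /andP[? ?] ? ?.
by apply/andP; split; lra.
Qed.

Lemma cube_gap (k : nat) : (0 < k)%N -> (k.+1 ^ 3 - k ^ 3 <= 7 * k ^ 2)%N.
Proof. by rewrite !expnS expn0; nia. Qed.

Lemma ln_nat_ge0 (i : nat) : 0 <= ln (i%:R : R).
Proof.
case: i => [|i]; first by rewrite ln0.
by apply: ln_ge0; rewrite ler1n.
Qed.

Lemma ln_incr_ge (z : R) : 0 < z -> (z + 1)^-1 <= ln (z + 1) - ln z.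
Proof.
move=> z0; have z1 : 0 < z + 1 by lra.
have : ln (z / (z + 1)) <= - (z + 1)^-1.
  have -> : z / (z + 1) = 1 + - (z + 1)^-1 by field; rewrite gt_eqF.
  by apply: le_ln1Dx; rewrite ltrN2 invf_lt1//; lra.
by rewrite ln_div ?posrE// -[ln z - _]opprB lerN2.
Qed.

Lemma ln_incr_le (z : R) : 0 < z -> z * (ln (z + 1) - ln z) <= 1.
Proof.
move=> z0; rewrite -ln_div ?posrE//; last by lra.
have -> : (z + 1) / z = 1 + z^-1 by field; rewrite gt_eqF.
rewrite mulrC -ler_pdivlMr// div1r; apply: le_ln1Dx.
by apply: lt_trans (_ : 0 < _); rewrite ?invr_gt0//; lra.
Qed.

(* Summable weights that dominate [i ^ (- 1 - 2 alpha)] for every [alpha > 0] at once. *)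
Definition log_weight (i : nat) : R := (i%:R * (1 + ln i%:R) ^+ 2)^-1.

Lemma log_weight_ge0 i : 0 <= log_weight i.
Proof. by rewrite invr_ge0 mulr_ge0// sqr_ge0. Qed.

(** A discrete form of integrating [1 / (x (1 + ln x)^2)]: the terms are dominated by the increments
    of [- 1 / (1 + ln i)]. *)
Lemma log_weight_sum N : \sum_(1 <= i < N) log_weight i <= 2.
Proof.
have [N1|N1] := leqP N 1; first by rewrite big_geq.
suff : \sum_(1 <= i < N) log_weight i <= 2 - (1 + ln (N.-1)%:R)^-1.
  move=> /le_trans; apply; rewrite gerBl invr_ge0 addr_ge0//; exact: ln_nat_ge0.
elim: N N1 => // -[//|[|N]] IH _.
  by rewrite big_nat1 /log_weight /= ln1 addr0 expr1n mulr1 invr1; lra.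
rewrite big_nat_recr//=; have := IH isT; rewrite /=.
set S := \sum_(_ <= _ < _) _.
have h := @ln_incr_ge N.+1%:R (ltr0Sn R N).
rewrite natr1 in h.
have a0 := ln_nat_ge0 N.+1.
have i0 : 0 < N.+2%:R :> R by rewrite ltr0n.
rewrite /log_weight invfM; move: h a0.
have : 0 < N.+2%:R^-1 :> R by rewrite invr_gt0.
move: (ln _) (ln _) (N.+2%:R^-1) => a b r r0 h a0 IHN.
have b0 : 0 < 1 + b by lra.
have a1 : 0 < 1 + a by lra.
suff : r * ((1 + b) ^+ 2)^-1 <= (1 + a)^-1 - (1 + b)^-1 by lra.
have -> : (1 + a)^-1 - (1 + b)^-1 = (b - a) * (1 + b) / (1 + a) * ((1 + b) ^+ 2)^-1.
  by field; rewrite !gt_eqF.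
apply: ler_wpM2r; first by rewrite invr_ge0 sqr_ge0.
rewrite ler_pdivlMr//; nra.
Qed.

End series_facts.

(** * Almost sure control of random series *)

Section iid_series.
Context d (T : measurableType d) {R : realType} (P : probability T R).
Variable Z : nat -> T -> R.
Hypothesis HZ : iid_std_normal P Z.

Lemma iid_sqr (c : R) i : 0 <= c -> (\int[P]_o (c * Z i o ^+ 2)%:E = c%:E)%E.
Proof.
move=> c0; have mX2 : measurable_fun setT (fun x : R => x ^+ 2) by exact: measurable_funX.
rewrite (iid_ge0_integral HZ (f := fun x => c * x ^+ 2)).
- have := integral_affine 0 c normal_integrable_X2 normal_sqr.
  by under eq_integral do rewrite add0r; rewrite add0r mulr1.
- exact: measurable_funM.
- by move=> x; rewrite mulr_ge0// sqr_ge0.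
Qed.

Lemma measurable_iid_sqr (c : R) i : measurable_fun setT (fun o => c * Z i o ^+ 2).
Proof.
apply: (iid_measurable_comp HZ (f := fun x => c * x ^+ 2)).
by apply: measurable_funM => //; exact: measurable_funX.
Qed.

Lemma likely_log_series (eta : R) : 0 < eta ->
  likely P eta (fun o => forall N, \sum_(1 <= i < N) log_weight i * Z i o ^+ 2 <= 2 / eta).
Proof.
move=> eta0; apply: likely_series_bounded => //.
- by move=> i; exact: measurable_iid_sqr.
- by move=> i o; rewrite mulr_ge0 ?sqr_ge0 ?log_weight_ge0.
- move=> N; under eq_bigr do rewrite iid_sqr ?log_weight_ge0//.
  by rewrite sumEFin lee_fin log_weight_sum.
Qed.

Lemma sum_inv_sqr_le N : \sum_(1 <= i < N) (i%:R ^+ 2)^-1 <= 2 :> R.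
Proof.
have [N1|N1] := leqP N 1; first by rewrite big_geq.
suff : \sum_(1 <= i < N) (i%:R ^+ 2)^-1 <= 2 - (N.-1)%:R^-1 :> R.
  by move=> /le_trans; apply; rewrite gerBl invr_ge0.
elim: N N1 => // -[//|[|N]] IH _.
  by rewrite big_nat1 /= expr1n invr1; lra.
rewrite big_nat_recr//=; have := IH isT; rewrite /=.
set S := \sum_(_ <= _ < _) _.
have n0 : 0 < N.+1%:R :> R by rewrite ltr0n.
rewrite -[in N.+2%:R]natr1; move: (N.+1%:R) n0 => a a0 h.
have a1 : 0 < a + 1 by lra.
suff : ((a + 1) ^+ 2)^-1 <= a^-1 - (a + 1)^-1 by lra.
have -> : a^-1 - (a + 1)^-1 = (a + 1) / a * ((a + 1) ^+ 2)^-1.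
  by field; rewrite !gt_eqF.
by rewrite ler_peMl ?invr_ge0 ?sqr_ge0// ler_pdivlMr// mul1r; lra.
Qed.

(* Needed only at [alpha = 0] with [p = 0], where the series of [ell] does not converge
   absolutely. *)
Lemma likely_centered_cvg (c : nat -> R) (A eta : R) : 0 < eta -> 0 < A ->
  (forall i, 0 <= c i) -> (forall i, (0 < i)%N -> c i <= A / i%:R) ->
  likely P eta (fun o => cvgn (fun N => \sum_(1 <= i < N) c i * noise 0 (Z i o))).
Proof.
move=> eta0 A0 c0 cA.
pose B k o := \sum_(k ^ 3 <= i < k.+1 ^ 3) c i * noise 0 (Z i o).
have mB k : measurable_fun setT (B k).
  apply: measurable_sum => i; apply: measurable_funM => //.
  exact: (iid_measurable_comp HZ _ (measurable_noise _)).
have cube k : (0 < k)%N -> ((k.+1 ^ 3 - k ^ 3)%N%:R <= 7 * k%:R ^+ 2 :> R).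
  by move=> k0; rewrite -natrX -natrM ler_nat cube_gap.
have gap k : (0 < k)%N -> \sum_(k ^ 3 <= i < k.+1 ^ 3) c i <= 7 * A / k%:R.
  move=> k0; have k0' : 0 < k%:R :> R by rewrite ltr0n.
  apply: le_trans (_ : \sum_(k ^ 3 <= i < k.+1 ^ 3) (A / k%:R ^+ 3) <= _).
    apply: ler_sum_nat => i /andP[ki _].
    have i0 : (0 < i)%N by apply: leq_trans ki; rewrite expn_gt0 k0.
    apply: le_trans (cA i i0) _; apply: ler_wpM2l; first exact: ltW.
    by rewrite lef_pV2 ?posrE ?exprn_gt0 ?ltr0n// -natrX ler_nat.
  rewrite sumr_const_nat -[leLHS]mulr_natl.
  apply: le_trans (ler_wpM2r _ (cube k k0)) _; first by rewrite divr_ge0 ?exprn_ge0// ltW.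
  by rewrite le_eqVlt; apply/orP; left; apply/eqP; field; rewrite gt_eqF.
(* At most [7 k^2] independent terms of variance at most [130 A^2 / k^6], whence [910 = 7 * 130]. *)
have EB k : (0 < k)%N -> (\int[P]_o (B k o ^+ 2)%:E <= (910 * A ^+ 2 / k%:R ^+ 4)%:E)%E.
  move=> k0; have k0' : 0 < k%:R :> R by rewrite ltr0n.
  apply: le_trans (noise_sum_sqr HZ (fun=> 0) c (iota_uniq _ _)) _.
  rewrite lee_fin.
  apply: le_trans (_ : \sum_(k ^ 3 <= i < k.+1 ^ 3) ((A / k%:R ^+ 3) ^+ 2 * 130) <= _).
    apply: ler_sum_nat => i /andP[ki _].
    have i0 : (0 < i)%N by apply: leq_trans ki; rewrite expn_gt0 k0.
    rewrite expr0n mulr0 add0r; apply: ler_wpM2r => //.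
    apply: lerXn2r; rewrite ?nnegrE ?divr_ge0 ?exprn_ge0 ?(ltW A0)//.
    apply: le_trans (cA i i0) _; apply: ler_wpM2l; first exact: ltW.
    by rewrite lef_pV2 ?posrE ?exprn_gt0 ?ltr0n// -natrX ler_nat.
  rewrite sumr_const_nat -[leLHS]mulr_natl.
  apply: le_trans (ler_wpM2r _ (cube k k0)) _; first by rewrite mulr_ge0 ?sqr_ge0.
  by rewrite le_eqVlt; apply/orP; left; apply/eqP; field; rewrite gt_eqF.
(* A majorant of [|B k|] by the arithmetic-geometric mean inequality, with weight [k^2] chosen so
   that both parts have mean [O(k^-2)], a summable bound. *)
pose f k o := (2 * k%:R ^+ 2)^-1 + k%:R ^+ 2 / 2 * B k o ^+ 2.
have ki0 k : 0 <= (2 * k%:R ^+ 2)^-1 :> R by rewrite invr_ge0 mulr_ge0// sqr_ge0.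
have kq0 k : 0 <= k%:R ^+ 2 / 2 :> R by rewrite divr_ge0// sqr_ge0.
have f0 k o : 0 <= f k o by rewrite addr_ge0// mulr_ge0// sqr_ge0.
have mB2 k : measurable_fun setT (fun o => B k o ^+ 2) by exact: measurable_funX.
have mf k : measurable_fun setT (f k).
  by apply: measurable_funD => //; exact: measurable_funM.
have : likely P eta (fun o => forall N, \sum_(1 <= k < N) f k o <= (2 * (455 * A ^+ 2 + 1)) / eta).
  have M0 : 0 < 2 * (455 * A ^+ 2 + 1) by have := sqr_ge0 A; lra.
  apply: (likely_series_bounded eta0 M0 mf f0).
  move=> N; apply: (@le_trans _ _ (\sum_(1 <= k < N) ((455 * A ^+ 2 + 1) * (k%:R ^+ 2)^-1)%:E)%E).
    rewrite big_nat [leRHS]big_nat; apply: lee_sum => k /andP[k0 _].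
    have k0' : 0 < k%:R :> R by rewrite ltr0n.
    rewrite ge0_integral_affine//; last first.
      by move=> o; exact: sqr_ge0.
    apply: (@le_trans _ _ (((2 * k%:R ^+ 2)^-1)%:E +
        (k%:R ^+ 2 / 2)%:E * (910 * A ^+ 2 / k%:R ^+ 4)%:E)%E).
      by rewrite leeD2l// lee_wpmul2l// ?EB// lee_fin.
    rewrite -EFinM -EFinD lee_fin.
    have -> : (2 * k%:R ^+ 2)^-1 + k%:R ^+ 2 / 2 * (910 * A ^+ 2 / k%:R ^+ 4) =
        (455 * A ^+ 2 + 2^-1) * (k%:R ^+ 2)^-1 :> R.
      by field; rewrite gt_eqF.
    by apply: ler_wpM2r; [rewrite invr_ge0 sqr_ge0|lra].
  rewrite sumEFin lee_fin -mulr_sumr mulrC; apply: ler_wpM2r; last exact: sum_inv_sqr_le.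
  by have := sqr_ge0 A; lra.
apply: likely_weaken => // o Ho.
apply: (cube_blocks_cvg (c := c) _ c0 _ gap).
  move=> i _; rewrite -mulrN1; apply: ler_wpM2l => //.
  by rewrite /noise mul0r add0r; have := sqr_ge0 (Z i o); lra.
move=> K; apply: le_trans (Ho K); apply: ler_sum_nat => k /andP[k0 _].
have k0' : 0 < k%:R :> R by rewrite ltr0n.
rewrite -/(B k o) /f; move: (B k o) k0' => b; move: (k%:R : R) => r r0.
have : 0 <= (2 * r ^+ 2)^-1 * (1 - r ^+ 2 * `|b|) ^+ 2.
  by rewrite mulr_ge0 ?sqr_ge0// invr_ge0 mulr_ge0// sqr_ge0.
rewrite -[b ^+ 2]real_normK ?num_real//.
have -> : (2 * r ^+ 2)^-1 * (1 - r ^+ 2 * `|b|) ^+ 2 =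
   (2 * r ^+ 2)^-1 + r ^+ 2 / 2 * `|b| ^+ 2 - `|b| by field; rewrite gt_eqF.
lra.
Qed.

End iid_series.

(** * The likelihood along the prior regularity *)

Section shrinkage.
Context {R : realType}.
Implicit Types x y z r t : R.

Lemma shrink_sub x y : 0 <= x -> 0 <= y ->
  x / (1 + x) - y / (1 + y) = (x - y) / ((1 + x) * (1 + y)).
Proof. by move=> x0 y0; field; rewrite !gt_eqF//; lra. Qed.

(** [ln t <= t - 1] at [t = (1 + y) / (1 + x)] bounds the difference of logarithms below by
    [(x - y) / (1 + x)]; the shrinkage factors differ by this quantity divided by [1 + y], and the
    fraction [y / (1 + y)] of it remains. *)
Lemma entropy_gain x y : 0 < y -> y <= x ->
  (x - y) / (1 + x) * (y / (1 + y)) <=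
  ln (1 + x) - ln (1 + y) - (x / (1 + x) - y / (1 + y)).
Proof.
move=> y0 yx.
have x1 : 0 < 1 + x by lra.
have y1 : 0 < 1 + y by lra.
have : ln ((1 + y) / (1 + x)) <= - ((x - y) / (1 + x)).
  have -> : (1 + y) / (1 + x) = 1 + - ((x - y) / (1 + x)) by field; rewrite gt_eqF.
  by apply: le_ln1Dx; rewrite ltrN2 ltr_pdivrMr//; lra.
rewrite ln_div ?posrE// shrink_sub; [|lra|lra].
have -> : (x - y) / ((1 + x) * (1 + y)) =
    (x - y) / (1 + x) - (x - y) / (1 + x) * (y / (1 + y)) by field; rewrite !gt_eqF.
set A := (x - y) / (1 + x); set B := A * _; lra.
Qed.

(* The increments of the shrinkage factor over a short interval are comparable to its
   slope [z / (1 + z)^2] at the left end; the ratio [r] of the prior precisions only has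
   to be bounded when the data dominates the prior. *)
Lemma shrink_sub_le z r1 r2 r t : 0 < z -> 1 <= r1 -> r1 <= r2 ->
  (1 < z -> r2 <= r) -> 2 <= r -> 0 <= t -> 1 - r1 / r2 <= t ->
  (z / r1) / (1 + z / r1) - (z / r2) / (1 + z / r2) <= t * (2 * r) * (z / (1 + z) ^+ 2).
Proof.
move=> z0 r11 r12 zr r_2 t0 ht.
have r10 : 0 < r1 by lra.
have r20 : 0 < r2 by lra.
have x0 : 0 < z / r1 by rewrite divr_gt0.
have y0 : 0 < z / r2 by rewrite divr_gt0.
have x1 : 0 < 1 + z / r1 by lra.
have y1 : 0 < 1 + z / r2 by lra.
rewrite shrink_sub; [|exact: ltW|exact: ltW].
have -> : (z / r1 - z / r2) / ((1 + z / r1) * (1 + z / r2)) =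
   (1 - r1 / r2) * ((z / r1) / ((1 + z / r1) * (1 + z / r2))).
  by field; rewrite !gt_eqF//; nra.
rewrite -[leRHS]mulrA; apply: ler_pM => //.
- by rewrite subr_ge0 ler_pdivrMr// mul1r.
- by apply: divr_ge0; [exact: ltW|apply: mulr_ge0; exact: ltW].
(* For [z <= 1] both sides are of order [z], whatever the ratios [r1] and [r2]. For [z > 1] they are
   of order [1 / z], and here [r2 <= r] is used. *)
have [z1|z1] := ltP 1 z; last first.
  apply: (@le_trans _ _ (z / r1)).
    by rewrite ler_pdivrMr ?mulr_gt0// ler_peMr ?(ltW x0)//; nra.
  apply: (@le_trans _ _ z).
    by rewrite ler_pdivrMr// ler_peMr// ltW.
  rewrite mulrA ler_pdivlMr ?exprn_gt0//; try lra.
  nra.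
have rr := zr z1.
apply: (@le_trans _ _ (1 + z / r2)^-1).
  rewrite invfM mulrA -[leRHS]mul1r; apply: ler_wpM2r; first by rewrite invr_ge0 ltW.
  by rewrite ler_pdivrMr// mul1r; lra.
have -> : (1 + z / r2)^-1 = r2 / (r2 + z) by field; rewrite !gt_eqF//; nra.
rewrite mulrA ler_pdivlMr ?exprn_gt0//; try lra.
rewrite mulrAC ler_pdivrMr; last by nra.
have h1 : r2 * (1 + z) ^+ 2 <= r * (1 + z) ^+ 2.
  by rewrite ler_wpM2r ?sqr_ge0.
have h2 : (1 + z) ^+ 2 <= 2 * z * (r2 + z) by nra.
apply: le_trans h1 _; rewrite [2 * r]mulrC -!mulrA; apply: ler_wpM2l; first by lra.
by rewrite mulrA.
Qed.

(** Here and in [shrink_sub_ge], [r] stands for a ratio [i^(2 d)] of prior precisions and [t] for a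
    lower bound of [r - 1], linear in [ln i]. *)
Lemma entropy_gain_ge y r t : 1 <= y -> 1 <= r -> 0 <= t -> t <= r - 1 ->
  t / (4 * r) <= ln (1 + r * y) - ln (1 + y) - ((r * y) / (1 + r * y) - y / (1 + y)).
Proof.
move=> y1 r1 t0 tr.
have y0 : 0 < y by lra.
have ry : y <= r * y by nra.
apply: le_trans (entropy_gain y0 ry).
have ry0 : 0 < 1 + r * y by lra.
apply: (@le_trans _ _ (t * (2 * r)^-1 * 2^-1)).
  by rewrite le_eqVlt; apply/orP; left; apply/eqP; field; rewrite gt_eqF//; lra.
apply: ler_pM.
- by rewrite mulr_ge0// invr_ge0; lra.
- by rewrite invr_ge0.
- rewrite ler_pdivrMr; last by lra.
  rewrite mulrAC ler_pdivlMr//.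
  have : t * (1 + r * y) <= (r - 1) * (1 + r * y) by rewrite ler_wpM2r// ltW.
  nra.
- by rewrite ler_pdivlMr; lra.
Qed.

Lemma shrink_sub_ge y r t : 0 < y -> 1 <= r -> t <= r - 1 ->
  t / r * (y / (1 + y) ^+ 2) <= (r * y) / (1 + r * y) - y / (1 + y).
Proof.
move=> y0 r1 tr; rewrite shrink_sub; [|nra|lra].
have ry0 : 0 < 1 + r * y by nra.
have y1 : 0 < 1 + y by lra.
have -> : (r * y - y) / ((1 + r * y) * (1 + y)) = (r - 1) * (y / ((1 + r * y) * (1 + y))).
  by field; rewrite !gt_eqF.
apply: (@le_trans _ _ ((r - 1) * (r^-1 * (y / (1 + y) ^+ 2)))).
  rewrite -mulrA; apply: ler_wpM2r => //.
  by rewrite mulr_ge0 ?invr_ge0 ?divr_ge0 ?sqr_ge0//; lra.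
apply: ler_wpM2l; first by lra.
rewrite mulrCA ler_pM2l// -invfM lef_pV2 ?posrE ?mulr_gt0 ?exprn_gt0//; try lra.
by rewrite expr2; nra.
Qed.

Lemma shrink_slope_le_self x : 0 <= x -> x / (1 + x) ^+ 2 <= x.
Proof.
move=> x0; rewrite ler_pdivrMr ?exprn_gt0//; last by lra.
by rewrite ler_peMr//; nra.
Qed.

Lemma shrink_slope_le_half x : 0 <= x -> x / (1 + x) ^+ 2 <= 1.
Proof. by move=> x0; rewrite ler_pdivrMr ?exprn_gt0//; [nra|lra]. Qed.

Lemma shrink_slope_le_inv x : 0 < x -> x / (1 + x) ^+ 2 <= x^-1.
Proof.
move=> x0; rewrite ler_pdivrMr ?exprn_gt0//; last by lra.
by rewrite mulrC ler_pdivlMr//; nra.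
Qed.

Lemma shrink_slope_ratio x r : 0 < x -> 1 <= r ->
  x / (1 + x) ^+ 2 <= r * ((x / r) / (1 + x / r) ^+ 2).
Proof.
move=> x0 r1; have r0 : 0 < r by lra.
rewrite mulrA mulrCA divff ?gt_eqF// mulr1 ler_pM2l//.
have h : 0 < x / r by rewrite divr_gt0.
rewrite lef_pV2 ?posrE ?exprn_gt0//; try lra.
apply: lerXn2r; rewrite ?nnegrE; try lra.
by rewrite lerD2l ler_pdivrMr// ler_peMr// ltW.
Qed.

End shrinkage.

(** * Power-weighted and logarithmic sums *)

Section log_sums.
Context {R : realType}.
Implicit Types J q : R.

Lemma ln_le_sqrt (x : R) : 0 < x -> ln x <= 2 * Num.sqrt x.
Proof.
move=> x0; have q0 : 0 < Num.sqrt x by rewrite sqrtr_gt0.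
rewrite -{1}(sqr_sqrtr (ltW x0)) lnXn// -[leLHS]mulr_natl.
by apply: ler_wpM2l => //; rewrite ltW// ln_sublinear.
Qed.

Lemma sqrt_expR (x : R) : 0 < x -> Num.sqrt x = expR (2^-1 * ln x).
Proof.
move=> x0; have -> : Num.sqrt x = Num.sqrt (expR (2^-1 * ln x) ^+ 2).
  by rewrite -expRM_natl mulVKf// lnK// posrE.
by rewrite sqrtr_sqr ger0_norm// expR_ge0.
Qed.

(* Weights equivalent to [min 1 ((J / i) ^ q)], chosen so that their sum telescopes. *)
Definition decay J q (i : nat) : R := expR (q * (ln (2 * J) - ln (i%:R + J))).

(** The summand [(2 J)^q (i + J)^(-q)] is at most the increment from [i - 1] to [i] of
    [- (2 J)^q (i + J)^(1 - q) / (q - 1)], whose value at [0] is minus the right-hand side. *)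
Lemma decay_sum J q (N : nat) : 0 < J -> 1 < q ->
  \sum_(1 <= i < N) decay J q i <= expR (q * ln 2) / (q - 1) * J.
Proof.
move=> J0 q1; have b0 : 0 < q - 1 by lra.
pose K := expR (q * ln (2 * J)) / (q - 1).
have K0 : 0 <= K by rewrite divr_ge0 ?expR_ge0// ltW.
pose F (i : nat) := - (K * expR (- ((q - 1) * ln (i%:R + J)))).
have F0 : - F 0%N = expR (q * ln 2) / (q - 1) * J.
  rewrite /F /K opprK add0r lnM ?posrE// mulrAC -expRD.
  rewrite [RHS]mulrAC -[in RHS](lnK (x := J)) ?posrE// -expRD.
  by congr (expR _ / _); ring.
have [N1|N1] := leqP N 1.
  by rewrite big_geq// -F0 /F opprK mulr_ge0// expR_ge0.
rewrite -F0.
apply: (@le_trans _ _ (F N.-1 - F 0%N)); last by rewrite gerDr oppr_le0 mulr_ge0// expR_ge0.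
elim: N N1 => // -[//|N] IH _; rewrite big_nat_recr//=.
have : decay J q N.+1 <= F N.+1 - F N.
  have y0 : 0 < N%:R + J by rewrite ltr_wpDl.
  have h := ln_incr_ge y0.
  rewrite /decay /F -[N.+1%:R]natr1 (addrAC N%:R 1 J); move: (N%:R + J) y0 h => z z0 h.
  have z1 : 0 < z + 1 by lra.
  have -> : - (K * expR (- ((q - 1) * ln (z + 1)))) - - (K * expR (- ((q - 1) * ln z))) =
    K * (expR (- ((q - 1) * ln z)) - expR (- ((q - 1) * ln (z + 1)))) by ring.
  rewrite mulrBr expRD /K -[leRHS]mulrA; apply: ler_wpM2l; first exact: expR_ge0.
  rewrite [leRHS]mulrC ler_pdivlMr//.
  have -> : expR (- (q * ln (z + 1))) = expR (- ((q - 1) * ln (z + 1))) * (z + 1)^-1.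
    rewrite -[(z + 1)^-1](lnK (x := _)) ?posrE ?invr_gt0// lnV ?posrE// -expRD.
    by congr expR; ring.
  have -> : expR (- ((q - 1) * ln z)) =
      expR (- ((q - 1) * ln (z + 1))) * expR ((q - 1) * (ln (z + 1) - ln z)).
    by rewrite -expRD; congr expR; ring.
  rewrite -[X in _ <= _ - X]mulr1 -mulrBr -mulrA; apply: ler_wpM2l; first exact: expR_ge0.
  apply: le_trans (_ : (q - 1) * (ln (z + 1) - ln z) <= _).
    by rewrite mulrC ler_pM2l.
  by rewrite lerBrDl expR_ge1Dx.
case: N IH => [|N] IH; first by rewrite big_geq// add0r.
by have := IH isT; rewrite /=; lra.
Qed.

(** Stirling's lower bound for [ln M!]. *)
Lemma log_factorial_ge (M : nat) :
  M%:R * ln M%:R - M%:R <= \sum_(1 <= i < M.+1) ln (i%:R : R).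
Proof.
elim: M => [|[|M] IH]; first by rewrite mul0r subr0 big_geq.
  by rewrite big_nat1 ln1 mulr0; lra.
rewrite big_nat_recr//=.
have m0 : 0 < M.+1%:R :> R by rewrite ltr0n.
have h := ln_incr_le m0.
move: h IH; rewrite -[M.+2%:R]natr1; move: (M.+1%:R : R) => m h IH.
by lra.
Qed.

(** Terms beyond [J] vanish. For [N <= J] the first [N] terms add up to [N ln J - ln N!], at most
    [N ln (J / N) + N <= J]. The absence of a factor [ln J] is what keeps the entropy in
    [entropy_sum_le] of order [s J]. *)
Lemma log_ratio_sum J (N : nat) : 1 <= J ->
  \sum_(1 <= i < N) Num.max 0 (ln J - ln i%:R) <= J.
Proof.
move=> J1; have J0 : 0 < J by lra.
elim: N => [|[|N] IH]; [by rewrite big_geq // ltW|by rewrite big_geq // ltW|].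
have n0 : 0 < N.+1%:R :> R by rewrite ltr0n.
have [NJ|NJ] := leP N.+1%:R J; last first.
  rewrite big_nat_recr//= max_l ?addr0// subr_le0.
  by rewrite ler_ln ?posrE// ltW.
have -> : \sum_(1 <= i < N.+2) Num.max 0 (ln J - ln i%:R) =
    \sum_(1 <= i < N.+2) (ln J - ln i%:R).
  apply: eq_big_nat => i /andP[i0 iN]; rewrite max_r// subr_ge0.
  have i0' : 0 < i%:R :> R by rewrite ltr0n.
  by rewrite ler_ln ?posrE// (le_trans _ NJ)// ler_nat.
rewrite sumrB sumr_const_nat subSS subn0 -[ln J *+ _]mulr_natl.
have h := log_factorial_ge N.+1.
have : ln (J / N.+1%:R) <= J / N.+1%:R - 1.
  have -> : J / N.+1%:R = 1 + (J / N.+1%:R - 1) by ring.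
  rewrite [X in _ <= X - 1]addrC addrK; apply: le_ln1Dx.
  by rewrite ltrBrDl subrr divr_gt0.
rewrite ln_div ?posrE// -(ler_pM2l n0).
have -> : N.+1%:R * (J / N.+1%:R - 1) = J - N.+1%:R by field; rewrite gt_eqF.
by move: h n0; move: (N.+1%:R : R) => m; lra.
Qed.

Lemma log_sum_ge (X : R) (N : nat) : expR 4 <= X -> X < N%:R ->
  X * ln X / 16 <= \sum_(1 <= i < N | i%:R <= X) ln (i%:R : R).
Proof.
move=> X4 XN.
have X5 : 5 <= X by apply: le_trans X4; have := expR_ge1Dx (4 : R); lra.
have X0 : 0 < X by lra.
pose M := Num.truncn X.
have /andP[MX _] := truncn_itv (ltW X0); rewrite -/M in MX.
have XM : X < M%:R + 1 by rewrite natr1; exact: truncnS_gt.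
have M0 : 0 < M%:R :> R by lra.
have MN : (M < N)%N by rewrite -(ltr_nat R) (le_lt_trans MX).
apply: (@le_trans _ _ (\sum_(1 <= i < M.+1) ln (i%:R : R))); last first.
  rewrite [leRHS](big_cat_nat (n := M.+1))//=.
  rewrite [leRHS](_ : _ = \sum_(1 <= i < M.+1) ln (i%:R : R) +
     \sum_(M.+1 <= i < N | i%:R <= X) ln (i%:R : R)).
    by rewrite lerDl sumr_ge0// => i _; exact: ln_nat_ge0.
  congr (_ + _); rewrite big_nat_cond [RHS]big_nat_cond; apply: eq_bigl => i.
  rewrite andbT; case: (boolP (1 <= i < M.+1)%N) => //= /andP[_ iM].
  by apply: le_trans MX; rewrite ler_nat.
apply: le_trans (log_factorial_ge M).
have lX : 4 <= ln X by rewrite -[4]expRK ler_ln ?posrE ?expR_gt0.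
have lM : ln X - 1 <= ln M%:R.
  have h : X / 2 <= M%:R by lra.
  have : ln (X / 2) <= ln M%:R by rewrite ler_ln ?posrE ?divr_gt0.
  rewrite ln_div ?posrE//.
  have : ln 2 <= 1 :> R by have := le_ln1Dx (x := 1); rewrite -natr1; apply; lra.
  lra.
have : M%:R * (ln X - 2) <= M%:R * (ln M%:R - 1) by rewrite ler_pM2l//; lra.
have : (X / 2) * (ln X / 2) <= M%:R * (ln X - 2) by apply: ler_pM; lra.
have : 0 <= X * ln X by rewrite mulr_ge0; lra.
lra.
Qed.

End log_sums.

(** * Signal-to-noise ratios and shrinkage factors *)

Section model.
Context {R : realType}.
Variables (p C : R) (kappa : nat -> R) (nu : R).
Hypotheses (p0 : 0 <= p) (C1 : 1 <= C) (Hkappa : kappa_cond p C kappa) (nu1 : 1 < nu).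
Local Notation Lam := (ln nu).
Implicit Types (a b c u v : R) (i : nat).

Definition rate a := 1 + 2 * a + 2 * p.
(* [n ^ (1 / (1 + 2 alpha + 2 p))], the effective dimension [J]. *)
Definition dimension a := expR (Lam / rate a).
(* Signal-to-noise ratio of the prior: [snr / (1 + snr)] is the shrinkage factor. *)
Definition snr a i := nu / sigk kappa a i.
Definition shr a i := snr a i / (1 + snr a i).
Definition slope a i := ln i%:R * (snr a i / (1 + snr a i) ^+ 2).
(* What the log-likelihood gains in expectation from [a] to [b] when [mu] vanishes. *)
Definition gain a b i := ln (1 + snr a i) - ln (1 + snr b i) - (shr a i - shr b i).

(** The exponential is [i^(2 (b - a))], the factor by which the prior precision grows from [a] to
    [b]. *)
Lemma expR_shift_ge1 a b i : a <= b -> 1 <= expR (2 * (b - a) * ln (i%:R : R)).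
Proof.
move=> ab; apply: le_trans (expR_ge1Dx _); rewrite lerDl.
by rewrite mulr_ge0 ?ln_nat_ge0// mulr_ge0// subr_ge0.
Qed.

Lemma nu_gt0 : 0 < nu. Proof. by have h := nu1; lra. Qed.

Lemma Lam_gt0 : 0 < Lam. Proof. exact: ln_gt0. Qed.

Lemma nuE : nu = expR Lam. Proof. by rewrite lnK// posrE nu_gt0. Qed.

Lemma C_gt0 : 0 < C. Proof. by have h := C1; lra. Qed.

Lemma rate0 : rate 0 = 1 + 2 * p. Proof. by rewrite /rate; ring. Qed.

Lemma rateD a t : rate (a + t) = rate a + 2 * t.
Proof. by rewrite /rate; ring. Qed.

Lemma rate_le a b : a <= b -> rate a <= rate b.
Proof. by move=> ab; rewrite /rate; lra. Qed.

Lemma rate_ge1 a : 0 <= a -> 1 <= rate a.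
Proof. by move=> a0; have h := p0; rewrite /rate; lra. Qed.

Lemma rate_gt0 a : 0 <= a -> 0 < rate a.
Proof. by move=> /rate_ge1; lra. Qed.

Lemma dimension_gt0 a : 0 < dimension a. Proof. exact: expR_gt0. Qed.

Lemma ln_dimension a : ln (dimension a) = Lam / rate a. Proof. exact: expRK. Qed.

Lemma dimension_ge1 a : 0 <= a -> 1 <= dimension a.
Proof.
move=> a0; apply: le_trans (expR_ge1Dx _); rewrite lerDl divr_ge0//.
  exact: ltW Lam_gt0.
exact: ltW (rate_gt0 a0).
Qed.

Lemma kappa_gt0 i : (0 < i)%N -> 0 < kappa i.
Proof.
move=> i0; have [h _] := Hkappa i0; apply: lt_le_trans h.
by rewrite mulr_gt0 ?invr_gt0 ?C_gt0// powR_gt0// ltr0n.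
Qed.

Lemma powRnE i x : (0 < i)%N -> i%:R `^ x = expR (x * ln i%:R) :> R.
Proof. by move=> i0; rewrite /powR gt_eqF// ltr0n. Qed.

Lemma sigk_gt0 a i : (0 < i)%N -> 0 < sigk kappa a i.
Proof.
move=> i0; rewrite mulr_gt0 ?powR_gt0 ?ltr0n// invr_gt0 exprn_gt0//.
exact: kappa_gt0.
Qed.

Lemma sigk_shift a b i : (0 < i)%N ->
  sigk kappa b i = expR (2 * (b - a) * ln i%:R) * sigk kappa a i.
Proof.
move=> i0; rewrite /sigk !powRnE// mulrA -expRD; congr (expR _ * _).
ring.
Qed.

Lemma kappa_sqr_le i : (0 < i)%N -> kappa i ^+ 2 <= C ^+ 2 * expR (- (2 * p * ln i%:R)).
Proof.
move=> i0; have [_ h] := Hkappa i0; have k0 := kappa_gt0 i0.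
rewrite powRnE// in h.
have -> : C ^+ 2 * expR (- (2 * p * ln i%:R)) = (C * expR (- p * ln i%:R)) ^+ 2.
  by rewrite exprMn -[in RHS]expRM_natl; congr (_ * expR _); ring.
by apply: lerXn2r h; rewrite nnegrE ?(ltW k0)// mulr_ge0 ?expR_ge0// ltW// C_gt0.
Qed.

Lemma kappa_sqr_ge i : (0 < i)%N -> expR (- (2 * p * ln i%:R)) / C ^+ 2 <= kappa i ^+ 2.
Proof.
move=> i0; have [h _] := Hkappa i0; have k0 := kappa_gt0 i0.
rewrite powRnE// in h.
have -> : expR (- (2 * p * ln i%:R)) / C ^+ 2 = (C^-1 * expR (- p * ln i%:R)) ^+ 2.
  rewrite exprMn exprVn -[in RHS]expRM_natl mulrC; congr (_ * expR _); ring.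
by apply: lerXn2r h; rewrite nnegrE ?(ltW k0)// mulr_ge0 ?expR_ge0// invr_ge0 ltW// C_gt0.
Qed.

Lemma snr_gt0 a i : (0 < i)%N -> 0 < snr a i.
Proof. by move=> i0; rewrite divr_gt0 ?nu_gt0// sigk_gt0. Qed.

Lemma snrE a i : snr a i = nu * kappa i ^+ 2 / i%:R `^ (1 + 2 * a).
Proof. by rewrite /snr /sigk invfM invrK mulrCA mulrA mulrAC mulrC mulrA mulrAC mulrA. Qed.

(** With [snr_ge]: the ratio is [n i^(- rate a)], that is [(J / i)^(rate a)], up to the factor
    [C^2]. *)
Lemma snr_le a i : (0 < i)%N -> snr a i <= C ^+ 2 * expR (Lam - rate a * ln i%:R).
Proof.
move=> i0; rewrite snrE powRnE// {1}nuE -expRN.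
have -> : C ^+ 2 * expR (Lam - rate a * ln i%:R) =
   expR Lam * (C ^+ 2 * expR (- (2 * p * ln i%:R))) * expR (- ((1 + 2 * a) * ln i%:R)).
  have -> : Lam - rate a * ln i%:R =
      Lam + (- (2 * p * ln i%:R)) + (- ((1 + 2 * a) * ln i%:R)) by rewrite /rate; ring.
  by rewrite !expRD; ring.
apply: ler_wpM2r; first exact: expR_ge0.
by apply: ler_wpM2l; [exact: expR_ge0|exact: kappa_sqr_le].
Qed.

Lemma snr_ge a i : (0 < i)%N -> expR (Lam - rate a * ln i%:R) / C ^+ 2 <= snr a i.
Proof.
move=> i0; rewrite snrE powRnE// {2}nuE -expRN.
have -> : expR (Lam - rate a * ln i%:R) / C ^+ 2 =
   expR Lam * (expR (- (2 * p * ln i%:R)) / C ^+ 2) * expR (- ((1 + 2 * a) * ln i%:R)).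
  have -> : Lam - rate a * ln i%:R =
      Lam + (- (2 * p * ln i%:R)) + (- ((1 + 2 * a) * ln i%:R)) by rewrite /rate; ring.
  by rewrite !expRD; ring.
apply: ler_wpM2r; first exact: expR_ge0.
by apply: ler_wpM2l; [exact: expR_ge0|exact: kappa_sqr_ge].
Qed.

Lemma snr_shift a b i : (0 < i)%N -> snr b i = snr a i / expR (2 * (b - a) * ln i%:R).
Proof. by move=> i0; rewrite /snr (sigk_shift a b i0) invfM mulrA mulrAC. Qed.

Lemma snr_shiftr a b i : (0 < i)%N -> snr a i = expR (2 * (b - a) * ln i%:R) * snr b i.
Proof. by move=> i0; rewrite (snr_shift a b i0) mulrC divfK// gt_eqF ?expR_gt0. Qed.

Lemma shr_snr a i : shr a i = snr a i / (1 + snr a i). Proof. by []. Qed.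

Lemma snr_sigk a i : snr a i = nu / sigk kappa a i. Proof. by []. Qed.

Lemma slopeE a i : slope a i = ln i%:R * (snr a i / (1 + snr a i) ^+ 2). Proof. by []. Qed.

Lemma gainE a b i :
  gain a b i = ln (1 + snr a i) - ln (1 + snr b i) - (shr a i - shr b i).
Proof. by []. Qed.

Lemma shrE a i : (0 < i)%N -> shr a i = nu / (sigk kappa a i + nu).
Proof.
move=> i0; have s0 := sigk_gt0 a i0; have n0 := nu_gt0.
by rewrite /shr /snr; field; rewrite !gt_eqF// addr_gt0.
Qed.

Lemma shr_ge0 a i : (0 < i)%N -> 0 <= shr a i.
Proof. by move=> i0; have h := snr_gt0 a i0; rewrite divr_ge0; lra. Qed.

Lemma shr_le a i : (0 < i)%N -> shr a i <= Num.min 1 (snr a i).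
Proof.
move=> i0; have h := snr_gt0 a i0; rewrite le_min /shr; apply/andP; split.
  by rewrite ler_pdivrMr; lra.
by rewrite ler_pdivrMr; nra.
Qed.

Lemma shr_mono u v i : (0 < i)%N -> u <= v -> shr v i <= shr u i.
Proof.
move=> i0 uv; rewrite -subr_ge0 /shr shrink_sub; try exact/ltW/snr_gt0.
have h1 := snr_gt0 u i0; have h2 := snr_gt0 v i0.
apply: divr_ge0; last by apply: mulr_ge0; lra.
by rewrite subr_ge0 (snr_shiftr u v i0) ler_peMl ?(ltW h2)// expR_shift_ge1.
Qed.

Lemma slope_ge0 a i : (0 < i)%N -> 0 <= slope a i.
Proof.
move=> i0; have h := snr_gt0 a i0.
by rewrite mulr_ge0 ?ln_nat_ge0// divr_ge0 ?sqr_ge0// ltW.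
Qed.

Lemma slope_le a i : (0 < i)%N -> slope a i <= ln i%:R * Num.min 1 (snr a i).
Proof.
move=> i0; have h := ltW (snr_gt0 a i0).
apply: ler_wpM2l; first exact: ln_nat_ge0.
by rewrite le_min shrink_slope_le_half// shrink_slope_le_self.
Qed.

Lemma shr_increment c u v i : (0 < i)%N -> C ^+ 2 <= nu -> 0 <= c -> c <= u -> u <= v ->
  v <= c + 2 / Lam -> 0 <= shr u i - shr v i <= (v - u) * (4 * expR 8 * slope c i).
Proof.
move=> i0 Cnu c0 cu uv vc; have L0 := Lam_gt0; have l0 := ln_nat_ge0 (R := R) i.
have z0 := snr_gt0 c i0.
apply/andP; split.
  by rewrite subr_ge0 shr_mono.
rewrite /shr (snr_shift c u i0) (snr_shift c v i0).
apply: le_trans (shrink_sub_le (r := expR 8) (t := 2 * (v - u) * ln i%:R) z0 _ _ _ _ _ _) _.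
- exact: expR_shift_ge1.
- by rewrite ler_expR ler_wpM2r//; lra.
(* When the data dominate, [1 < C^2 n i^(- rate c)]; as [C^2 <= n] and [rate c >= 1], this gives
   [ln i <= 2 Lam]. Over a shift of at most [2 / Lam] the precision ratio then stays below
   [expR 8]. *)
- move=> z1; rewrite ler_expR.
  have : 0 < (Lam + Lam) - rate c * ln i%:R.
    rewrite -ltr_expR expR0 -addrA expRD -nuE; apply: lt_le_trans z1 _.
    apply: le_trans (snr_le c i0) _; apply: ler_wpM2r => //; exact: expR_ge0.
  have r1 := rate_ge1 c0.
  have : ln i%:R <= rate c * ln i%:R by rewrite ler_peMl.
  move=> h1 h2; have h3 : ln i%:R <= 2 * Lam by lra.
  have h4 : v - c <= 2 / Lam by lra.
  have : (v - c) * ln i%:R <= 2 / Lam * (2 * Lam) by apply: ler_pM => //; lra.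
  have -> : 2 / Lam * (2 * Lam) = 4 by field; rewrite gt_eqF.
  lra.
- by have := expR_ge1Dx (8 : R); lra.
- by rewrite !mulr_ge0// subr_ge0.
- rewrite -expRN -expRD.
  have := expR_ge1Dx (2 * (u - c) * ln i%:R - 2 * (v - c) * ln (i%:R : R)); lra.
by rewrite le_eqVlt /slope; apply/orP; left; apply/eqP; ring.
Qed.

Lemma gain_ge0 a b i : (0 < i)%N -> a <= b -> 0 <= gain a b i.
Proof.
move=> i0 ab; have l0 := ln_nat_ge0 (R := R) i; have y0 := snr_gt0 b i0.
have yx : snr b i <= snr a i.
  rewrite (snr_shiftr a b i0) ler_peMl ?(ltW y0)//.
  exact: expR_shift_ge1.
apply: le_trans (entropy_gain y0 yx); apply: mulr_ge0; apply: divr_ge0; lra.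
Qed.

(** The last hypothesis says that the lower bound [n i^(- rate b) / C^2] of [snr b i] is at least 1.
    It also gives [ln i <= Lam], so the precision ratio is at most [expR 4]. *)
Lemma gain_ge a b i : (0 < i)%N -> 0 <= b -> 1 / Lam <= b - a -> b - a <= 2 / Lam ->
  rate b * ln i%:R + 2 * ln C <= Lam -> ln i%:R / (2 * expR 4 * Lam) <= gain a b i.
Proof.
move=> i0 b0 ba1 ba2 hi; have L0 := Lam_gt0; have l0 := ln_nat_ge0 (R := R) i.
have y0 := snr_gt0 b i0; have r1 := rate_ge1 b0.
have lC : 0 <= ln C by exact: ln_ge0.
have d0 : 0 < b - a by apply: lt_le_trans ba1; rewrite divr_gt0.
have y1 : 1 <= snr b i.
  apply: le_trans (snr_ge b i0).
  rewrite ler_pdivlMr ?exprn_gt0 ?C_gt0// mul1r -[C](lnK (x := _)) ?posrE ?C_gt0//.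
  by rewrite -expRM_natl ler_expR; lra.
have liL : ln i%:R <= Lam.
  have : ln i%:R <= rate b * ln i%:R by rewrite ler_peMl.
  lra.
set r := expR (2 * (b - a) * ln i%:R).
have rr1 : 1 <= r by apply: expR_shift_ge1; lra.
rewrite /gain /shr (snr_shiftr a b i0) -/r.
have h : 2 * (b - a) * ln i%:R <= r - 1.
  by rewrite lerBrDl expR_ge1Dx.
apply: le_trans (entropy_gain_ge y1 rr1 _ h); last by rewrite !mulr_ge0// ltW.
have r4 : r <= expR 4.
  rewrite ler_expR.
  have : (b - a) * ln i%:R <= 2 / Lam * Lam by apply: ler_pM => //; exact: ltW.
  have -> : 2 / Lam * Lam = 2 by field; rewrite gt_eqF.
  lra.
have -> : ln i%:R / (2 * expR 4 * Lam) = 2 * (1 / Lam) * ln i%:R / (4 * expR 4).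
  by field; rewrite !gt_eqF// expR_gt0.
apply: ler_pM.
- by rewrite !mulr_ge0// invr_ge0 ltW.
- by rewrite invr_ge0 mulr_ge0// expR_ge0.
- by apply: ler_wpM2r => //; rewrite ler_pM2l.
- by rewrite lef_pV2 ?posrE ?mulr_gt0 ?expR_gt0// ?ler_pM2l//; lra.
Qed.

(** For [i <= n^4] a shift by at most [2 / Lam] changes the precision by a factor of at most
    [expR 16]; larger indices are left to [slope_sig_tail]. *)
Lemma shr_decrement_ge a b i : (0 < i)%N -> 1 / Lam <= a - b -> a - b <= 2 / Lam ->
  ln i%:R <= 4 * Lam -> 2 / (expR 16 * Lam) * slope a i <= shr b i - shr a i.
Proof.
move=> i0 ab1 ab2 hi; have L0 := Lam_gt0; have l0 := ln_nat_ge0 (R := R) i.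
have y0 := snr_gt0 a i0.
have d0 : 0 < a - b by apply: lt_le_trans ab1; rewrite divr_gt0.
set r := expR (2 * (a - b) * ln i%:R).
have rr1 : 1 <= r by apply: expR_shift_ge1; lra.
rewrite /shr (snr_shiftr b a i0) -/r.
have h : 2 / Lam * ln i%:R <= r - 1.
  apply: (@le_trans _ _ (2 * (a - b) * ln i%:R)); last by rewrite lerBrDl expR_ge1Dx.
  by apply: ler_wpM2r => //; lra.
apply: le_trans (shrink_sub_ge y0 rr1 h).
have r16 : r <= expR 16.
  rewrite ler_expR.
  have : (a - b) * ln i%:R <= 2 / Lam * (4 * Lam) by apply: ler_pM => //; exact: ltW.
  have -> : 2 / Lam * (4 * Lam) = 8 by field; rewrite gt_eqF.
  lra.
have -> : 2 / (expR 16 * Lam) * slope a i =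
   2 / Lam * ln i%:R / expR 16 * (snr a i / (1 + snr a i) ^+ 2).
  by rewrite /slope; field; rewrite !gt_eqF ?expR_gt0//; lra.
apply: ler_wpM2r; first by rewrite divr_ge0 ?sqr_ge0// ltW.
apply: ler_wpM2l; first by rewrite mulr_ge0// divr_ge0// ltW.
by rewrite lef_pV2 ?posrE ?expR_gt0//; lra.
Qed.

(** Up to [J] the weight is at least 1. Beyond [J], since [n = J^(rate a)], the ratio is at most
    [C^2 (J / i)^q], and [i + J <= 2 i]. *)
Lemma min_snr_le_decay a q i : (0 < i)%N -> 0 <= a -> 0 <= q -> q <= rate a ->
  Num.min 1 (snr a i) <= C ^+ 2 * decay (dimension a) q i.
Proof.
move=> i0 a0 q0 qr; have r0 := rate_gt0 a0; have J0 := dimension_gt0 a.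
have i0' : 0 < i%:R :> R by rewrite ltr0n.
have C2 : 1 <= C ^+ 2 by rewrite expr_ge1// ltW ?C_gt0.
set J := dimension a in J0 *.
have [iJ|iJ] := leP (i%:R : R) J.
  rewrite ge_min; apply/orP; left.
  rewrite -[leLHS]mulr1; apply: ler_pM => //.
  apply: le_trans (expR_ge1Dx _); rewrite lerDl mulr_ge0// subr_ge0.
  by rewrite ler_ln ?posrE ?mulr_gt0 ?addr_gt0//; lra.
rewrite ge_min; apply/orP; right.
apply: le_trans (snr_le a i0) _; apply: ler_wpM2l; first by rewrite sqr_ge0.
rewrite ler_expR.
have lJ : ln J < ln i%:R by rewrite ltr_ln ?posrE.
have -> : Lam = rate a * ln J by rewrite ln_dimension mulrC divfK// gt_eqF.
rewrite -mulrBr.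
have : rate a * (ln J - ln i%:R) <= q * (ln J - ln i%:R).
  by rewrite ler_wnM2r//; lra.
have : ln J - ln i%:R <= ln (2 * J) - ln (i%:R + J).
  have : ln (i%:R + J) <= ln (2 * i%:R) by rewrite ler_ln ?posrE ?mulr_gt0 ?addr_gt0//; lra.
  rewrite !lnM ?posrE//; lra.
move=> h1; have : q * (ln J - ln i%:R) <= q * (ln (2 * J) - ln (i%:R + J)) by rewrite ler_wpM2l.
lra.
Qed.

End model.

(** * Sums of slopes, shrinkage factors, entropy and gain *)

Section model_sums.
Context {R : realType}.
Variables (p C : R) (kappa : nat -> R) (nu : R).
Hypotheses (p0 : 0 <= p) (C1 : 1 <= C) (Hkappa : kappa_cond p C kappa) (nu1 : 1 < nu).
Local Notation Lam := (ln nu).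
Local Notation rate := (rate p).
Local Notation dimension := (dimension p nu).
Local Notation snr := (snr kappa nu).
Local Notation shr := (shr kappa nu).
Local Notation slope := (slope kappa nu).
Local Notation gain := (gain kappa nu).
Implicit Types (a b c : R) (i N : nat).

Lemma decay1E (J : R) i : 0 < J -> decay J 1 i = 2 * J / (i%:R + J).
Proof.
move=> J0; have i0 : 0 < i%:R + J by rewrite ltr_wpDl.
by rewrite /decay mul1r expRD expRN !lnK ?posrE ?mulr_gt0.
Qed.

(** [ln i <= 2 sqrt i] is combined with the decay of exponent [q = 1], admissible even when
    [rate a = 1]; what remains is [2 sqrt (i J) <= i + J]. *)
Lemma slope_le_sqrt a i : (0 < i)%N -> 0 <= a ->
  slope a i <= 2 * C ^+ 2 * Num.sqrt (dimension a).
Proof.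
move=> i0 a0; have J0 := dimension_gt0 p nu a; have r1 := rate_ge1 p0 a0.
have i0' : 0 < i%:R :> R by rewrite ltr0n.
apply: le_trans (slope_le C1 Hkappa nu1 a i0) _.
apply: (@le_trans _ _ (2 * Num.sqrt i%:R * (C ^+ 2 * decay (dimension a) 1 i))).
  apply: ler_pM; rewrite ?ln_nat_ge0 ?ln_le_sqrt//.
    by rewrite le_min ler01 ltW// (snr_gt0 C1 Hkappa nu1).
  by apply: (min_snr_le_decay p0 C1 Hkappa nu1).
rewrite decay1E// mulrCA [leRHS]mulrAC -[leRHS]mulrC; apply: ler_wpM2l; first exact: sqr_ge0.
have := sqr_sqrtr (ltW i0'); have := sqr_sqrtr (ltW J0).
have s0 : 0 < Num.sqrt (dimension a) by rewrite sqrtr_gt0.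
have t0 : 0 < Num.sqrt (i%:R : R) by rewrite sqrtr_gt0.
move: s0 t0; move: (Num.sqrt _) (Num.sqrt _) => s t s0 t0 <- <-.
rewrite mulrA ler_pdivrMr; last by rewrite addr_gt0// exprn_gt0.
have : 0 <= t * (s - t) ^+ 2 by rewrite mulr_ge0 ?sqr_ge0// ltW.
by rewrite !expr2; lra.
Qed.

(** Even at [rate a = 1] the squared decay has exponent 2. Bounding [ln i] by [4 i^(1/4)] costs
    [i^(1/2)] of it, and the remaining exponent [3 / 2] is summable; the price is the factor
    [sqrt J]. *)
Lemma slope_sqr_sum a N : 0 <= a ->
  \sum_(1 <= i < N) slope a i ^+ 2 <=
  128 * C ^+ 4 * Num.sqrt (dimension a) * dimension a.
Proof.
move=> a0; have J0 := dimension_gt0 p nu a; have r1 := rate_ge1 p0 a0.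
set J := dimension a in J0 *.
apply: (@le_trans _ _ (\sum_(1 <= i < N) (16 * C ^+ 4 * expR (2^-1 * ln (2 * J))) * decay J (3 / 2) i)).
  apply: ler_sum_nat => i /andP[i0 _].
  have i0' : 0 < i%:R :> R by rewrite ltr0n.
  have h := slope_le C1 Hkappa nu1 a i0.
  have m0 : 0 <= Num.min 1 (snr a i) by rewrite le_min ler01 ltW// (snr_gt0 C1 Hkappa nu1).
  have hm : Num.min 1 (snr a i) <= C ^+ 2 * decay J 1 i.
    by apply: (min_snr_le_decay p0 C1 Hkappa nu1).
  have s0 : 0 < Num.sqrt (i%:R : R) by rewrite sqrtr_gt0.
  have q0 : 0 < Num.sqrt (Num.sqrt (i%:R : R)) by rewrite sqrtr_gt0.
  have hl : ln i%:R <= 4 * Num.sqrt (Num.sqrt (i%:R : R)).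
    rewrite -{1}(sqr_sqrtr (ltW i0')) lnXn// -[leLHS]mulr_natl.
    by have := ln_le_sqrt s0; lra.
  apply: (@le_trans _ _ ((4 * Num.sqrt (Num.sqrt (i%:R : R)) * (C ^+ 2 * decay J 1 i)) ^+ 2)).
    apply: lerXn2r; rewrite ?nnegrE ?(slope_ge0 C1 Hkappa nu1)//.
      have d0 : 0 <= decay J 1 i by exact: expR_ge0.
      by apply: mulr_ge0; apply: mulr_ge0 => //; exact: sqr_ge0.
    by apply: le_trans h _; apply: ler_pM => //; exact: ln_nat_ge0.
  have -> : (4 * Num.sqrt (Num.sqrt (i%:R : R)) * (C ^+ 2 * decay J 1 i)) ^+ 2 =
     16 * C ^+ 4 * (Num.sqrt i%:R * decay J 1 i ^+ 2).
    by rewrite !exprMn (sqr_sqrtr (ltW s0)); ring.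
  rewrite -[leRHS]mulrA; apply: ler_wpM2l; first by rewrite mulr_ge0// exprn_even_ge0.
  apply: (@le_trans _ _ (expR (2^-1 * ln (i%:R + J)) * decay J 1 i ^+ 2)).
    apply: ler_wpM2r; first exact: sqr_ge0.
    rewrite -[leLHS](lnK (x := _)) ?posrE// ler_expR.
    have -> : ln (Num.sqrt i%:R) = 2^-1 * ln (i%:R : R).
      by rewrite -{2}(sqr_sqrtr (ltW i0')) lnXn//; field.
    by rewrite ler_pM2l// ler_ln ?posrE ?addr_gt0//; lra.
  by rewrite le_eqVlt; apply/orP; left; apply/eqP; rewrite /decay -expRM_natl -!expRD; congr expR; field.
rewrite -mulr_sumr.
have q32 : 1 < 3 / 2 :> R by lra.
apply: le_trans (ler_wpM2l _ (decay_sum N J0 q32)) _.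
  by rewrite mulr_ge0 ?expR_ge0// mulr_ge0// exprn_even_ge0.
rewrite sqrt_expR//.
have h2 : ln (2 * J) = ln 2 + ln J by rewrite lnM ?posrE.
rewrite le_eqVlt h2; apply/orP; left; apply/eqP.
have -> : 16 * C ^+ 4 * expR (2^-1 * (ln 2 + ln J)) * (expR (3 / 2 * ln 2) / (3 / 2 - 1) * J) =
   32 * C ^+ 4 * (expR (2^-1 * (ln 2 + ln J)) * expR (3 / 2 * ln 2)) * J by field.
rewrite -expRD (_ : _ + _ = 2 * ln 2 + 2^-1 * ln J); last by field.
by rewrite expRD expRM_natl lnK ?posrE//; ring.
Qed.

Lemma shr_sum_le b q N : 0 <= b -> 1 < q -> q <= rate b ->
  \sum_(1 <= i < N) shr b i <= C ^+ 2 * (expR (q * ln 2) / (q - 1)) * dimension b.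
Proof.
move=> b0 q1 qb; have J0 := dimension_gt0 p nu b.
rewrite -[leRHS]mulrA; apply: le_trans (ler_wpM2l (sqr_ge0 C) (decay_sum N J0 q1)).
rewrite mulr_sumr; apply: ler_sum_nat => i /andP[i0 _].
apply: le_trans (shr_le C1 Hkappa nu1 b i0) _.
by apply: (min_snr_le_decay p0 C1 Hkappa nu1) => //; lra.
Qed.

(** Where [snr <= 1] the logarithm is at most [snr], summed by [decay_sum]. Elsewhere it is at most
    [1 + 2 ln C + rate b * ln (J / i)], and [log_ratio_sum] takes the last part. *)
Lemma entropy_sum_le b q N : 0 <= b -> 1 < q -> q <= rate b ->
  \sum_(1 <= i < N) ln (1 + snr b i) <=
  ((1 + 2 * ln C) * C ^+ 2 * (expR (q * ln 2) / (q - 1)) + rate b) * dimension b.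
Proof.
move=> b0 q1 qb; have J0 := dimension_gt0 p nu b.
have J1 := dimension_ge1 p0 nu1 b0; have r0 := rate_gt0 p0 b0.
have lC : 0 <= ln C by exact: ln_ge0.
apply: (@le_trans _ _ (\sum_(1 <= i < N) ((1 + 2 * ln C) * C ^+ 2 * decay (dimension b) q i +
   rate b * Num.max 0 (ln (dimension b) - ln i%:R)))).
  apply: ler_sum_nat => i /andP[i0 _]; have x0 := snr_gt0 C1 Hkappa nu1 b i0.
  have hm : Num.min 1 (snr b i) <= C ^+ 2 * decay (dimension b) q i.
    by apply: (min_snr_le_decay p0 C1 Hkappa nu1) => //; lra.
  have hM : 0 <= Num.max 0 (ln (dimension b) - ln (i%:R : R)) by rewrite le_max lexx.
  have [x1|x1] := leP (snr b i) 1.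
    rewrite min_r// in hm.
    apply: (@le_trans _ _ (snr b i)); first by apply: le_ln1Dx; lra.
    apply: le_trans hm _; rewrite -[leLHS]addr0; apply: lerD; last by rewrite mulr_ge0// ltW.
    rewrite -[X in _ <= X]mulrA ler_peMl//; last by lra.
    by rewrite mulr_ge0 ?sqr_ge0// expR_ge0.
  rewrite min_l ?(ltW x1)// in hm.
  have h1 : ln (1 + snr b i) <= 1 + ln (snr b i).
    have x2 : 0 < 1 + snr b i by apply: addr_gt0.
    have x3 : 0 < 2 * snr b i by apply: mulr_gt0.
    have : ln (1 + snr b i) <= ln (2 * snr b i).
      by rewrite ler_ln ?posrE// mulr2n mulrDl !mul1r lerD2r ltW.
    rewrite lnM ?posrE//.
    have : ln 2 <= 1 :> R by have := le_ln1Dx (x := 1); rewrite -natr1; apply; lra.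
    lra.
  have h2 : ln (snr b i) <= 2 * ln C + rate b * (ln (dimension b) - ln i%:R).
    have hs := snr_le C1 Hkappa nu1 b i0.
    have : ln (snr b i) <= ln (C ^+ 2 * expR (Lam - rate b * ln i%:R)).
      by rewrite ler_ln ?posrE// mulr_gt0 ?expR_gt0// exprn_gt0// (C_gt0 C1).
    rewrite lnM ?posrE ?expR_gt0 ?exprn_gt0 ?(C_gt0 C1)// lnXn ?(C_gt0 C1)// expRK.
    rewrite ln_dimension mulrBr mulrCA divff ?gt_eqF// mulr1 -mulr_natl; lra.
  have h3 : rate b * (ln (dimension b) - ln i%:R) <=
     rate b * Num.max 0 (ln (dimension b) - ln (i%:R : R)).
    by rewrite ler_pM2l// le_max lexx orbT.
  have h4 : (1 + 2 * ln C) * 1 <= (1 + 2 * ln C) * (C ^+ 2 * decay (dimension b) q i).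
    by rewrite ler_wpM2l//; lra.
  by rewrite -mulrA; lra.
rewrite big_split/= -!mulr_sumr [leRHS]mulrDl; apply: lerD.
  rewrite -[leRHS]mulrA; apply: ler_wpM2l; last exact: decay_sum.
  by rewrite mulr_ge0 ?sqr_ge0//; lra.
by rewrite ler_pM2l// log_ratio_sum.
Qed.

Lemma gain_sum_ge c a N : 0 <= c -> c <= a -> a <= c + 1 / Lam -> nu < N%:R ->
  8 + 4 * ln C <= ln (dimension c) ->
  dimension c * ln (dimension c) / (64 * expR 8 * C ^+ 2 * Lam) <=
  \sum_(1 <= i < N) gain a (c + 2 / Lam) i.
Proof.
move=> c0 ca ac nuN hJ; have L0 := Lam_gt0 nu1; have J0 := dimension_gt0 p nu c.
set b := c + 2 / Lam.
have Li : 0 < 1 / Lam by rewrite divr_gt0.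
have L2 : 2 / Lam = 1 / Lam + 1 / Lam by field; rewrite gt_eqF.
have b0 : 0 <= b by rewrite /b L2; lra.
have rc := rate_ge1 p0 c0; have rb := rate_ge1 p0 b0.
have lC : 0 <= ln C by exact: ln_ge0.
have ab : a <= b.
  by apply: le_trans ac _; rewrite lerD2l ler_pM2r ?invr_gt0// ler1n.
(* [expR lX] is the largest index to which [gain_ge] applies. Passing from [c] to [b] lowers
   [Lam / rate] by at most 4, so this cutoff is at least [J / (expR 4 * C^2)] with [J] the dimension
   at [c]; hence the factor [expR 8 * C^2] of the statement, one [expR 4] coming from [gain_ge]. *)
pose lX := (Lam - 2 * ln C) / rate b.
have lXE : ln (dimension c) - (4 + 2 * ln C) <= lX.
  rewrite /lX mulrBl ln_dimension.
  have h1 : Lam / rate c - Lam / rate b <= 4.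
    have -> : Lam / rate c - Lam / rate b = 4 / (rate c * rate b).
      move: rc rb; rewrite /b rateD => rc rb.
      by field; rewrite !gt_eqF//; move: rb; rewrite -(ltr_pM2r L0) => rb; nra.
    by rewrite ler_pdivrMr ?mulr_gt0//; nra.
  have h2 : 2 * ln C / rate b <= 2 * ln C.
    by rewrite ler_pdivrMr ?ler_peMr ?mulr_ge0//; lra.
  lra.
have X4 : expR 4 <= expR lX by rewrite ler_expR; lra.
have XN : expR lX < N%:R.
  apply: le_lt_trans nuN; rewrite [leRHS](nuE nu1) ler_expR /lX ler_pdivrMr; last by lra.
  have : Lam <= Lam * rate b by rewrite ler_peMr// ltW.
  lra.
apply: (@le_trans _ _ (\sum_(1 <= i < N | i%:R <= expR lX) ln i%:R / (2 * expR 4 * Lam))); last first.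
  rewrite [leRHS](bigID (fun i : nat => i%:R <= expR lX))/=.
  rewrite -[leLHS]addr0; apply: lerD; last first.
    rewrite big_nat_cond; apply: sumr_ge0 => i /andP[/andP[i0 _] _].
    exact: (gain_ge0 C1 Hkappa nu1).
  rewrite big_nat_cond [leRHS]big_nat_cond; apply: ler_sum => i /andP[/andP[i0 _] iX].
  apply: (gain_ge p0 C1 Hkappa nu1) => //.
  - by rewrite /b L2; lra.
  - by rewrite /b L2; lra.
  have : ln i%:R <= lX by rewrite -[lX]expRK ler_ln ?posrE ?expR_gt0// ltr0n.
  by rewrite /lX ler_pdivlMr; lra.
rewrite -mulr_suml.
have h := log_sum_ge X4 XN; rewrite expRK in h.
have e4 : 0 < 2 * expR 4 * Lam by rewrite !mulr_gt0// expR_gt0.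
apply: (@le_trans _ _ ((expR lX * lX / 16) / (2 * expR 4 * Lam))); last first.
  by rewrite ler_pM2r ?invr_gt0.
have -> : dimension c * ln (dimension c) / (64 * expR 8 * C ^+ 2 * Lam) =
  (dimension c / (expR 4 * C ^+ 2)) * (ln (dimension c) / 2) / 16 / (2 * expR 4 * Lam).
  have -> : expR 8 = expR 4 * expR 4 :> R by rewrite -expRD; congr expR; ring.
  have C0 := C_gt0 C1.
  by field; rewrite !gt_eqF ?expR_gt0.
rewrite ler_pM2r ?invr_gt0// ler_pM2r ?invr_gt0//; apply: ler_pM.
- apply: divr_ge0; first exact: ltW.
  by apply: mulr_ge0; [exact: expR_ge0|exact: sqr_ge0].
- by lra.
- have -> : dimension c / (expR 4 * C ^+ 2) = expR (ln (dimension c) - (4 + 2 * ln C)).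
    have -> : C ^+ 2 = expR (2 * ln C) by rewrite expRM_natl lnK// posrE (C_gt0 C1).
    by rewrite -[in LHS]expRD [in RHS]expRD [in RHS]expRN [in RHS]lnK ?posrE.
  by rewrite ler_expR.
- lra.
Qed.

End model_sums.

(** * The signal and its relation to [h_n] *)

Section signal.
Context {R : realType}.
Variables (p C : R) (kappa mu : nat -> R) (n : nat) (beta Q : R).
Hypotheses (p0 : 0 <= p) (C1 : 1 <= C) (Hkappa : kappa_cond p C kappa).
Hypotheses (n1 : 1 < n%:R :> R) (beta0 : 0 < beta).
Hypothesis HQ : forall N, \sum_(1 <= i < N) expR (2 * beta * ln i%:R) * mu i ^+ 2 <= Q.
Local Notation Lam := (ln (n%:R : R)).
Local Notation rate := (rate p).
Local Notation dimension := (dimension p (n%:R : R)).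
Local Notation snr := (snr kappa (n%:R : R)).
Local Notation shr := (shr kappa (n%:R : R)).
Local Notation slope := (slope kappa (n%:R : R)).
Implicit Types (a b c : R) (i N : nat).

Definition sig i := Num.sqrt n%:R * kappa i * mu i.

Lemma sigE i : sig i = Num.sqrt n%:R * kappa i * mu i. Proof. by []. Qed.

Lemma sig_sqr i : sig i ^+ 2 = n%:R * kappa i ^+ 2 * mu i ^+ 2.
Proof. by rewrite /sig !exprMn sqr_sqrtr// ltW// (nu_gt0 n1). Qed.

Lemma sig_sqr_le i : (0 < i)%N ->
  sig i ^+ 2 <= C ^+ 2 * expR (Lam - 2 * p * ln i%:R) * mu i ^+ 2.
Proof.
move=> i0; rewrite sig_sqr; apply: ler_wpM2r; first exact: sqr_ge0.
rewrite expRD -(nuE n1) [leRHS]mulrCA; apply: ler_wpM2l; first exact: ltW (nu_gt0 n1).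
exact: kappa_sqr_le.
Qed.

Lemma mu_sqr_le i : mu i ^+ 2 <= expR (2 * beta * ln i%:R) * mu i ^+ 2.
Proof.
rewrite ler_peMl ?sqr_ge0//; apply: le_trans (expR_ge1Dx _).
by rewrite lerDl !mulr_ge0 ?ln_nat_ge0// ltW.
Qed.

Lemma mu_sum_le N : \sum_(1 <= i < N) mu i ^+ 2 <= Q.
Proof. by apply: le_trans (HQ N); apply: ler_sum => i _; exact: mu_sqr_le. Qed.

Lemma Q_ge0 : 0 <= Q.
Proof. by have := mu_sum_le 0; rewrite big_geq. Qed.

Lemma sig_sum_le N : \sum_(1 <= i < N) sig i ^+ 2 <= n%:R * C ^+ 2 * Q.
Proof.
have n0 := nu_gt0 n1.
apply: (@le_trans _ _ (\sum_(1 <= i < N) n%:R * C ^+ 2 * mu i ^+ 2)).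
  apply: ler_sum_nat => i /andP[i0 _]; apply: le_trans (sig_sqr_le i0) _.
  apply: ler_wpM2r; first exact: sqr_ge0.
  rewrite mulrC; apply: ler_wpM2r; first exact: sqr_ge0.
  rewrite [leRHS](nuE n1) ler_expR; have := ln_nat_ge0 (R := R) i; have := p0.
  by move=> ? ?; nra.
rewrite -mulr_sumr; apply: ler_wpM2l (mu_sum_le N).
by rewrite mulr_ge0 ?sqr_ge0// ltW.
Qed.

Lemma slope_sig_ge0 a i : (0 < i)%N -> 0 <= slope a i * sig i ^+ 2.
Proof. by move=> i0; rewrite mulr_ge0 ?sqr_ge0// (slope_ge0 C1 Hkappa n1). Qed.

Lemma slope_sig_mono a N M : (N <= M)%N ->
  \sum_(1 <= i < N) slope a i * sig i ^+ 2 <= \sum_(1 <= i < M) slope a i * sig i ^+ 2.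
Proof.
move=> NM; have [N0|N0] := posnP N.
  rewrite N0 big_geq// big_nat_cond; apply: sumr_ge0 => i /andP[/andP[i0 _] _].
  exact: slope_sig_ge0.
rewrite [leRHS](big_cat_nat (n := N))//= lerDl big_nat_cond.
apply: sumr_ge0 => i /andP[/andP[i0 _] _]; apply: slope_sig_ge0; exact: leq_trans i0.
Qed.

Lemma slope_le_snr a i : (0 < i)%N ->
  slope a i <= ln i%:R * (C ^+ 2 * expR (Lam - rate a * ln i%:R)).
Proof.
move=> i0; apply: ler_wpM2l; first exact: ln_nat_ge0.
apply: le_trans (snr_le C1 Hkappa n1 a i0).
exact/shrink_slope_le_self/ltW/(snr_gt0 C1 Hkappa n1).
Qed.

Lemma slope_le_inv a i : (0 < i)%N ->
  slope a i <= ln i%:R * (C ^+ 2 * expR (rate a * ln i%:R - Lam)).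
Proof.
move=> i0; apply: ler_wpM2l; first exact: ln_nat_ge0.
have s0 := snr_gt0 C1 Hkappa n1 a i0.
apply: le_trans (shrink_slope_le_inv s0) _.
have -> : C ^+ 2 * expR (rate a * ln i%:R - Lam) =
    (expR (Lam - rate a * ln i%:R) / C ^+ 2)^-1.
  by rewrite invfM invrK -expRN opprB mulrC.
have e0 : 0 < expR (Lam - rate a * ln i%:R) / C ^+ 2.
  by rewrite divr_gt0 ?expR_gt0// exprn_gt0// (C_gt0 C1).
by rewrite lef_pV2 ?posrE//; exact: (snr_ge C1 Hkappa n1).
Qed.

(** Up to constants the left-hand side is at most [ln i * n^2 / i * mu_i^2], and [ln i <= 2 sqrt i];
    the factor [n^2 / sqrt i] is at most 1 exactly when [i >= n^4]. *)
Lemma slope_sig_tail a i : (0 < i)%N -> 0 <= a -> 4 * Lam <= ln i%:R ->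
  slope a i * sig i ^+ 2 <= 2 * C ^+ 4 * mu i ^+ 2.
Proof.
move=> i0 a0 hi; have l0 := ln_nat_ge0 (R := R) i; have r1 := rate_ge1 p0 a0.
have i0' : 0 < i%:R :> R by rewrite ltr0n.
have L0 := Lam_gt0 n1.
apply: (@le_trans _ _ (ln i%:R * (C ^+ 2 * expR (Lam - rate a * ln i%:R)) *
    (C ^+ 2 * expR (Lam - 2 * p * ln i%:R) * mu i ^+ 2))).
  apply: ler_pM; rewrite ?sqr_ge0 ?sig_sqr_le ?slope_le_snr//.
  exact: (slope_ge0 C1 Hkappa n1).
have -> : ln i%:R * (C ^+ 2 * expR (Lam - rate a * ln i%:R)) *
    (C ^+ 2 * expR (Lam - 2 * p * ln i%:R) * mu i ^+ 2) =
  (ln i%:R * (expR (Lam - rate a * ln i%:R) * expR (Lam - 2 * p * ln i%:R))) * (C ^+ 4 * mu i ^+ 2).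
  by ring.
rewrite -[leRHS]mulrA; apply: ler_wpM2r.
  by rewrite mulr_ge0 ?sqr_ge0// exprn_even_ge0.
rewrite -expRD.
have hl : ln i%:R <= 2 * expR (2^-1 * ln i%:R) :> R.
  by rewrite -sqrt_expR// ln_le_sqrt.
apply: (@le_trans _ _ (2 * expR (2^-1 * ln i%:R) *
    expR (Lam - rate a * ln i%:R + (Lam - 2 * p * ln i%:R)))).
  by apply: ler_wpM2r => //; exact: expR_ge0.
rewrite -mulrA -expRD -[leRHS]mulr1 ler_pM2l// -[leRHS]expR0 ler_expR.
have h1 : 0 <= p * ln (i%:R : R) by rewrite mulr_ge0.
have h2 : ln i%:R <= rate a * ln (i%:R : R) by rewrite ler_peMl.
lra.
Qed.

Lemma slope_sig_cvg a : 0 <= a -> cvgn (fun N => \sum_(1 <= i < N) slope a i * sig i ^+ 2).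
Proof.
move=> a0; apply: (abs_bounded_series_cvg (M := C ^+ 2 * n%:R * (n%:R * C ^+ 2 * Q))) => N.
have n0 := nu_gt0 n1.
apply: (@le_trans _ _ (\sum_(1 <= i < N) C ^+ 2 * n%:R * sig i ^+ 2)).
  apply: ler_sum_nat => i /andP[i0 _]; rewrite ger0_norm ?slope_sig_ge0//.
  apply: ler_wpM2r; first exact: sqr_ge0.
  apply: le_trans (slope_le_snr a i0) _; rewrite mulrCA; apply: ler_wpM2l; first exact: sqr_ge0.
  rewrite expRD -(nuE n1) mulrCA ler_piMr ?(ltW n0)//.
  have l0 := ln_nat_ge0 (R := R) i; have r1 := rate_ge1 p0 a0.
  rewrite expRN ler_pdivrMr ?expR_gt0// mul1r.
  have : ln i%:R <= rate a * ln (i%:R : R) by rewrite ler_peMl.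
  by have := expR_ge1Dx (rate a * ln (i%:R : R)); lra.
rewrite -mulr_sumr; apply: ler_wpM2l (sig_sum_le N).
by rewrite mulr_ge0 ?sqr_ge0// ltW.
Qed.

Lemma effective_gt0 a : 0 <= a -> 0 < dimension a * ln (dimension a).
Proof.
move=> a0; rewrite mulr_gt0 ?expR_gt0// ln_dimension divr_gt0 ?(Lam_gt0 n1)//.
exact: rate_gt0.
Qed.

Lemma h_nE a : 0 <= a ->
  h_n p kappa mu n a = limn (fun N => \sum_(1 <= i < N) slope a i * sig i ^+ 2) /
    (dimension a * ln (dimension a)).
Proof.
move=> a0; have n0 := nu_gt0 n1; have r0 := rate_gt0 p0 a0; have L0 := Lam_gt0 n1.
rewrite /h_n mulrC; congr (_ * _).
  apply: (congr1 (fun f : nat -> R => limn f)); apply/funext => N; apply: eq_big_nat => i /andP[i0 _].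
  have s0 := sigk_gt0 C1 Hkappa a i0; have k0 := kappa_gt0 C1 Hkappa i0.
  rewrite sig_sqr /slope /snr.
  have -> : i%:R `^ (1 + 2 * a) = sigk kappa a i * kappa i ^+ 2.
    by rewrite /sigk mulfVK// gt_eqF// exprn_gt0.
  by field; rewrite !gt_eqF ?addr_gt0.
rewrite ln_dimension.
have -> : n%:R `^ (1 + 2 * a + 2 * p)^-1 = dimension a.
  by rewrite /powR gt_eqF//; congr expR; rewrite mulrC.
have J0 := dimension_gt0 p (n%:R : R) a.
by rewrite -/(rate a); field; rewrite !gt_eqF.
Qed.

Lemma slope_sig_le_h a N : 0 <= a ->
  \sum_(1 <= i < N) slope a i * sig i ^+ 2 <=
  h_n p kappa mu n a * (dimension a * ln (dimension a)).
Proof.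
move=> a0; rewrite h_nE// divfK ?gt_eqF ?effective_gt0//.
by apply: nondecreasing_cvgn_le; [move=> ? ?; exact: slope_sig_mono|exact: slope_sig_cvg].
Qed.

Lemma h_lt_slope_sig a x : 0 <= a -> x < h_n p kappa mu n a ->
  exists N0, forall N, (N0 <= N)%N ->
    x * (dimension a * ln (dimension a)) < \sum_(1 <= i < N) slope a i * sig i ^+ 2.
Proof.
move=> a0; have G0 := effective_gt0 a0; rewrite h_nE// ltr_pdivlMr// => hx.
have [N0 _ H] := cvgr_gt _ (slope_sig_cvg a0) _ hx.
by exists N0 => N /H.
Qed.

Lemma dimension_mono a b : 0 <= a -> a <= b -> ln (dimension b) <= ln (dimension a).
Proof.
move=> a0 ab; rewrite !ln_dimension ler_pM2l ?(Lam_gt0 n1)//.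
by rewrite lef_pV2 ?posrE ?(rate_gt0 p0) ?rate_le//; lra.
Qed.

(* [l < h] fails at every point of [(c, alpha_low)]; for a finite sum the bound extends to
   the end point [c], which may be [0] where nothing is assumed on [h]. *)
Lemma slope_sig_below c l N : 0 <= c -> 0 < l -> (c%:E < alpha_low p kappa mu n l)%E ->
  \sum_(1 <= i < N) slope c i * sig i ^+ 2 <= 2 * l * (dimension c * ln (dimension c)).
Proof.
move=> c0 l0 hc.
(* The auxiliary point [w] depends on [N] and is so close to [c] that [i^(2 (w - c)) <= 2] for all
   [i < N]; this is the factor 2 of the statement. *)
pose t := (4 * N.+1%:R)^-1 : R.
have t0 : 0 < t by rewrite invr_gt0 mulr_gt0// ltr0n.
have [w [cw wt hw]] : exists w, [/\ c < w, w <= c + t & (w%:E < alpha_low p kappa mu n l)%E].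
  have hs : (alpha_low p kappa mu n l <= (Num.sqrt Lam)%:E)%E by rewrite /alpha_low ge_min lexx orbT.
  case E : (alpha_low p kappa mu n l) hc hs => [r| |]//= hc _.
  rewrite lte_fin in hc.
  exists (Num.min (c + t) ((c + r) / 2)); split.
  - by rewrite lt_min; apply/andP; split; lra.
  - by rewrite ge_min lexx.
  - by rewrite lte_fin gt_min; apply/orP; right; lra.
have w0 : 0 < w by lra.
have hl : h_n p kappa mu n w <= l.
  rewrite leNgt; apply/negP => lh; move: hw; rewrite /alpha_low lt_min => /andP[+ _].
  by apply/negP; rewrite -leNgt; apply: ereal_inf_lbound; exists w.
have hp := slope_sig_le_h N (ltW w0).
have Gw : dimension w * ln (dimension w) <= dimension c * ln (dimension c).
  have h := dimension_mono c0 (ltW cw).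
  apply: ler_pM => //; rewrite ?expR_ge0//.
    by rewrite ln_ge0// (dimension_ge1 p0 n1)// ltW.
  by rewrite -ler_ln ?posrE ?expR_gt0.
have Gc := effective_gt0 c0; have Gw0 := effective_gt0 (ltW w0).
apply: (@le_trans _ _ (2 * \sum_(1 <= i < N) slope w i * sig i ^+ 2)); last first.
  rewrite -mulrA ler_pM2l//; apply: le_trans hp _.
  apply: (@le_trans _ _ (l * (dimension w * ln (dimension w)))).
    by rewrite ler_pM2r.
  by rewrite ler_pM2l.
rewrite mulr_sumr; apply: ler_sum_nat => i /andP[i0 iN].
rewrite mulrA; apply: ler_wpM2r; first exact: sqr_ge0.
have s0 := snr_gt0 C1 Hkappa n1 c i0.
rewrite /slope [leRHS]mulrCA; apply: ler_wpM2l; first exact: ln_nat_ge0.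
rewrite (snr_shift kappa n%:R c w i0).
have r1 : 1 <= expR (2 * (w - c) * ln (i%:R : R)) by apply: expR_shift_ge1; exact: ltW.
apply: le_trans (shrink_slope_ratio s0 r1) _; apply: ler_wpM2r.
  rewrite divr_ge0 ?sqr_ge0// divr_ge0 ?expR_ge0//; exact: ltW.
have h : 2 * (w - c) * ln (i%:R : R) <= 2^-1.
  have lN : ln (i%:R : R) <= N.+1%:R.
    apply: le_trans (ltW (ln_sublinear _)) _; first by rewrite ltr0n.
    by rewrite ler_nat ltnW// ltnW.
  apply: (@le_trans _ _ (2 * t * N.+1%:R)).
    by apply: ler_pM => //; rewrite ?ln_nat_ge0//; lra.
  have N0 : (N.+1%:R : R) != 0 by rewrite pnatr_eq0.
  rewrite /t le_eqVlt; apply/orP; left; apply/eqP.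
  by move: (N.+1%:R : R) N0 => y y0; field.
have h2 := expR_ge1Dx (- (2 * (w - c) * ln (i%:R : R))).
have h3 : expR (2 * (w - c) * ln (i%:R : R)) * expR (- (2 * (w - c) * ln (i%:R : R))) = 1.
  by rewrite -expRD subrr expR0.
by move: h2 h3 r1 h; move: (expR _) (expR _) => x y; nra.
Qed.

(** The uniform bound that keeps [alpha_up] away from [0]: each slope, times its squared signal, is
    at most [C^4 J (ln J + 1)] times the Sobolev term of order [beta]. *)
Lemma h_le_small a : 0 < a -> a <= beta -> rate beta <= Lam ->
  h_n p kappa mu n a <= 2 * C ^+ 4 * Q.
Proof.
move=> a0 ab rL; have a0' := ltW a0; have G0 := effective_gt0 a0'.
have r0 := rate_gt0 p0 a0'; have L0 := Lam_gt0 n1.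
have J0 := dimension_gt0 p (n%:R : R) a; have q0 := Q_ge0.
set lJ := ln (dimension a).
have lJ1 : 1 <= lJ.
  rewrite /lJ ln_dimension ler_pdivlMr// mul1r; apply: le_trans rL.
  exact: rate_le.
have LE : Lam = rate a * lJ by rewrite /lJ ln_dimension mulrC divfK// gt_eqF.
have C4 : 0 <= C ^+ 4 by rewrite exprn_even_ge0.
rewrite h_nE// ler_pdivrMr//; apply: limr_le; first exact: slope_sig_cvg.
near=> N.
apply: (@le_trans _ _ (\sum_(1 <= i < N) C ^+ 4 * (dimension a * (lJ + 1)) *
    (expR (2 * beta * ln i%:R) * mu i ^+ 2))); last first.
  rewrite -mulr_sumr; apply: (@le_trans _ _ (C ^+ 4 * (dimension a * (lJ + 1)) * Q)).
    by apply: ler_wpM2l (HQ N); rewrite mulr_ge0// mulr_ge0 ?(ltW J0)//; lra.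
  have -> : 2 * C ^+ 4 * Q * (dimension a * lJ) = C ^+ 4 * (dimension a * (lJ + lJ)) * Q by ring.
  by rewrite ler_wpM2r// ler_wpM2l// ler_pM2l//; lra.
apply: ler_sum_nat => i /andP[i0 _].
rewrite mulrA -[leLHS]/(slope a i * sig i ^+ 2).
have l0 := ln_nat_ge0 (R := R) i; set li := ln (i%:R : R) in l0 *.
have rE : rate a = 1 + 2 * a + 2 * p by [].
(* Reduces the claim to a comparison of exponents, with [x = ln (1 / snr)] below [J] and
   [x = ln snr] beyond, up to constants. The term [Num.min 0 (lJ - li)] pays for the factor [ln i]
   when [i > J], as [li * expR (lJ - li) <= lJ + 1]. *)
have core x : x + Lam - (2 * p) * li <= lJ + 2 * beta * li + Num.min 0 (lJ - li) ->
    slope a i <= li * (C ^+ 2 * expR x) ->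
    slope a i * sig i ^+ 2 <= C ^+ 4 * (dimension a * (lJ + 1)) * expR (2 * beta * li) * mu i ^+ 2.
  move=> hx hs; apply: (@le_trans _ _ (li * (C ^+ 2 * expR x) *
      (C ^+ 2 * expR (Lam - 2 * p * li) * mu i ^+ 2))).
    apply: ler_pM; rewrite ?sqr_ge0 ?sig_sqr_le//.
    exact: (slope_ge0 C1 Hkappa n1).
  rewrite mulrA; apply: ler_wpM2r; first exact: sqr_ge0.
  have -> : li * (C ^+ 2 * expR x) * (C ^+ 2 * expR (Lam - 2 * p * li)) =
     C ^+ 4 * (li * (expR x * expR (Lam - 2 * p * li))) by ring.
  rewrite -[leRHS]mulrA -expRD; apply: ler_wpM2l; first exact: C4.
  apply: (@le_trans _ _ (li * expR (lJ + 2 * beta * li + Num.min 0 (lJ - li)))).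
    by apply: ler_wpM2l => //; rewrite ler_expR; lra.
  rewrite !expRD lnK ?posrE//.
  have -> : li * (dimension a * expR (2 * beta * li) * expR (Num.min 0 (lJ - li))) =
    dimension a * ((li * expR (Num.min 0 (lJ - li))) * expR (2 * beta * li)) by ring.
  rewrite -[leRHS]mulrA ler_pM2l//; apply: ler_wpM2r; first exact: expR_ge0.
  have [h|h] := leP 0 (lJ - li); first by rewrite expR0 mulr1; lra.
  have -> : lJ - li = - (li - lJ) by ring.
  rewrite expRN ler_pdivrMr ?expR_gt0//.
  have := expR_ge1Dx (li - lJ); move: (expR (li - lJ)) => e he.
  by nra.
have [h|h] := leP li lJ.
  apply: (core (rate a * li - Lam)); last exact: slope_le_inv.
  rewrite min_l; last by lra.
  have : a * li <= beta * li by rewrite ler_wpM2r.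
  by rewrite rE; lra.
apply: (core (Lam - rate a * li)); last exact: slope_le_snr.
rewrite min_r; last by lra.
rewrite LE rE.
have : 0 <= (a + 2 * p + beta) * (li - lJ).
  by rewrite mulr_ge0//; have := p0; have := beta0; lra.
have : a * lJ <= beta * lJ by rewrite ler_wpM2r//; lra.
lra.
Unshelve. all: by end_near.
Qed.

(** By monotonicity only the part of the decrement from [b] to [a] is kept, compared with the slope
    at [a] for [i <= n^4]. The other indices contribute at most [2 C^4 Q] to the slope sum, which is
    subtracted. *)
Lemma slope_sig_above a b c x N0 : 0 <= b -> 1 / Lam <= a - b -> a - b <= 2 / Lam -> a <= c ->
  (forall N, (N0 <= N)%N -> x <= \sum_(1 <= i < N) slope a i * sig i ^+ 2) ->
  forall N, (N0 <= N)%N ->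
  2 / (expR 16 * Lam) * (x - 2 * C ^+ 4 * Q) <=
  \sum_(1 <= i < N) (shr b i - shr c i) * sig i ^+ 2.
Proof.
move=> b0 ab1 ab2 ac Hx N N0N; have L0 := Lam_gt0 n1; have q0 := Q_ge0.
have Li : 0 < 1 / Lam by rewrite divr_gt0.
have a0 : 0 <= a by lra.
have e0 : 0 < 2 / (expR 16 * Lam) by rewrite divr_gt0// mulr_gt0// expR_gt0.
have C4 : 0 <= 2 * C ^+ 4 by rewrite mulr_ge0// exprn_even_ge0.
apply: (@le_trans _ _ (\sum_(1 <= i < N)
   2 / (expR 16 * Lam) * (slope a i * sig i ^+ 2 - 2 * C ^+ 4 * mu i ^+ 2))).
  rewrite -mulr_sumr ler_pM2l// sumrB -mulr_sumr; apply: lerB; first exact: Hx.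
  exact: ler_wpM2l (mu_sum_le N).
apply: ler_sum_nat => i /andP[i0 _].
have mono u v : u <= v -> shr v i <= shr u i by exact: (shr_mono C1 Hkappa n1).
have d0 : 0 <= (shr b i - shr c i) * sig i ^+ 2.
  by rewrite mulr_ge0 ?sqr_ge0// subr_ge0 mono//; lra.
have [h|h] := leP (ln (i%:R : R)) (4 * Lam).
  apply: (@le_trans _ _ (2 / (expR 16 * Lam) * slope a i * sig i ^+ 2)).
    rewrite -[leRHS]mulrA ler_pM2l// gerBl mulr_ge0 ?sqr_ge0//.
  apply: ler_wpM2r; first exact: sqr_ge0.
  apply: le_trans (shr_decrement_ge C1 Hkappa n1 i0 ab1 ab2 h) _.
  by rewrite lerD2l lerN2 mono.
apply: le_trans d0; rewrite pmulr_rle0// subr_le0.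
exact: slope_sig_tail (ltW h).
Qed.

End signal.

(** * Convergence and comparison of the likelihood series *)

Section likelihood.
Context {R : realType}.
Variables (p C : R) (kappa mu : nat -> R) (n : nat) (beta Q : R).
Hypotheses (p0 : 0 <= p) (C1 : 1 <= C) (Hkappa : kappa_cond p C kappa).
Hypotheses (n1 : 1 < n%:R :> R) (beta0 : 0 < beta).
Hypothesis HQ : forall N, \sum_(1 <= i < N) expR (2 * beta * ln i%:R) * mu i ^+ 2 <= Q.
Local Notation Lam := (ln (n%:R : R)).
Local Notation rate := (rate p).
Local Notation snr := (snr kappa (n%:R : R)).
Local Notation shr := (shr kappa (n%:R : R)).
Local Notation sig := (sig kappa mu n).
Implicit Types (a b c : R) (i N : nat).

(** A summand of [- 2 ell] in terms of the rescaled observation [sqrt n Y_i = sig i + z i]; a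
    smaller sum is a larger likelihood. *)
Definition ell_term (z : nat -> R) a i := ln (1 + snr a i) - shr a i * (sig i + z i) ^+ 2.

Lemma ell_termE (z : nat -> R) a i :
  ell_term z a i = ln (1 + snr a i) - shr a i * (sig i + z i) ^+ 2.
Proof. by []. Qed.

Lemma ell_nE (z : nat -> R) a : ell_n kappa n (obsY kappa mu n z) a =
  - 2^-1 * limn (fun N => \sum_(1 <= i < N) ell_term z a i).
Proof.
congr (_ * _); apply: (congr1 (fun f : nat -> R => limn f)); apply/funext => N.
apply: eq_big_nat => i /andP[i0 _]; rewrite /ell_term (shrE C1 Hkappa n1)//.
congr (_ - _); have n0 := nu_gt0 n1.
have s0 : 0 < Num.sqrt (n%:R : R) by rewrite sqrtr_gt0.
have -> : obsY kappa mu n z i = (Num.sqrt n%:R)^-1 * (sig i + z i).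
  by rewrite /obsY sigE; field; rewrite gt_eqF.
rewrite exprMn exprVn sqr_sqrtr ?(ltW n0)//.
have k0 := sigk_gt0 C1 Hkappa a i0.
by field; rewrite !gt_eqF ?addr_gt0.
Qed.

Lemma snr_le_inv a i : (0 < i)%N -> 0 <= a ->
  snr a i <= C ^+ 2 * n%:R * (expR (- (2 * a * ln i%:R)) / i%:R).
Proof.
move=> i0 a0; apply: le_trans (snr_le C1 Hkappa n1 a i0) _.
rewrite -mulrA; apply: ler_wpM2l; first exact: sqr_ge0.
have i0' : 0 < i%:R :> R by rewrite ltr0n.
have -> : (i%:R)^-1 = expR (- ln i%:R) :> R by rewrite expRN lnK// posrE.
have nE x : n%:R * expR x = expR (Lam + x) by rewrite expRD -(nuE n1).
rewrite -expRD nE ler_expR.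
have h : 0 <= p * ln (i%:R : R) by rewrite mulr_ge0 ?ln_nat_ge0.
have -> : rate a = rate 0 + 2 * a by rewrite -rateD add0r.
have -> : rate 0 = 1 + 2 * p by rewrite rate0.
lra.
Qed.

Lemma snr_sqr_le a i : (0 < i)%N -> 0 <= a ->
  snr a i ^+ 2 <= C ^+ 4 * n%:R ^+ 2 * (i%:R ^+ 2)^-1.
Proof.
move=> i0 a0; have x0 := snr_gt0 C1 Hkappa n1 a i0; have n0 := nu_gt0 n1.
have i0' : 0 < i%:R :> R by rewrite ltr0n.
have l0 := ln_nat_ge0 (R := R) i.
have -> : C ^+ 4 * n%:R ^+ 2 * (i%:R ^+ 2)^-1 = (C ^+ 2 * n%:R * (1 / i%:R)) ^+ 2.
  by field; rewrite gt_eqF.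
apply: lerXn2r; rewrite ?nnegrE ?(ltW x0)//.
  apply: mulr_ge0; last by apply: divr_ge0 => //; exact: ltW.
  by apply: mulr_ge0; [exact: sqr_ge0|exact: ltW].
apply: le_trans (snr_le_inv i0 a0) _; apply: ler_wpM2l.
  by rewrite mulr_ge0 ?sqr_ge0// ltW.
rewrite ler_pM2r ?invr_gt0// -[leRHS]expR0 ler_expR oppr_le0.
by rewrite mulr_ge0// mulr_ge0.
Qed.

Lemma inv_sqr_le_log_weight i : (0 < i)%N -> (i%:R ^+ 2)^-1 <= 9 * log_weight i :> R.
Proof.
move=> i0; have i0' : 1 <= i%:R :> R by rewrite ler1n.
have i1 : 0 < i%:R :> R by lra.
have l0 := ln_nat_ge0 (R := R) i.
have s0 : 0 < Num.sqrt (i%:R : R) by rewrite sqrtr_gt0.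
have s1 : 1 <= Num.sqrt (i%:R : R) by rewrite -[leLHS]sqrtr1; exact: ler_wsqrtr.
have h := ln_le_sqrt i1.
have h2 : (1 + ln (i%:R : R)) ^+ 2 <= 9 * i%:R.
  have -> : 9 * i%:R = (3 * Num.sqrt i%:R) ^+ 2 :> R.
    by rewrite exprMn sqr_sqrtr ?(ltW i1)//; ring.
  by apply: lerXn2r; rewrite ?nnegrE; lra.
have w0 : 0 < i%:R * (1 + ln (i%:R : R)) ^+ 2.
  by rewrite mulr_gt0// exprn_gt0//; lra.
rewrite /log_weight -[leLHS]div1r ler_pdivrMr ?exprn_gt0//.
rewrite mulrAC ler_pdivlMr// mul1r.
have -> : 9 * i%:R ^+ 2 = i%:R * (9 * i%:R) :> R by ring.
by rewrite ler_pM2l.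
Qed.

(** The two conditions on [z] do not mention [a]: one event of large probability gives convergence
    at all [a >= 0] simultaneously. *)
Lemma ell_cvg (z : nat -> R) a (K : R) : 0 <= a ->
  (forall N, \sum_(1 <= i < N) log_weight i * z i ^+ 2 <= K) ->
  cvgn (fun N => \sum_(1 <= i < N) shr 0 i * noise 0 (z i)) ->
  cvgn (fun N => \sum_(1 <= i < N) ell_term z a i).
Proof.
move=> a0 HK cv0; have n0 := nu_gt0 n1.
have cva : cvgn (fun N => \sum_(1 <= i < N) shr a i * noise 0 (z i)).
  have [<- //|an0] := eqVneq 0 a.
  have a1 : 0 < a by rewrite lt_neqAle an0.
  (* From [ln i <= i^a / a], so that [i^(- 2 a) (1 + ln i)^2 <= (1 + 1 / a)^2]. The constant blows
     up at [a = 0], which is why that point has its own hypothesis. *)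
  pose Ka := C ^+ 2 * n%:R * (1 + a^-1) ^+ 2.
  have Ka0 : 0 <= Ka by rewrite mulr_ge0 ?sqr_ge0// mulr_ge0 ?sqr_ge0// ltW.
  apply: (abs_bounded_series_cvg (M := Ka * (K + 2))) => N.
  apply: (@le_trans _ _ (\sum_(1 <= i < N) Ka * (log_weight i * z i ^+ 2 + log_weight i))).
    apply: ler_sum_nat => i /andP[i0 _].
    have x0 := snr_gt0 C1 Hkappa n1 a i0.
    have l0 := ln_nat_ge0 (R := R) i.
    have i1 : 0 < i%:R :> R by rewrite ltr0n.
    have sx : shr a i <= Ka * log_weight i.
      have := shr_le C1 Hkappa n1 a i0; rewrite le_min => /andP[_ /le_trans]; apply.
      apply: le_trans (snr_le_inv i0 a0) _; rewrite /Ka -[leRHS]mulrA; apply: ler_wpM2l.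
        by rewrite mulr_ge0 ?sqr_ge0// ltW.
      have e1 : 1 <= expR (a * ln (i%:R : R)).
        by apply: le_trans (expR_ge1Dx _); rewrite lerDl mulr_ge0.
      have e2 : 1 + ln i%:R <= (1 + a^-1) * expR (a * ln (i%:R : R)).
        have h := expR_ge1Dx (a * ln (i%:R : R)).
        have : ln (i%:R : R) <= a^-1 * expR (a * ln (i%:R : R)).
          by rewrite -ler_pdivrMl ?invr_gt0// invrK; lra.
        lra.
      have e3 : (1 + ln i%:R) ^+ 2 <= (1 + a^-1) ^+ 2 * expR (2 * a * ln (i%:R : R)).
        rewrite -mulrA expRM_natl -exprMn; apply: lerXn2r; rewrite ?nnegrE//; first by lra.
        by apply: le_trans e2; lra.
      rewrite /log_weight invfM [leRHS]mulrCA [leRHS]mulrC; apply: ler_wpM2r; first by rewrite invr_ge0 ltW.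
      rewrite expRN ler_pdivlMr; last by rewrite exprn_gt0//; lra.
      by rewrite mulrC ler_pdivrMr ?expR_gt0.
    have s0 := shr_ge0 C1 Hkappa n1 a i0.
    rewrite normrM ger0_norm//.
    have -> : Ka * (log_weight i * z i ^+ 2 + log_weight i) = Ka * log_weight i * (z i ^+ 2 + 1) by ring.
    apply: ler_pM => //; rewrite /noise mul0r add0r ler_norml; have := sqr_ge0 (z i).
    by move=> ?; apply/andP; split; lra.
  rewrite -mulr_sumr big_split/=; apply: ler_wpM2l => //.
  by apply: lerD => //; exact: log_weight_sum.
(* Once the centered squares are added back, what remains converges absolutely: [ln (1 + snr) - shr]
   is at most [snr^2 = O(i^-2)], and the signal and cross terms are controlled by [sig^2] and
   [(shr * z)^2]. *)
have cvA : cvgn (fun N => \sum_(1 <= i < N) (ell_term z a i + shr a i * noise 0 (z i))).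
  pose D := C ^+ 4 * n%:R ^+ 2.
  have D0 : 0 <= D by rewrite mulr_ge0 ?sqr_ge0// exprn_even_ge0.
  apply: (abs_bounded_series_cvg (M := D * 2 + 2 * (n%:R * C ^+ 2 * Q) + 9 * D * K)) => N.
  apply: (@le_trans _ _ (\sum_(1 <= i < N) (D * (i%:R ^+ 2)^-1 + 2 * sig i ^+ 2 +
      9 * D * (log_weight i * z i ^+ 2)))).
    apply: ler_sum_nat => i /andP[i0 _].
    have x0 := snr_gt0 C1 Hkappa n1 a i0.
    have s0 := shr_ge0 C1 Hkappa n1 a i0.
    have := shr_le C1 Hkappa n1 a i0; rewrite le_min => /andP[s1 sx].
    have hx := snr_sqr_le i0 a0; rewrite -/D in hx.
    have hL : ln (1 + snr a i) <= snr a i by apply: le_ln1Dx; lra.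
    have hl : 0 <= ln (1 + snr a i) - shr a i.
      have := le_ln1Dx (x := - shr a i).
      have sE : 1 + - shr a i = (1 + snr a i)^-1.
        by rewrite shr_snr; field; rewrite gt_eqF//; lra.
      have x1 : 0 < 1 + snr a i by lra.
      rewrite sE lnV ?posrE//.
      have : shr a i < 1 by have : 0 < (1 + snr a i)^-1 by [rewrite invr_gt0]; rewrite -sE; lra.
      by move=> h1 h2; have := h2 ltac:(lra); lra.
    have hr : snr a i - shr a i <= snr a i ^+ 2.
      have x1 : 0 < 1 + snr a i by lra.
      have -> : snr a i - shr a i = snr a i ^+ 2 * (1 + snr a i)^-1.
        by rewrite shr_snr; field; rewrite gt_eqF.
      by rewrite ler_piMr ?sqr_ge0// invf_le1//; lra.
    have hz : shr a i ^+ 2 * z i ^+ 2 <= 9 * D * (log_weight i * z i ^+ 2).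
      rewrite mulrA; apply: ler_wpM2r; first exact: sqr_ge0.
      apply: (@le_trans _ _ (snr a i ^+ 2)).
        by apply: lerXn2r; rewrite ?nnegrE// ltW.
      apply: le_trans hx _; rewrite [9 * D]mulrC -[leRHS]mulrA; apply: ler_wpM2l => //.
      exact: inv_sqr_le_log_weight.
    have -> : ell_term z a i + shr a i * noise 0 (z i) =
       (ln (1 + snr a i) - shr a i) - (shr a i * sig i ^+ 2 + 2 * sig i * (shr a i * z i)).
      by rewrite /ell_term /noise; ring.
    have h3 : shr a i * sig i ^+ 2 <= sig i ^+ 2 by rewrite ler_piMl ?sqr_ge0.
    have h4 : 0 <= shr a i * sig i ^+ 2 by rewrite mulr_ge0 ?sqr_ge0.
    move: hz; rewrite -exprMn.
    have := sqr_ge0 (sig i - shr a i * z i); have := sqr_ge0 (sig i + shr a i * z i).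
    rewrite sqrrD sqrrB.
    have hE : ln (1 + snr a i) - shr a i <= D * (i%:R ^+ 2)^-1.
      by apply: le_trans hx; apply: le_trans hr; rewrite lerD2r.
    have w0 : 0 <= D * (i%:R ^+ 2)^-1 by exact: le_trans hl hE.
    move: hl hE w0 h3 h4.
    move: (ln (1 + _) - _) (D * (i%:R ^+ 2)^-1) (shr a i * sig i ^+ 2) => E' W u.
    move: (shr a i * z i) (sig i) (9 * D * _) => y x K' *.
    by rewrite ler_norml; apply/andP; split; lra.
  rewrite !big_split/= -!mulr_sumr; apply: lerD; first apply: lerD.
  - by apply: ler_wpM2l => //; exact: sum_inv_sqr_le.
  - by apply: ler_wpM2l => //; exact: (sig_sum_le p0 C1 Hkappa n1 beta0 HQ).
  - by apply: ler_wpM2l => //; rewrite mulr_ge0.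
have -> : (fun N => \sum_(1 <= i < N) ell_term z a i) =
    (fun N => \sum_(1 <= i < N) (ell_term z a i + shr a i * noise 0 (z i))) -
    (fun N => \sum_(1 <= i < N) shr a i * noise 0 (z i)).
  apply/funext => N; rewrite /GRing.add/= /GRing.opp/= -sumrB.
  by apply: eq_bigr => i _; rewrite addrK.
exact: is_cvgB.
Qed.

(** Both series converge, so a gap [e] seen along a subsequence of partial sums persists in the
    limit. *)
Lemma ell_lt (z : nat -> R) a b (e : R) : 0 < e ->
  cvgn (fun N => \sum_(1 <= i < N) ell_term z a i) ->
  cvgn (fun N => \sum_(1 <= i < N) ell_term z b i) ->
  (forall N0, exists2 N, (N0 <= N)%N &
     e <= \sum_(1 <= i < N) (ell_term z a i - ell_term z b i)) ->
  ell_n kappa n (obsY kappa mu n z) a < ell_n kappa n (obsY kappa mu n z) b.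
Proof.
move=> e0 cva cvb H; rewrite !ell_nE.
set la := limn _; set lb := limn _.
suff : e <= la - lb by lra.
rewrite leNgt; apply/negP => h.
have cv : (fun N => \sum_(1 <= i < N) (ell_term z a i - ell_term z b i)) @ \oo --> la - lb.
  have -> : (fun N => \sum_(1 <= i < N) (ell_term z a i - ell_term z b i)) =
      (fun N => \sum_(1 <= i < N) ell_term z a i) - (fun N => \sum_(1 <= i < N) ell_term z b i).
    by apply/funext => N; rewrite /GRing.add/= /GRing.opp/= -sumrB.
  exact: (cvgB cva cvb).
have [N0 _ HN] := cvgr_lt _ cv _ h.
have [N N0N] := H N0; apply/negP; rewrite -ltNge; exact: HN.
Qed.

End likelihood.

Section constants.
Context {R : realType}.
Implicit Types C : R.

(* [gain_const] comes from [gain_sum_ge]; [low_const], the constant [l] of the theorem, makes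
   the signal at most a quarter of the gain; [noise_const ^ 2] bounds the noise variance. *)
Definition gain_const C := (64 * expR 8 * C ^+ 2)^-1.
Definition low_const C := gain_const C / (64 * expR 8).
Definition noise_const C := 512 * 528 * expR 16 * C ^+ 4.

Lemma gain_const_gt0 C : 0 < C -> 0 < gain_const C.
Proof. by move=> C0; rewrite invr_gt0 !mulr_gt0 ?expR_gt0// exprn_gt0. Qed.

Lemma low_const_gt0 C : 0 < C -> 0 < low_const C.
Proof. by move=> C0; rewrite divr_gt0 ?gain_const_gt0// mulr_gt0// expR_gt0. Qed.

Lemma low_const_le1 C : 1 <= C -> low_const C <= 1.
Proof.
move=> C1; have C0 : 0 < C by lra.
have e1 : 1 <= expR 8 :> R by have := expR_ge1Dx (8 : R); lra.
have C2 : 1 <= C ^+ 2 by rewrite expr_ge1// ltW.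
rewrite /low_const ler_pdivrMr ?mulr_gt0 ?expR_gt0// mul1r.
apply: (@le_trans _ _ 1); last by lra.
by rewrite /gain_const invf_le1 ?mulr_gt0 ?expR_gt0 ?exprn_gt0//; nra.
Qed.

Lemma noise_const_ge1 C : 1 <= C -> 1 <= noise_const C.
Proof.
move=> C1; have C0 : 0 < C by lra.
have e1 : 1 <= expR 16 :> R by have := expR_ge1Dx (16 : R); lra.
have C2 : 1 <= C ^+ 4 by rewrite expr_ge1// ltW.
by rewrite /noise_const; nra.
Qed.

End constants.

(** * Comparison of two points for a fixed noise sequence *)

Section deterministic.
Context {R : realType}.
Variables (p C : R) (kappa mu : nat -> R) (n : nat) (beta Q : R).
Hypotheses (p0 : 0 <= p) (C1 : 1 <= C) (Hkappa : kappa_cond p C kappa).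
Hypotheses (n1 : 1 < n%:R :> R) (beta0 : 0 < beta).
Hypothesis HQ : forall N, \sum_(1 <= i < N) expR (2 * beta * ln i%:R) * mu i ^+ 2 <= Q.
Local Notation Lam := (ln (n%:R : R)).
Local Notation rate := (rate p).
Local Notation dimension := (dimension p (n%:R : R)).
Local Notation snr := (snr kappa (n%:R : R)).
Local Notation shr := (shr kappa (n%:R : R)).
Local Notation slope := (slope kappa (n%:R : R)).
Local Notation gain := (gain kappa (n%:R : R)).
Local Notation sig := (sig kappa mu n).
Local Notation ell_term := (ell_term kappa mu n).
Implicit Types (a b c : R) (i N : nat).

Lemma lower_cell (z : nat -> R) c a N : C ^+ 2 <= n%:R -> 0 <= c -> c <= a -> a <= c + 1 / Lam ->
  8 + 4 * ln C <= ln (dimension c) -> n%:R < N%:R :> R ->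
  (c%:E < alpha_low p kappa mu n (low_const C))%E ->
  `|\sum_(1 <= i < N) (shr a i - shr (c + 2 / Lam) i) * noise (2 * sig i) (z i)| <=
     gain_const C * (dimension c * ln (dimension c)) / (4 * Lam) ->
  gain_const C * (dimension c * ln (dimension c)) / (2 * Lam) <=
  \sum_(1 <= i < N) (ell_term z a i - ell_term z (c + 2 / Lam) i).
Proof.
move=> Cn c0 ca ac hJ nN hc hX; have L0 := Lam_gt0 n1; have C0 := C_gt0 C1.
have L2 : 2 / Lam = 1 / Lam + 1 / Lam by field; rewrite gt_eqF.
have Li : 0 < 1 / Lam by rewrite divr_gt0.
have hg := gain_sum_ge p0 C1 Hkappa n1 c0 ca ac nN hJ.
have hs := slope_sig_below p0 C1 Hkappa n1 beta0 HQ N c0 (low_const_gt0 C0) hc.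
set b := c + 2 / Lam in hX hg *; set G := dimension c * ln (dimension c) in hX hg hs *.
(* The constant 1 in [(m + z)^2 = m^2 + 1 + noise (2 m) z] contributes the difference of shrinkage
   factors, which turns the difference of entropies into [gain]. *)
have E : \sum_(1 <= i < N) (ell_term z a i - ell_term z b i) =
   \sum_(1 <= i < N) gain a b i - \sum_(1 <= i < N) (shr a i - shr b i) * sig i ^+ 2
   - \sum_(1 <= i < N) (shr a i - shr b i) * noise (2 * sig i) (z i).
  by rewrite -!sumrB; apply: eq_bigr => i _; rewrite !ell_termE gainE /noise; ring.
have hsig : \sum_(1 <= i < N) (shr a i - shr b i) * sig i ^+ 2 <= gain_const C * G / (4 * Lam).
  apply: (@le_trans _ _ (\sum_(1 <= i < N) 2 / Lam * (4 * expR 8) * (slope c i * sig i ^+ 2))).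
    apply: ler_sum_nat => i /andP[i0 _]; rewrite [leRHS]mulrA.
    apply: ler_wpM2r; first exact: sqr_ge0.
    have ab : a <= b by apply: le_trans ac _; rewrite lerD2l ler_pM2r ?invr_gt0// ler1n.
    have /andP[_] := shr_increment p0 C1 Hkappa n1 i0 Cn c0 ca ab (lexx _).
    move=> /le_trans; apply.
    rewrite -[leRHS]mulrA; apply: ler_wpM2r.
      by rewrite mulr_ge0 ?(slope_ge0 C1 Hkappa n1)// mulr_ge0// expR_ge0.
    by rewrite /b; lra.
  rewrite -mulr_sumr.
  have e0 : 0 < 2 / Lam * (4 * expR 8) by rewrite !mulr_gt0 ?expR_gt0// invr_gt0.
  apply: le_trans (ler_wpM2l (ltW e0) hs) _.
  have e8 : expR 8 != 0 :> R by rewrite gt_eqF ?expR_gt0.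
  rewrite /low_const le_eqVlt; apply/orP; left; apply/eqP; field.
  by rewrite e8 gt_eqF.
have hgain : gain_const C * G / Lam <= \sum_(1 <= i < N) gain a b i.
  apply: le_trans hg; rewrite le_eqVlt /gain_const; apply/orP; left; apply/eqP; field.
  by rewrite !gt_eqF ?expR_gt0.
move: hX; rewrite ler_norml => /andP[_ hX]; rewrite E.
have -> : gain_const C * G / (2 * Lam) = gain_const C * G / Lam
   - gain_const C * G / (4 * Lam) - gain_const C * G / (4 * Lam).
  by field; rewrite gt_eqF.
by apply: lerB => //; apply: lerB.
Qed.

Lemma upper_cell (z : nat -> R) a0 a b q L K2 eta N0 : 1 <= Lam -> 0 <= b -> 0 < eta ->
  1 < q -> q <= rate b -> 1 / Lam <= a0 - b -> a0 - b <= 2 / Lam -> a0 <= a -> a <= Lam ->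
  L = 2 * expR 20 * (3 + 2 * p) ^+ 2 + 1 -> K2 = C ^+ 2 * (expR (q * ln 2) / (q - 1)) ->
  2 * expR 16 * (3 + 2 * p) * (expR 4 * ((1 + 2 * ln C) * K2 + K2 / eta) + 1 + 2 * C ^+ 4 * Q) <= Lam ->
  (forall N, (N0 <= N)%N -> L * Lam ^+ 2 * (dimension a0 * ln (dimension a0)) <=
     \sum_(1 <= i < N) slope a0 i * sig i ^+ 2) ->
  (forall N, \sum_(1 <= i < N) shr b i * z i ^+ 2 <= K2 * dimension b / eta) ->
  forall N, (N0 <= N)%N -> 1 <= \sum_(1 <= i < N) (ell_term z a i - ell_term z b i).
Proof.
move=> Lam1 b0 eta0 q1 qb ab1 ab2 aa aL LE K2E hLam hS hZ N N0N.
have L0 := Lam_gt0 n1; have C0 := C_gt0 C1; have P0 := p0; have Q0 := Q_ge0 beta0 HQ.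
have Li : 0 < 1 / Lam by rewrite divr_gt0.
have a00 : 0 <= a0 by lra.
have lC : 0 <= ln C by exact: ln_ge0.
have C4 : 0 <= C ^+ 4 by rewrite exprn_even_ge0.
have hsig := slope_sig_above p0 C1 Hkappa n1 beta0 HQ b0 ab1 ab2 aa hS N0N.
have hent := entropy_sum_le p0 C1 Hkappa n1 N b0 q1 qb.
have CQ : 0 <= 2 * C ^+ 4 * Q by apply: mulr_ge0 => //; exact: mulr_ge0.
have J0 := dimension_gt0 p (n%:R : R) a0; have Jb0 := dimension_gt0 p (n%:R : R) b.
have J1 := dimension_ge1 p0 n1 a00.
have s1 := rate_ge1 p0 a00; have sb1 := rate_ge1 p0 b0.
have sb : rate b <= rate a0 by apply: rate_le; lra.
have sK : rate a0 <= (3 + 2 * p) * Lam.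
  have -> : rate a0 = rate 0 + 2 * a0 by rewrite -rateD add0r.
  by rewrite rate0; nra.
(* A shift by at most [2 / Lam] moves [Lam / rate] by at most 4, so all terms can be expressed in
   the dimension at [a0]. *)
have Jb : dimension b <= expR 4 * dimension a0.
  rewrite -[dimension a0](lnK (x := _)) ?posrE// -expRD.
  rewrite -[dimension b](lnK (x := _)) ?posrE// ler_expR !ln_dimension.
  have -> : Lam / rate b = Lam / rate a0 + Lam * (rate a0 - rate b) / (rate a0 * rate b).
    by field; rewrite !gt_eqF//; lra.
  rewrite addrC lerD2r ler_pdivrMr ?mulr_gt0//; try lra.
  have -> : rate a0 - rate b = 2 * (a0 - b).
    have -> : rate a0 = rate b + 2 * (a0 - b) by rewrite -rateD; congr (_ _); ring.
    ring.
  have : Lam * (2 * (a0 - b)) <= Lam * (2 * (2 / Lam)) by rewrite ler_pM2l//; lra.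
  have -> : Lam * (2 * (2 / Lam)) = 4 by field; rewrite gt_eqF.
  have : 4 * 1 <= 4 * (rate a0 * rate b) by rewrite ler_pM2l//; nra.
  lra.
(* Three losses remove [a] from all terms but the signal: [ln (1 + snr a i)] is dropped,
   [(m + z)^2 >= m^2 / 2 - z^2], and the decrement multiplying [z^2] is bounded by [shr b i]. *)
have T : \sum_(1 <= i < N) (- ln (1 + snr b i) + 2^-1 * ((shr b i - shr a i) * sig i ^+ 2)
     - shr b i * z i ^+ 2) <= \sum_(1 <= i < N) (ell_term z a i - ell_term z b i).
  apply: ler_sum_nat => i /andP[i0 _]; rewrite !ell_termE.
  have x0 := snr_gt0 C1 Hkappa n1 a i0.
  have la : 0 <= ln (1 + snr a i) by apply: ln_ge0; lra.
  have sa := shr_ge0 C1 Hkappa n1 a i0.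
  have d0 : 0 <= shr b i - shr a i.
    by rewrite subr_ge0 (shr_mono C1 Hkappa n1)//; lra.
  have h1 : 2^-1 * ((shr b i - shr a i) * sig i ^+ 2) - (shr b i - shr a i) * z i ^+ 2 <=
     (shr b i - shr a i) * (sig i + z i) ^+ 2.
    have := mulr_ge0 d0 (sqr_ge0 (sig i + 2 * z i)).
    have : 0 <= (shr b i - shr a i) * (sig i + z i + z i) ^+ 2 by rewrite mulr_ge0 ?sqr_ge0.
    move: (shr b i - shr a i) (sig i) (z i) => D x y; rewrite !expr2; lra.
  have h2 : (shr b i - shr a i) * z i ^+ 2 <= shr b i * z i ^+ 2.
    by apply: ler_wpM2r; [exact: sqr_ge0|lra].
  lra.
apply: le_trans T; rewrite big_split/= big_split/= sumrN sumrN -mulr_sumr.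
have hZN := hZ N.
set S := \sum_(_ <= _ < _) _ * sig _ ^+ 2 in hsig *.
set En := \sum_(_ <= _ < _) ln _ in hent *.
set Zn := \sum_(_ <= _ < _) _ * z _ ^+ 2 in hZN *.
have K20 : 0 <= K2.
  by rewrite K2E mulr_ge0 ?sqr_ge0// divr_ge0 ?expR_ge0//; lra.
have hent' : En <= ((1 + 2 * ln C) * K2 + rate a0) * (expR 4 * dimension a0).
  apply: le_trans hent _; apply: ler_pM => //.
  - rewrite addr_ge0//; last by lra.
    rewrite -mulrA -K2E mulr_ge0//; lra.
  - exact: ltW.
  - by rewrite -mulrA -K2E lerD2l.
have hZ' : Zn <= K2 / eta * (expR 4 * dimension a0).
  apply: le_trans hZN _; rewrite mulrAC; apply: ler_wpM2l => //.
  by rewrite divr_ge0// ltW.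
have hS1 : L * Lam ^+ 2 * dimension a0 / (expR 16 * rate a0) - 2 * C ^+ 4 * Q <= 2^-1 * S.
  have -> : L * Lam ^+ 2 * dimension a0 / (expR 16 * rate a0) =
     2^-1 * (2 / (expR 16 * Lam) * (L * Lam ^+ 2 * (dimension a0 * ln (dimension a0)))).
    rewrite ln_dimension; field; rewrite !gt_eqF ?expR_gt0//; lra.
  apply: (@le_trans _ _ (2^-1 * (2 / (expR 16 * Lam) * (L * Lam ^+ 2 *
     (dimension a0 * ln (dimension a0)) - 2 * C ^+ 4 * Q)))); last by rewrite ler_pM2l.
  set X := L * _ * _.
  have e1 : (expR 16 * Lam)^-1 <= 1.
    rewrite invf_le1 ?mulr_gt0 ?expR_gt0//.
    by have := expR_ge1Dx (16 : R); nra.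
  have : (expR 16 * Lam)^-1 * (2 * C ^+ 4 * Q) <= 1 * (2 * C ^+ 4 * Q).
    exact: ler_wpM2r.
  lra.
(* After division by [J], signal against entropy. Multiplying by [expR 16 * rate a0] produces
   [rate a0 ^ 2], and [rate a0 <= (3 + 2 p) Lam]: the square in the threshold [L (ln n)^2] absorbs
   it. The main part of [L] pays for the entropy, the [+ 1] for all remaining constants. *)
have key : (expR 4 * ((1 + 2 * ln C) * K2 + K2 / eta) + 1 + 2 * C ^+ 4 * Q + expR 4 * rate a0)
    <= L * Lam ^+ 2 / (expR 16 * rate a0).
  rewrite ler_pdivlMr ?mulr_gt0 ?expR_gt0//; last by lra.
  set X := _ + 1 + _ in hLam *.
  have X0 : 0 <= X.
    rewrite /X; have : 0 <= K2 / eta by rewrite divr_ge0// ltW.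
    have := expR_gt0 (4 : R); have := CQ.
    have : 0 <= (1 + 2 * ln C) * K2 by rewrite mulr_ge0//; lra.
    by move=> ? ? ? ?; nra.
  have L1 : 1 <= L - 2 * expR 20 * (3 + 2 * p) ^+ 2 by rewrite LE; lra.
  have hA : X * (expR 16 * rate a0) <= Lam ^+ 2.
    apply: (@le_trans _ _ (X * (expR 16 * ((3 + 2 * p) * Lam)))).
      by apply: ler_wpM2l => //; rewrite ler_pM2l ?expR_gt0.
    have -> : X * (expR 16 * ((3 + 2 * p) * Lam)) = expR 16 * (3 + 2 * p) * X * Lam by ring.
    rewrite expr2 ler_pM2r//; apply: le_trans hLam.
    have : 0 <= expR 16 * (3 + 2 * p) * X by rewrite !mulr_ge0 ?expR_ge0//; lra.
    lra.
  have hB : expR 4 * rate a0 * (expR 16 * rate a0) <= expR 20 * (3 + 2 * p) ^+ 2 * Lam ^+ 2.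
    have -> : expR 20 = expR 4 * expR 16 :> R by rewrite -expRD; congr expR; ring.
    have -> : expR 4 * rate a0 * (expR 16 * rate a0) = expR 4 * expR 16 * rate a0 ^+ 2 by ring.
    rewrite -[leRHS]mulrA -exprMn; apply: ler_wpM2l; first by rewrite mulr_ge0 ?expR_ge0.
    by apply: lerXn2r => //; rewrite nnegrE; lra.
  rewrite mulrDl LE.
  have : 0 <= expR 20 * (3 + 2 * p) ^+ 2 * Lam ^+ 2 by rewrite mulr_ge0 ?sqr_ge0// mulr_ge0 ?expR_ge0 ?sqr_ge0.
  lra.
have := ler_wpM2r (ltW J0) key.
have -> : L * Lam ^+ 2 / (expR 16 * rate a0) * dimension a0 =
  L * Lam ^+ 2 * dimension a0 / (expR 16 * rate a0) by rewrite mulrAC.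
have : (1 + 2 * C ^+ 4 * Q) * 1 <= (1 + 2 * C ^+ 4 * Q) * dimension a0.
  by apply: ler_wpM2l => //; exact: addr_ge0.
lra.
Qed.

End deterministic.

(** The term of degree 6 of the exponential series, [L^3 / (720 D^6)], leaves one power of [L]
    beyond [L^2] to absorb the constants. With [L = ln n], the failure probability of a cell beats
    the number of cells. *)
Lemma expR_sqrt_ge (R : realType) (L D M : R) : 0 < L -> 0 < D -> 720 * D ^+ 6 * M <= L ->
  L ^+ 2 * M <= expR (Num.sqrt L / D).
Proof.
move=> L0 D0 h.
have y0 : 0 <= Num.sqrt L / D by rewrite divr_ge0// ltW.
have := expR_ge1Dxn 5 y0; rewrite (_ : (6`!)%:R = 720 :> R)//.
have -> : (Num.sqrt L / D) ^+ 6 = L ^+ 3 / D ^+ 6.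
  by rewrite -[in RHS](sqr_sqrtr (ltW L0)) -exprM exprMn exprVn.
have D6 : 0 < D ^+ 6 by rewrite exprn_gt0.
have k0 : 0 < 720 :> R by rewrite ltr0n.
move: h k0 D6; move: (720 : R) (D ^+ 6) => k D' h k0 D6 hR.
apply: (@le_trans _ _ (L ^+ 3 / D' / k)); last by lra.
rewrite -mulrA -invfM ler_pdivlMr ?mulr_gt0//.
have -> : L ^+ 3 = L ^+ 2 * L by ring.
rewrite -mulrA; apply: ler_wpM2l; first exact: sqr_ge0.
by apply: le_trans h; rewrite le_eqVlt; apply/orP; left; apply/eqP; ring.
Qed.

(** * Localization of the maximizer *)

Section events.
Context d (T : measurableType d) {R : realType} (P : probability T R).
Variable Z : nat -> T -> R.
Hypothesis HZ : iid_std_normal P Z.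
Variables (p C : R) (kappa mu : nat -> R) (n : nat) (beta Q : R).
Hypotheses (p0 : 0 <= p) (C1 : 1 <= C) (Hkappa : kappa_cond p C kappa).
Hypotheses (n1 : 1 < n%:R :> R) (beta0 : 0 < beta).
Hypothesis HQ : forall N, \sum_(1 <= i < N) expR (2 * beta * ln i%:R) * mu i ^+ 2 <= Q.
Local Notation Lam := (ln (n%:R : R)).
Local Notation rate := (rate p).
Local Notation dimension := (dimension p (n%:R : R)).
Local Notation snr := (snr kappa (n%:R : R)).
Local Notation shr := (shr kappa (n%:R : R)).
Local Notation slope := (slope kappa (n%:R : R)).
Local Notation sig := (sig kappa mu n).
Implicit Types (a b c : R) (i N : nat).

(** The sums start at 1, but the noise and series lemmas quantify over every index; at [0] the value
    comes from the conventions [0 ^ x = 0] for nonzero [x] and [x / 0 = 0]. *)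
Lemma shr_index0 a : 0 <= a -> shr a 0%N = 0.
Proof.
move=> a0; rewrite shr_snr; have -> : snr a 0%N = 0; last by rewrite mul0r.
by rewrite snr_sigk /sigk powR0 ?mul0r ?invr0 ?mulr0// gt_eqF//; lra.
Qed.

Lemma slope_index0 a : slope a 0%N = 0.
Proof. by rewrite slopeE ln0// mul0r. Qed.

Lemma likely_cell c N : C ^+ 2 <= n%:R -> 0 <= c -> 1 <= ln (dimension c) ->
  (c%:E < alpha_low p kappa mu n (low_const C))%E ->
  likely P (16 * noise_const C / (gain_const C * expR (8^-1 * ln (dimension c))))
   (fun o => forall a, c <= a <= c + 2 / Lam ->
     `|\sum_(1 <= i < N) (shr a i - shr (c + 2 / Lam) i) * noise (2 * sig i) (Z i o)| <=
     gain_const C * (dimension c * ln (dimension c)) / (4 * Lam)).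
Proof.
move=> Cn c0 hJ hc; have L0 := Lam_gt0 n1; have C0 := C_gt0 C1.
have J0 := dimension_gt0 p (n%:R : R) c; have g0 := gain_const_gt0 C0.
have K1 := noise_const_ge1 C1; have l0 := low_const_gt0 C0; have l1 := low_const_le1 C1.
(* In powers of [r = J^(1/8)], up to constants: slopes are at most [r^4], [ln J] at most [r], the
   signal sum at most [r^9], so the two parts of the variance are at most [r^13] and [r^12]. With
   [B] of order [r^7] against [J = r^8], a factor [r] is left for the probability. *)
pose r := expR (8^-1 * ln (dimension c)).
have r1 : 1 <= r by apply: le_trans (expR_ge1Dx _); lra.
have r0 : 0 < r by lra.
have Jr : dimension c = r ^+ 8.
  by rewrite -expRM_natl mulVKf// lnK// posrE.
have sJ : Num.sqrt (dimension c) = r ^+ 4.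
  by rewrite sqrt_expR// -expRM_natl; congr expR; field.
have lJ : ln (dimension c) <= 8 * r.
  rewrite Jr lnXn// -[leLHS]mulr_natl ler_pM2l//; exact/ltW/ln_sublinear.
pose e i := 4 * expR 8 * slope c i.
pose B := noise_const C * r ^+ 7.
have B0 : 0 < B by rewrite mulr_gt0 ?exprn_gt0//; lra.
pose t := gain_const C * (dimension c * ln (dimension c)) / (4 * Lam).
have G0 := effective_gt0 p0 n1 c0.
have t0 : 0 < t by apply: divr_gt0; exact: mulr_gt0.
have len0 : 0 < 2 / Lam by rewrite divr_gt0.
have e0 i : 0 <= e i.
  case: i => [|i]; first by rewrite /e slope_index0 mulr0.
  by rewrite mulr_ge0 ?(slope_ge0 C1 Hkappa n1)// mulr_ge0// expR_ge0.
have fe i u v : c <= u -> u <= v -> v <= c + 2 / Lam ->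
    0 <= shr u i - shr v i <= (v - u) * e i.
  case: i => [|i] cu uv vc; last exact: (shr_increment p0 C1 Hkappa n1).
  by rewrite !shr_index0 ?subrr ?lexx /= /e ?slope_index0 ?mulr0//; lra.
have eB : \sum_(1 <= i < N) e i ^+ 2 * (8 * sig i ^+ 2 + 130) <= B ^+ 2.
  have hs := slope_sig_below p0 C1 Hkappa n1 beta0 HQ N c0 l0 hc.
  have hq := slope_sqr_sum p0 C1 Hkappa n1 N c0.
  apply: (@le_trans _ _ (\sum_(1 <= i < N) 16 * expR 16 *
     (16 * C ^+ 2 * r ^+ 4 * (slope c i * sig i ^+ 2) + 130 * slope c i ^+ 2))).
    apply: ler_sum_nat => i /andP[i0 _].
    have h1 := slope_le_sqrt p0 C1 Hkappa n1 i0 c0; rewrite sJ in h1.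
    have h2 := slope_sig_ge0 mu C1 Hkappa n1 c i0.
    have h3 : slope c i * (slope c i * sig i ^+ 2) <= 2 * C ^+ 2 * r ^+ 4 * (slope c i * sig i ^+ 2).
      exact: ler_wpM2r.
    have -> : e i ^+ 2 * (8 * sig i ^+ 2 + 130) = 16 * (expR 8 * expR 8) *
       (8 * (slope c i * (slope c i * sig i ^+ 2)) + 130 * slope c i ^+ 2) by rewrite /e; ring.
    rewrite -expRD (_ : 8 + 8 = 16); last by ring.
    apply: ler_wpM2l; first by rewrite mulr_ge0// expR_ge0.
    lra.
  rewrite -mulr_sumr big_split/= -!mulr_sumr.
  rewrite sJ in hq.
  have hG : dimension c * ln (dimension c) <= 8 * r ^+ 9.
    have -> : 8 * r ^+ 9 = r ^+ 8 * (8 * r) by ring.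
    by rewrite -Jr ler_pM2l.
  have C2 : 1 <= C ^+ 2 by rewrite expr_ge1// ltW.
  have C24 : C ^+ 2 <= C ^+ 4.
    by have -> : C ^+ 4 = C ^+ 2 * C ^+ 2 :> R; [ring|rewrite ler_peMl// sqr_ge0].
  have r14 k : (k <= 14)%N -> r ^+ k <= r ^+ 14 by move=> k14; apply: ler_weXn2l.
  have s1 : 16 * C ^+ 2 * r ^+ 4 * (\sum_(1 <= i < N) slope c i * sig i ^+ 2) <= 256 * C ^+ 4 * r ^+ 14.
    apply: (@le_trans _ _ (16 * C ^+ 2 * r ^+ 4 * (2 * 1 * (8 * r ^+ 9)))).
      apply: ler_wpM2l; first by apply: mulr_ge0; [apply: mulr_ge0 => //; exact: sqr_ge0|exact: exprn_even_ge0].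
      apply: le_trans hs _; apply: ler_pM => //; [lra|exact: ltW|lra].
    have -> : 16 * C ^+ 2 * r ^+ 4 * (2 * 1 * (8 * r ^+ 9)) = 256 * (C ^+ 2 * r ^+ 13) by ring.
    rewrite -[leRHS]mulrA ler_pM2l//.
    by apply: ler_pM; [exact: sqr_ge0|exact: exprn_ge0 (ltW r0)|exact: C24|exact: r14].
  have s2 : 130 * (\sum_(1 <= i < N) slope c i ^+ 2) <= 130 * 128 * C ^+ 4 * r ^+ 14.
    apply: (@le_trans _ _ (130 * (128 * C ^+ 4 * r ^+ 4 * dimension c))).
      by rewrite ler_pM2l.
    rewrite Jr.
    have -> : 130 * (128 * C ^+ 4 * r ^+ 4 * r ^+ 8) = 130 * 128 * C ^+ 4 * r ^+ 12 by ring.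
    by apply: ler_wpM2l; [rewrite mulr_ge0// exprn_even_ge0|exact: r14].
  have r140 : 0 <= r ^+ 14 by rewrite exprn_ge0// ltW.
  (* Here [512 * 528 = 16 * (256 + 130 * 128)]. As the constant is at least 1, it is below its own
     square. *)
  apply: (@le_trans _ _ (noise_const C * r ^+ 14)).
    have -> : noise_const C * r ^+ 14 =
       16 * expR 16 * (256 * C ^+ 4 * r ^+ 14 + 130 * 128 * C ^+ 4 * r ^+ 14).
      by rewrite /noise_const; ring.
    by apply: ler_wpM2l; [rewrite mulr_ge0// expR_ge0|exact: lerD].
  rewrite /B exprMn -exprM; apply: ler_wpM2r => //.
  by rewrite expr2 ler_peMl//; lra.
have [E [mE PE EH]] := noise_total_variation HZ len0 B0 t0 e0 fe eB.
exists E; split => //; apply: le_trans PE _; rewrite lee_fin.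
have -> : 2 * (2 / Lam) * B / t = 16 * noise_const C / (gain_const C * r) / ln (dimension c).
  rewrite /t /B Jr; field; rewrite !gt_eqF//; move: hJ; rewrite Jr; lra.
have X0 : 0 <= 16 * noise_const C / (gain_const C * r).
  have K0 : 0 <= 16 * noise_const C by move: K1; move: (noise_const C) => K; lra.
  by apply: divr_ge0; [exact: K0|exact: mulr_ge0 (ltW g0) (ltW r0)].
move: X0; rewrite -/r; move: (16 * noise_const C / (gain_const C * r)) => X X0.
by rewrite ler_pdivrMr ?(lt_le_trans _ hJ)// ler_peMr.
Qed.

Lemma likely_lower eta N : 0 < eta -> 4 <= Lam -> C ^+ 2 <= n%:R ->
  (3 + 2 * p) * (8 + 4 * ln C) <= Num.sqrt Lam ->
  720 * (8 * (3 + 2 * p)) ^+ 6 * (32 * noise_const C / (gain_const C * eta)) <= Lam ->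
  likely P eta (fun o => forall k, (k < (Num.truncn (Lam ^+ 2)).+1)%N ->
    ((k%:R / Lam)%:E < alpha_low p kappa mu n (low_const C))%E ->
    8 + 4 * ln C <= ln (dimension (k%:R / Lam)) /\
    forall a, k%:R / Lam <= a <= k%:R / Lam + 2 / Lam ->
     `|\sum_(1 <= i < N) (shr a i - shr (k%:R / Lam + 2 / Lam) i) * noise (2 * sig i) (Z i o)| <=
     gain_const C * (dimension (k%:R / Lam) * ln (dimension (k%:R / Lam))) / (4 * Lam)).
Proof.
move=> eta0 L4 Cn hS hL; have L0 := Lam_gt0 n1; have C0 := C_gt0 C1; have P0 := p0.
have g0 := gain_const_gt0 C0; have K1 := noise_const_ge1 C1.
have lC : 0 <= ln C by exact: ln_ge0.
pose D := 8 * (3 + 2 * p); have D0 : 0 < D by rewrite /D; lra.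
have s0 : 0 < Num.sqrt Lam by rewrite sqrtr_gt0.
have s2 : Num.sqrt Lam ^+ 2 = Lam by rewrite sqr_sqrtr// ltW.
have sL : 1 <= Num.sqrt Lam by rewrite -[leLHS]sqrtr1; apply: ler_wsqrtr; lra.
pose R0 := expR (Num.sqrt Lam / D).
have R00 : 0 < R0 by exact: expR_gt0.
pose x := 16 * noise_const C / (gain_const C * R0).
have x0 : 0 < x.
  have K0 : 0 < 16 * noise_const C by move: K1; move: (noise_const C) => K; lra.
  by apply: divr_gt0; [exact: K0|exact: mulr_gt0].
(* Union bound: cells of length [1 / Lam] cover [[0, Lam]], and [x] bounds the failure probability
   of each. *)
have hx : (Num.truncn (Lam ^+ 2)).+1%:R * x <= eta.
  have /andP[tr _] := truncn_itv (sqr_ge0 Lam).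
  have hR := expR_sqrt_ge L0 D0 hL; rewrite -/R0 in hR.
  move: K1 x0 hR; rewrite /x; move: (noise_const C) => K K1 x0 hR.
  apply: (@le_trans _ _ (2 * Lam ^+ 2 * (16 * K / (gain_const C * R0)))).
    rewrite ler_pM2r// -natr1.
    have L21 : 1 <= Lam ^+ 2 by rewrite expr_ge1 ?(ltW L0)//; apply: le_trans L4; rewrite ler1n.
    by rewrite mulr2n mulrDl mul1r; exact: lerD.
  have -> : 2 * Lam ^+ 2 * (16 * K / (gain_const C * R0)) =
      Lam ^+ 2 * (32 * K / (gain_const C * eta)) / R0 * eta.
    by field; rewrite !gt_eqF.
  by rewrite ler_piMl ?(ltW eta0)// ler_pdivrMr// mul1r.
apply: likely_weaken hx (fun o h => h) _.
apply: likely_forall_lt => k _.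
set c := k%:R / Lam.
have c0 : 0 <= c by rewrite divr_ge0// ltW.
(* Whether a cell lies to the left of [alpha_low] is deterministic; for the others nothing is
   claimed. *)
have [hc|hc] := boolP (c%:E < alpha_low p kappa mu n (low_const C))%E; last first.
  by apply: likely_weaken (ltW x0) _ (likelyT P (Q := fun=> True) (fun=> I)) => // o _.
have cS : c <= Num.sqrt Lam.
  rewrite -lee_fin; apply: le_trans (ltW hc) _.
  by rewrite /alpha_low ge_min lexx orbT.
have rS : rate c <= (3 + 2 * p) * Num.sqrt Lam.
  have -> : rate c = rate 0 + 2 * c by rewrite -rateD add0r.
  by rewrite rate0; nra.
have r1 := rate_ge1 p0 c0.
(* The cap in [alpha_low] gives [c <= sqrt Lam], hence [rate c <= (3 + 2 p) sqrt Lam]. The further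
   factor 8 in [D] accounts for the power [J^(1/8)] in [likely_cell]. *)
have lJ : Num.sqrt Lam / (3 + 2 * p) <= ln (dimension c).
  rewrite ln_dimension ler_pdivlMr; last by lra.
  rewrite mulrAC ler_pdivrMr; last by lra.
  apply: (@le_trans _ _ (Num.sqrt Lam * ((3 + 2 * p) * Num.sqrt Lam))).
    by rewrite ler_pM2l.
  by rewrite -[in leRHS]s2 le_eqVlt; apply/orP; left; apply/eqP; ring.
have hJ : 8 + 4 * ln C <= ln (dimension c).
  by apply: le_trans lJ; rewrite ler_pdivlMr; [rewrite mulrC|lra].
have hJ1 : 1 <= ln (dimension c) by lra.
apply: likely_weaken (likely_cell N Cn c0 hJ1 hc).
  rewrite /x; apply: ler_wpM2l; first by lra.
  rewrite lef_pV2 ?posrE ?mulr_gt0 ?expR_gt0// ler_pM2l// ler_expR.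
  apply: le_trans (_ : 8^-1 * (Num.sqrt Lam / (3 + 2 * p)) <= _); last by rewrite ler_pM2l.
  by rewrite le_eqVlt /D; apply/orP; left; apply/eqP; field; lra.
by move=> o h _; split.
Qed.

End events.

Section good.
Context d (T : measurableType d) {R : realType} (P : probability T R).
Variable Z : nat -> T -> R.
Hypothesis HZ : iid_std_normal P Z.
Variables (p C : R) (kappa mu : nat -> R) (n : nat) (beta Q : R).
Hypotheses (p0 : 0 <= p) (C1 : 1 <= C) (Hkappa : kappa_cond p C kappa).
Hypotheses (n1 : 1 < n%:R :> R) (beta0 : 0 < beta).
Hypothesis HQ : forall N, \sum_(1 <= i < N) expR (2 * beta * ln i%:R) * mu i ^+ 2 <= Q.
Local Notation Lam := (ln (n%:R : R)).
Local Notation rate := (rate p).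
Local Notation dimension := (dimension p (n%:R : R)).
Local Notation shr := (shr kappa (n%:R : R)).
Local Notation ell_term := (ell_term kappa mu n).
Implicit Types (a b c : R) (i N : nat).

Lemma alpha_up_ge L : rate beta <= Lam -> 2 * C ^+ 4 * Q <= L * Lam ^+ 2 ->
  (beta%:E <= alpha_up p kappa mu n L)%E.
Proof.
move=> rL hL; apply: le_ereal_inf_tmp => _ [a [a0 ha] <-]; rewrite lee_fin leNgt.
apply/negP => ab; have := h_le_small p0 C1 Hkappa n1 beta0 HQ a0 (ltW ab) rL.
by move=> /(lt_le_trans ha) /(le_lt_trans hL); rewrite ltxx.
Qed.

Lemma likely_posterior_variance b q eta : 0 < eta -> 0 <= b -> 1 < q -> q <= rate b ->
  likely P eta (fun o => forall N, \sum_(1 <= i < N) shr b i * Z i o ^+ 2 <=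
    C ^+ 2 * (expR (q * ln 2) / (q - 1)) * dimension b / eta).
Proof.
move=> eta0 b0 q1 qb.
have s0 i : 0 <= shr b i.
  by case: i => [|i]; [rewrite shr_index0|exact: (shr_ge0 C1 Hkappa n1)].
apply: likely_series_bounded => //.
- apply: mulr_gt0; last exact: dimension_gt0.
  apply: mulr_gt0; first by rewrite exprn_gt0// (C_gt0 C1).
  by apply: divr_gt0; [exact: expR_gt0|lra].
- by move=> i; exact: (measurable_iid_sqr HZ).
- by move=> i o; rewrite mulr_ge0 ?sqr_ge0.
- move=> N; under eq_bigr do rewrite (iid_sqr HZ) ?s0//.
  by rewrite sumEFin lee_fin; exact: (shr_sum_le p0 C1 Hkappa n1).
Qed.

Lemma likely_good eta L : 0 < eta -> 4 <= Lam -> C ^+ 2 <= n%:R ->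
  (3 + 2 * p) * (8 + 4 * ln C) <= Num.sqrt Lam ->
  720 * (8 * (3 + 2 * p)) ^+ 6 * (32 * noise_const C / (gain_const C * eta)) <= Lam ->
  rate beta <= Lam -> 2 * C ^+ 4 * Q <= L * Lam ^+ 2 -> 2 <= beta * Lam ->
  L = 2 * expR 20 * (3 + 2 * p) ^+ 2 + 1 ->
  (let K2 := C ^+ 2 * (expR ((1 + beta) * ln 2) / (1 + beta - 1)) in
   2 * expR 16 * (3 + 2 * p) * (expR 4 * ((1 + 2 * ln C) * K2 + K2 / eta) + 1 + 2 * C ^+ 4 * Q)
     <= Lam) ->
  likely P (eta + (eta + (eta + eta))) (good_event Z p kappa mu n (low_const C) L).
Proof.
move=> eta0 L4 Cn hS hL rL hQ bL LE hK2.
have L0 := Lam_gt0 n1; have C0 := C_gt0 C1; have n0 := nu_gt0 n1; have P0 := p0.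
have b0 := beta0.
have A1 := likely_log_series HZ eta0.
have A2 : likely P eta (fun o => cvgn (fun N => \sum_(1 <= i < N) shr 0 i * noise 0 (Z i o))).
  apply: (likely_centered_cvg HZ (A := C ^+ 2 * n%:R)) => //.
  - by rewrite mulr_gt0// exprn_gt0.
  - by move=> [|i]; [rewrite shr_index0|exact: (shr_ge0 C1 Hkappa n1)].
  - move=> i i0; have := shr_le C1 Hkappa n1 0 i0; rewrite le_min => /andP[_ /le_trans]; apply.
    have := snr_le_inv p0 C1 Hkappa n1 i0 (lexx (0 : R)).
    by rewrite mulr0 mul0r oppr0 expR0 div1r.
have aup := alpha_up_ge rL hQ.
have Li : 0 < 1 / Lam by rewrite divr_gt0.
have L2 : 2 / Lam = 1 / Lam + 1 / Lam by field; rewrite gt_eqF.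
have Lb : 1 / Lam <= beta / 2.
  by rewrite ler_pdivrMr// mulrAC ler_pdivlMr// mul1r.
(* With [1 / Lam <= beta / 2], stepping left of [alpha_up] costs at most half of [2 beta];
   [q = 1 + beta] thus serves for all [n] and [mu]. *)
have qb r : beta <= r -> 1 + beta <= rate (r - 1 / Lam).
  move=> br; have -> : rate (r - 1 / Lam) = rate 0 + 2 * (r - 1 / Lam).
    by rewrite -rateD add0r.
  by rewrite rate0; lra.
(* An infinite [alpha_up] makes the upper bound void; the hypothesis [alpha_up = r%:E] covers the
   remaining case. *)
have A3 : likely P eta (fun o => forall r, alpha_up p kappa mu n L = r%:E -> forall N,
    \sum_(1 <= i < N) shr (r - 1 / Lam) i * Z i o ^+ 2 <=
    C ^+ 2 * (expR ((1 + beta) * ln 2) / (1 + beta - 1)) * dimension (r - 1 / Lam) / eta).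
  case E : (alpha_up p kappa mu n L) aup => [r| |] aup.
  - rewrite lee_fin in aup.
    have h1 : 1 < 1 + beta by lra.
    have h2 : 0 <= r - 1 / Lam by lra.
    apply: likely_weaken (likely_posterior_variance eta0 h2 h1 (qb r aup)) => // o h r' [<-].
    exact: h.
  - by apply: likely_weaken (ltW eta0) _ (likelyT P (Q := fun=> True) (fun=> I)).
  - by apply: likely_weaken (ltW eta0) _ (likelyT P (Q := fun=> True) (fun=> I)).
have A4 := likely_infinitely_often
  (fun N => likely_lower HZ p0 C1 Hkappa n1 beta0 HQ N eta0 L4 Cn hS hL).
apply: likely_weaken (lexx _) _ (likely_and A1 (likely_and A2 (likely_and A3 A4))).
move=> o [h1 [h2 [h3 h4]]] a [/andP[a0 aL] amax].
have cv b : 0 <= b -> cvgn (fun N => \sum_(1 <= i < N) ell_term (fun i => Z i o) b i).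
  by move=> b0'; exact: (ell_cvg p0 C1 Hkappa n1 beta0 HQ b0' h1 h2).
split.
  rewrite leNgt; apply/negP => alow.
  (* The grid cell containing the maximizer; the likelihood at [a] is beaten by the one at
     [c + 2 / Lam], at distance between [1 / Lam] and [2 / Lam] to the right of [a]. *)
  pose k := Num.truncn (a * Lam); pose c := k%:R / Lam.
  have aL0 : 0 <= a * Lam by rewrite mulr_ge0// ltW.
  have /andP[k1 k2] := truncn_itv aL0.
  have ca : c <= a by rewrite ler_pdivrMr.
  have ac : a <= c + 1 / Lam.
    by rewrite -mulrDl ler_pdivlMr// natr1 ltW.
  have c0 : 0 <= c by rewrite divr_ge0// ltW.
  have hc : (c%:E < alpha_low p kappa mu n (low_const C))%E.
    by apply: le_lt_trans alow; rewrite lee_fin.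
  have kK : (k < (Num.truncn (Lam ^+ 2)).+1)%N.
    by rewrite ltnS; apply: le_truncn; rewrite expr2 ler_pM2r.
  have aS : a <= Num.sqrt Lam.
    rewrite -lee_fin; apply: le_trans (ltW alow) _.
    by rewrite /alpha_low ge_min lexx orbT.
  (* The competitor must stay in the range of the argmax: [c <= sqrt Lam <= Lam / 2] and
     [2 / Lam <= 1 / 2], by [4 <= Lam]. *)
  have bL' : c + 2 / Lam <= Lam.
    have s2 : Num.sqrt Lam ^+ 2 = Lam by rewrite sqr_sqrtr// ltW.
    have s4 : 2 <= Num.sqrt Lam.
      have -> : 2 = Num.sqrt (2 ^+ 2) :> R by rewrite sqrtr_sqr ger0_norm.
      by apply: ler_wsqrtr; lra.
    have : 2 / Lam <= 2^-1 by rewrite ler_pdivrMr//; lra.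
    have : 2 * Num.sqrt Lam <= Num.sqrt Lam * Num.sqrt Lam.
      by rewrite ler_wpM2r//; lra.
    by rewrite -expr2 s2; lra.
  have bb0 : 0 <= c + 2 / Lam by lra.
  have e0 : 0 < gain_const C * (dimension c * ln (dimension c)) / (2 * Lam).
    apply: divr_gt0; last by apply: mulr_gt0.
    by apply: mulr_gt0; [exact: gain_const_gt0|exact: (effective_gt0 p0 n1)].
  have := ell_lt C1 Hkappa n1 e0 (cv a a0) (cv _ bb0) _.
  have hlt : forall N0, exists2 N, (N0 <= N)%N &
      gain_const C * (dimension c * ln (dimension c)) / (2 * Lam) <=
      \sum_(1 <= i < N) (ell_term (fun i => Z i o) a i - ell_term (fun i => Z i o) (c + 2 / Lam) i).
    (* Truncating beyond [n] keeps every index used by the gain in [gain_sum_ge]. *)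
    move=> N0; have [N NN HN] := h4 (maxn N0 n.+1).
    exists N; first by apply: leq_trans NN; rewrite leq_maxl.
    have [hJ hX] := HN k kK hc.
    apply: (lower_cell p0 C1 Hkappa n1 beta0 HQ Cn c0 ca ac hJ _ hc).
      by rewrite ltr_nat; apply: leq_trans NN; rewrite leq_maxr.
    by apply: hX; apply/andP; split => //; rewrite -/c; lra.
  move=> /(_ hlt); apply/negP; rewrite -leNgt; apply: amax.
  by rewrite bb0 bL'.
rewrite leNgt; apply/negP => alt.
case E : (alpha_up p kappa mu n L) aup alt => [r| |]// aup alt.
rewrite lee_fin in aup; rewrite lte_fin in alt.
(* The infimum [r] need not be attained, so a point [a1] of the set is taken in [[r, r + 1 / Lam)],
   to the left of [a]; its distance to [b = r - 1 / Lam] lies between [1 / Lam] and [2 / Lam]. *)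
have : (alpha_up p kappa mu n L < (Num.min a (r + 1 / Lam))%:E)%E.
  by rewrite E lte_fin lt_min alt; lra.
move=> /ereal_inf_lt[_ [a1 [a10 ha1] <-]]; rewrite lte_fin lt_min => /andP[a1a a1r].
have ra1 : r <= a1.
  by rewrite -lee_fin -E; apply: ereal_inf_lbound; exists a1.
pose b := r - 1 / Lam.
have bb0 : 0 <= b by rewrite /b; lra.
have [N0 hN0] := h_lt_slope_sig p0 C1 Hkappa n1 beta0 HQ (ltW a10) ha1.
have hlt : forall N, (N0 <= N)%N ->
    1 <= \sum_(1 <= i < N) (ell_term (fun i => Z i o) a i - ell_term (fun i => Z i o) b i).
  move=> N NN; have q1 : 1 < 1 + beta by lra.
  have Lam1 : 1 <= Lam by lra.
  have d1 : 1 / Lam <= a1 - b by rewrite /b; lra.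
  have d2 : a1 - b <= 2 / Lam by rewrite /b L2; lra.
  exact: (upper_cell p0 C1 Hkappa n1 beta0 HQ Lam1 bb0 eta0 q1 (qb r aup) d1 d2 (ltW a1a) aL
    LE erefl hK2 (fun N h => ltW (hN0 N h)) (h3 r E) NN).
have := ell_lt C1 Hkappa n1 (ltr01 : 0 < 1 :> R) (cv a a0) (cv b bb0) _.
have hio : forall N1, exists2 N, (N1 <= N)%N &
    1 <= \sum_(1 <= i < N) (ell_term (fun i => Z i o) a i - ell_term (fun i => Z i o) b i).
  move=> N1; exists (maxn N0 N1); first by rewrite leq_maxr.
  by apply: hlt; rewrite leq_maxl.
move=> /(_ hio); apply/negP; rewrite -leNgt; apply: amax.
by rewrite bb0 /b; lra.
Qed.

End good.

(** * Reduction of both balls to one weighted sum *)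

Section balls.
Context {R : realType}.
Implicit Types (beta gamma Rad : R) (mu : nat -> R).

Lemma partial_sum_le (f : nat -> R) (r : R) : (forall i, 0 <= f i) ->
  (\sum_(1 <= i <oo) (f i)%:E <= r%:E)%E -> forall N, \sum_(1 <= i < N) f i <= r.
Proof.
move=> f0 h N; rewrite -lee_fin -sumEFin; apply: le_trans h.
by apply: nneseries_lim_ge => i _ _; rewrite lee_fin.
Qed.

Lemma sobolev_ball_sum beta Rad mu : sobolev_ball beta Rad mu ->
  forall N, \sum_(1 <= i < N) expR (2 * beta * ln i%:R) * mu i ^+ 2 <= Rad ^+ 2.
Proof.
move=> [_ /partial_sum_le h] N.
apply: le_trans (h _ N); last by move=> i; rewrite mulr_ge0 ?powR_ge0 ?sqr_ge0.
by apply: ler_sum_nat => i /andP[i0 _]; rewrite powRnE.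
Qed.

(** [ln x < x] at [x = i gamma / beta] gives [i^(2 beta) <= (beta / gamma)^(2 beta) expR (2 gamma
    i)]: an analytic ball lies in a Sobolev ball of order [beta]. *)
Lemma analytic_ball_sum beta gamma Rad mu : 0 < beta -> 0 < gamma ->
  analytic_ball gamma Rad mu ->
  forall N, \sum_(1 <= i < N) expR (2 * beta * ln i%:R) * mu i ^+ 2 <=
    expR (2 * beta * ln (beta / gamma)) * Rad ^+ 2.
Proof.
move=> b0 g0 [_ /partial_sum_le h] N.
have {}h := h (fun i => mulr_ge0 (expR_ge0 _) (sqr_ge0 _)) N.
apply: le_trans (ler_wpM2l (expR_ge0 _) h); rewrite mulr_sumr.
apply: ler_sum_nat => i /andP[i0 _]; rewrite [leRHS]mulrA; apply: ler_wpM2r; first exact: sqr_ge0.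
have i0' : 0 < i%:R :> R by rewrite ltr0n.
rewrite -expRD ler_expR.
have x0 : 0 < i%:R * gamma / beta by rewrite divr_gt0// mulr_gt0.
have := ltW (ln_sublinear x0).
have -> : ln (i%:R * gamma / beta) = ln i%:R - ln (beta / gamma).
  by rewrite !ln_div ?lnM ?posrE ?mulr_gt0//; ring.
rewrite ler_pdivlMr// => h2; lra.
Qed.

End balls.

Lemma likely_probability d (T : measurableType d) (R : realType) (P : probability T R)
    (x : R) (Q : T -> Prop) : likely P x Q ->
  exists A : set T, measurable A /\ A `<=` Q /\ ((1 - x)%:E <= P A)%E.
Proof.
move=> [E [mE PE EQ]]; exists E; split => //; split => //.
have := probability_setC P (measurableC mE); rewrite setCK => ->.
by rewrite EFinB; apply: leeB.
Qed.

Unset Implicit Arguments.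

Theorem theorem2p1 (R : realType) (p C : R) (kappa : nat -> R)
    (beta gamma Rad : R) (analytic : bool) :
  0 <= p -> 1 <= C -> kappa_cond p C kappa ->
  0 < beta -> 0 < gamma -> 0 < Rad ->
  exists l L : R, 0 < l /\ l < L /\
  forall (d : measure_display) (T : measurableType d) (P : probability T R)
         (Z : nat -> T -> R),
  iid_std_normal P Z ->
  forall eps : R, 0 < eps ->
  exists N : nat, forall n : nat, (N <= n)%N ->
  forall mu0 : nat -> R,
    (if analytic then analytic_ball gamma Rad mu0 else sobolev_ball beta Rad mu0) ->
    exists A : set T, measurable A /\ A `<=` good_event Z p kappa mu0 n l L /\
      ((1 - eps)%:E <= P A)%E.

Proof.
move=> p0 C1 Hk b0 g0 Rad0.
have C0 : 0 < C by lra.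
(* The constants [l] and [L] are built from [p] and [C] alone; the ball enters through the threshold
   for [n]. *)
pose L := 2 * expR 20 * (3 + 2 * p) ^+ 2 + 1.
have L1 : 1 < L.
  rewrite /L ltrDr; apply: mulr_gt0; first by apply: mulr_gt0 => //; exact: expR_gt0.
  by rewrite exprn_gt0//; lra.
exists (low_const C), L; split; first exact: low_const_gt0.
split; first exact: le_lt_trans (low_const_le1 C1) L1.
move=> d T P Z HZ eps eps0.
pose Q := (if analytic then expR (2 * beta * ln (beta / gamma)) else 1) * Rad ^+ 2.
have HQ mu0 : (if analytic then analytic_ball gamma Rad mu0 else sobolev_ball beta Rad mu0) ->
    forall N, \sum_(1 <= i < N) expR (2 * beta * ln i%:R) * mu0 i ^+ 2 <= Q.
  rewrite /Q; case: (analytic) => [|/sobolev_ball_sum]; last by rewrite mul1r.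
  exact: analytic_ball_sum.
pose eta := eps / 4; have eta0 : 0 < eta by rewrite divr_gt0.
pose A := (3 + 2 * p) * (8 + 4 * ln C).
pose B := 720 * (8 * (3 + 2 * p)) ^+ 6 * (32 * noise_const C / (gain_const C * eta)).
pose K2 := C ^+ 2 * (expR ((1 + beta) * ln 2) / (1 + beta - 1)).
pose D := 2 * expR 16 * (3 + 2 * p) *
  (expR 4 * ((1 + 2 * ln C) * K2 + K2 / eta) + 1 + 2 * C ^+ 4 * Q).
(* The maximum of all lower bounds required of [ln n]. It involves [mu0] only through [Q], whence
   uniformity over the ball; each of the four events gets the share [eps / 4]. *)
pose Lam0 := \big[Num.max/4]_(x <- [:: 2 * ln C; A ^+ 2; B; rate p beta; 2 * C ^+ 4 * Q; 2 / beta; D]) x.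
exists (Num.truncn (expR Lam0)).+1 => n Nn mu0 /HQ Hmu.
have nL : expR Lam0 <= n%:R.
  apply: le_trans (_ : (Num.truncn (expR Lam0)).+1%:R <= _); last by rewrite ler_nat.
  by rewrite ltW// truncnS_gt.
have n0 : 0 < n%:R :> R by apply: lt_le_trans nL; exact: expR_gt0.
have : Lam0 <= ln n%:R by rewrite -[Lam0]expRK ler_ln ?posrE ?expR_gt0.
rewrite /Lam0 !big_cons big_nil !ge_max.
move=> /andP[hC /andP[hA /andP[hB /andP[hr /andP[hQ /andP[hb /andP[hD h4]]]]]]].
have n1 : 1 < n%:R :> R by rewrite ltNge; apply/negP => /ln_le0; lra.
have S : eps = eta + (eta + (eta + eta)) by rewrite /eta; field.
rewrite S; apply: likely_probability.
apply: (likely_good HZ p0 C1 Hk n1 b0 Hmu eta0 h4) => //.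
- have -> : C ^+ 2 = expR (2 * ln C) by rewrite expRM_natl lnK.
  by rewrite -[leRHS](lnK (x := _)) ?posrE// ler_expR.
- have lC : 0 <= ln C by exact: ln_ge0.
  rewrite -/A -[A]ger0_norm; last by rewrite mulr_ge0//; lra.
  by rewrite -sqrtr_sqr; exact: ler_wsqrtr.
- apply: le_trans hQ _; rewrite -[leLHS]mul1r; apply: ler_pM => //; [lra|exact: ltW|].
  by rewrite expr2 ler_peMl//; lra.
- by rewrite mulrC -ler_pdivrMr.
Qed.

Unset Implicit Arguments.
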